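(* Let $\mathbb{T}=S_1\cup S_2\cup S_3=S_1'\cup S_2'\cup S_3'$ be two measurable partitions of the unit circle with $m(S_k)=m(S_k')$ for $k=1,2,3$, and let $\Delta_1,\Delta_2,\Delta_3\in M_2$ be selfadjoint matrices such that, with $\Delta=\sum_{k=1}^3\Delta_k1_{S_k}$ and $\Delta'=\sum_{k=1}^3\Delta_k1_{S_k'}$, one has $\sum_{n\ge1}|\widehat{\Delta}(n)|^2\neq\sum_{n\ge1}|\widehat{\Delta'}(n)|^2$. For $0<\varepsilon<1/\|\Delta\|_\infty$ define the matrix weights $$W_\varepsilon=I+\varepsilon\Delta,\qquad W_\varepsilon'=I+\varepsilon\Delta',$$ and let $w_\varepsilon=\sqrt{W_\varepsilon}$, $w_\varepsilon'=\sqrt{W_\varepsilon'}$ (pointwise positive square roots). Then there exists $0<\varepsilon_0<1$ such that whenever $0<\varepsilon<\varepsilon_0$, $$|F_{W_\varepsilon}(0)|^2\neq|F_{W'_\varepsilon}(0)|^2 .$$ Thus, whenever $0<\varepsilon<\varepsilon_0$, the two interpolation families $\{\ell^2_{w_\varepsilon(\gamma)}:\gamma\in\mathbb{T}\}$ and $\{\ell^2_{w_\varepsilon'(\gamma)}:\gamma\in\mathbb{T}\}$ have the same distribution and take only 3 distinct values, but their interpolation spaces at $0$, which are respectively $\ell^2_{F_{W_\varepsilon}(0)}$ and $\ell^2_{F_{W'_\varepsilon}(0)}$, are different: $$\ell^2_{F_{W_\varepsilon}(0)}\neq\ell^2_{F_{W'_\varepsilon}(0)} .$$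
   Context: $\mathbb{D}$ is the open unit disc, $\mathbb{T}$ the unit circle with normalized Lebesgue measure $m$. $M_N$ is the space of complex $N\times N$ matrices (here $N=2$), $|A|^2=A^*A$, $\widehat{\Delta}(n)=\int\gamma^{-n}\Delta(\gamma)\,dm(\gamma)$, and $\|\Delta\|_\infty$ is the essential supremum of the operator norm of $\Delta(\gamma)$. $S_2^N$ denotes $M_N$ with the Hilbert–Schmidt norm; elements of the Hardy space $H^2(\mathbb{T};S_2^N)$ are identified with their holomorphic extensions to $\mathbb{D}$. A matrix weight is a measurable $W:\mathbb{T}\to M_N$ with $cI\le W(\gamma)\le CI$ a.e. for some constants $c,C>0$. A right outer function associated to $W$ is an $F\in H^2(\mathbb{T};S_2^N)$ with $F(\gamma)^*F(\gamma)=W(\gamma)$ a.e. and $F\cdot H^2(\mathbb{T};S_2^N)$ dense in $H^2(\mathbb{T};S_2^N)$. Such $F$ exists (Helson–Lowdenslager) and is unique up to left multiplication by a constant unitary matrix; $F_W$ denotes the unique one with $F_W(0)$ positive. For $A\in GL_N(\mathbb{C})$, $\ell^2_A=(\mathbb{C}^N,\|\cdot\|_A)$ with $\|x\|_A=\|Ax\|_{\ell_2^N}$. For a family of norms $E_\gamma=(\mathbb{C}^N,\|\cdot\|_\gamma)$, $\gamma\in\mathbb{T}$, measurable in $\gamma$ and uniformly equivalent to the Euclidean norm, the interpolation space at $0$ is $\mathbb{C}^N$ with norm $\|x\|_{E[0]}=\inf\{\operatorname{ess\,sup}_{\gamma}\|f(\gamma)\|_{\gamma}\}$, the infimum over bounded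 analytic $f:\mathbb{D}\to\mathbb{C}^N$ with $f(0)=x$ ($f(\gamma)$ being the boundary values). *)

(* Defs.v *)
From HB Require Import structures.
From mathcomp Require Import all_boot all_order all_algebra.
From mathcomp Require Import all_classical all_reals all_analysis.
From mathcomp Require Import ess_sup_inf.
From mathcomp Require Export complex.

Set Implicit Arguments.
Unset Strict Implicit.
Unset Printing Implicit Defensive.

Import Order.TTheory GRing.Theory Num.Theory.
Import numFieldNormedType.Exports.

Local Open Scope classical_set_scope.
Local Open Scope ring_scope.
Local Open Scope sesquilinear_scope.

(* Lebesgue-measurable (rather than Borel) subsets of the line. *)
Notation lebesgueType R :=
  (caratheodory_type (mu_ext (wlength (@idfun R)))).

Definition circle (R : realType) : Type := {z : R[i] | `|z| == 1}.

Section circle.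
Variable R : realType.

Definition expi (t : R) : R[i] :=
  Complex (cos (2 * pi * t)) (sin (2 * pi * t)).

Lemma norm_expi (t : R) : `|expi t| == 1.
Proof. by rewrite normc_def /= cos2Dsin2 sqrtr1. Qed.

Definition circle_of (t : lebesgueType R) : circle R :=
  exist _ (expi t) (norm_expi t).

HB.instance Definition _ := Choice.on (circle R).
HB.instance Definition _ := isPointed.Build (circle R) (circle_of 0).

(* A set of points of the circle is measurable when the set of its arguments is
   Lebesgue measurable. *)
Definition circle_measurable : set (set (circle R)) :=
  image_set_system [set: lebesgueType R] circle_of measurable.

Lemma circle_sigma_algebra : sigma_algebra setT circle_measurable.
Proof. exact/sigma_algebra_image/sigma_algebra_measurable. Qed.

Lemma circle_measurable0 : circle_measurable set0.
Proof. by case: circle_sigma_algebra. Qed.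

Lemma circle_measurableC A : circle_measurable A -> circle_measurable (~` A).
Proof. by case: circle_sigma_algebra => _ + _; rewrite -setTD; exact. Qed.

Lemma circle_measurable_bigcup (F : (set (circle R))^nat) :
  (forall i, circle_measurable (F i)) -> circle_measurable (\bigcup_i (F i)).
Proof. by case: circle_sigma_algebra => _ _; exact. Qed.

HB.instance Definition _ := @isMeasurable.Build default_measure_display
  (circle R) circle_measurable circle_measurable0 circle_measurableC
  circle_measurable_bigcup.

Lemma measurable_circle_of : measurable_fun setT circle_of.
Proof. by move=> _ A mA. Qed.

Lemma measurable_unit_interval :
  measurable (`[0, 1[%classic : set (lebesgueType R)).
Proof.
exact: (@sub_caratheodory _ _ _ (wlength idfun) `[0, 1[%classic
  (measurable_itv `[0, 1[)).
Qed.

(* Normalized Lebesgue measure: the image of Lebesgue measure on [0, 1[. *)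
Definition arc_length : set (circle R) -> \bar R :=
  pushforward (mrestr (@completed_lebesgue_measure R) measurable_unit_interval)
    circle_of.

Let arc_length0 : arc_length set0 = 0%E.
Proof. by rewrite /arc_length /pushforward preimage_set0 measure0. Qed.

Let arc_length_ge0 A : (0 <= arc_length A)%E.
Proof. exact: measure_ge0. Qed.

Let arc_length_sigma_additive : semi_sigma_additive arc_length.
Proof.
exact: (@measure_semi_sigma_additive _ _ _ (pushforward _ circle_of)).
Qed.

HB.instance Definition _ := isMeasure.Build _ _ _ arc_length
  arc_length0 arc_length_ge0 arc_length_sigma_additive.

Lemma arc_length_setT : arc_length setT = 1%E.
Proof.
rewrite /arc_length /pushforward preimage_setT /mrestr setTI.
have -> : completed_lebesgue_measure `[0, 1[%classic
    = @lebesgue_measure R `[0, 1[%classic by [].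
by rewrite lebesgue_measure_itv /= lte01 oppr0 adde0.
Qed.

HB.instance Definition _ :=
  Measure_isProbability.Build _ _ _ arc_length arc_length_setT.

End circle.

Section matrices.
Variable R : realType.
Implicit Types p q n : nat.

(* The Hilbert-Schmidt norm; on a column vector, the Euclidean norm. *)
Definition hsnorm p q (A : 'M[R[i]]_(p, q)) : R :=
  Num.sqrt (\sum_i \sum_j ComplexField.Normc.normc (A i j) ^+ 2).

Definition opnorm n (A : 'M[R[i]]_n) : R :=
  sup [set hsnorm (A *m x) | x in [set x : 'cV[R[i]]_n | hsnorm x <= 1]].

(* |A|^2 *)
Definition sqabsmx n (A : 'M[R[i]]_n) : 'M[R[i]]_n := A ^t* *m A.

Definition selfadjoint n (A : 'M[R[i]]_n) := A ^t* = A.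

(* [0 <= z] in R[i] says that z is real and nonnegative, so that A is also
   selfadjoint. *)
Definition posmx n (A : 'M[R[i]]_n) :=
  forall x : 'cV[R[i]]_n, 0 <= (x ^t* *m A *m x) 0 0.

Definition sqrtmx n (A : 'M[R[i]]_n) : 'M[R[i]]_n :=
  xget 0 [set B | posmx B /\ B *m B = A].

(* The norm of the space l^2_A. *)
Definition ell2norm n (A : 'M[R[i]]_n) : 'cV[R[i]]_n -> R :=
  fun x => hsnorm (A *m x).

End matrices.

Section hardy.
Variable R : realType.
Local Notation m := (@arc_length R).
Implicit Types p q n : nat.

Definition measurable_mx p q (F : circle R -> 'M[R[i]]_(p, q)) :=
  forall i j, measurable_fun setT (fun z => complex.Re (F z i j)) /\
              measurable_fun setT (fun z => complex.Im (F z i j)).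

Definition Cintegral (f : circle R -> R[i]) : R[i] :=
  Complex (\int[m]_z complex.Re (f z))%R (\int[m]_z complex.Im (f z))%R.

Definition fourier p q (F : circle R -> 'M[R[i]]_(p, q)) (k : int) :
    'M[R[i]]_(p, q) :=
  \matrix_(i, j) Cintegral (fun z => (val z : R[i]) ^ (- k) * F z i j).

Definition mxseries p q (u : nat -> 'M[R[i]]_(p, q)) : 'M[R[i]]_(p, q) :=
  \matrix_(i, j)
    lim (series (fun k => u k i j : (R[i])^o) @ \oo).

Definition sqnormL2 p q (F : circle R -> 'M[R[i]]_(p, q)) : \bar R :=
  (\int[m]_z (hsnorm (F z) ^+ 2)%:E)%E.

Definition H2 p q (F : circle R -> 'M[R[i]]_(p, q)) :=
  [/\ measurable_mx F, (sqnormL2 F < +oo)%E &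
      forall k : int, k < 0 -> fourier F k = 0].

(* The holomorphic extension to the disc of a function in H^2. *)
Definition holo_ext p q (F : circle R -> 'M[R[i]]_(p, q)) (z : R[i]) :
    'M[R[i]]_(p, q) :=
  mxseries (fun k => z ^+ k *: fourier F k%:Z).

(* Essential supremum of the operator norm. *)
Definition normLoo n (F : circle R -> 'M[R[i]]_n) : \bar R :=
  ess_sup m (fun z => (opnorm (F z))%:E).

Definition matrix_weight n (W : circle R -> 'M[R[i]]_n) :=
  measurable_mx W /\
  exists c C : R, [/\ 0 < c, 0 < C &
    {ae m, forall z, posmx (W z - (c%:C)%C%:M) /\ posmx ((C%:C)%C%:M - W z)}].

(* Since W is essentially bounded in all uses, so is F, and F * H^2 is a
   subspace of H^2. *)
Definition right_outer n (W F : circle R -> 'M[R[i]]_n) :=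
  [/\ H2 F, {ae m, forall z, (F z) ^t* *m F z = W z} &
      forall G : circle R -> 'M[R[i]]_n, H2 G -> forall e : R, 0 < e ->
        exists K : circle R -> 'M[R[i]]_n,
          H2 K /\ (sqnormL2 (fun z => F z *m K z - G z)%R < e%:E)%E].

(* For a matrix weight W this determines F = F_W up to a.e. equality; the left
   unitary factor is fixed because F(0), being invertible, is then positive
   definite. *)
Definition normalized_right_outer n (W F : circle R -> 'M[R[i]]_n) :=
  right_outer W F /\ posmx (holo_ext F 0).

Definition bounded_analytic n (f : R[i] -> 'cV[R[i]]_n) :=
  (forall (z : R[i]) i, `|z| < 1 ->
     derivable ((fun w => f w i 0) : (R[i])^o -> (R[i])^o) z 1) /\
  exists M : R, forall z : R[i], `|z| < 1 -> hsnorm (f z) <= M.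

(* As for H^2, a bounded analytic function on the disc is identified with the
   function on the circle whose holomorphic extension it is. *)
Definition boundary_values n (f : R[i] -> 'cV[R[i]]_n)
    (g : circle R -> 'cV[R[i]]_n) :=
  H2 g /\ forall z, `|z| < 1 -> f z = holo_ext g z.

(* Norm of the interpolation space at 0 of a family of norms E. *)
Definition interp0 n (E : circle R -> 'cV[R[i]]_n -> R) (x : 'cV[R[i]]_n) :
    \bar R :=
  ereal_inf [set s | exists f g, [/\ bounded_analytic f, boundary_values f g,
    f 0 = x & s = ess_sup m (fun z => (E z (g z))%:E)]].

Definition ell2family n (w : circle R -> 'M[R[i]]_n) :
    circle R -> 'cV[R[i]]_n -> R :=
  fun z => ell2norm (w z).

(* All sets of values are allowed here, so this is to be used for families
   taking countably many values, each on a measurable set. *)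
Definition same_distribution T (X Y : circle R -> T) :=
  forall B : set T, m (X @^-1` B) = m (Y @^-1` B).

Definition measurable_partition N (S : 'I_N -> set (circle R)) :=
  [/\ forall k, measurable (S k), trivIset setT S & \bigcup_k S k = setT].

Definition stepmx N n (S : 'I_N -> set (circle R)) (D : 'I_N -> 'M[R[i]]_n) :
    circle R -> 'M[R[i]]_n :=
  fun z => \sum_k \1_(S k) z *: D k.

End hardy.

(* Main.v *)
From HB Require Import structures.
Require Import Defs.
From mathcomp Require Import all_boot all_order all_algebra.
From mathcomp Require Import all_classical all_reals all_analysis.
From mathcomp Require Import measurable_realfun ess_sup_inf.
From mathcomp Require Import ring lra zify.

Set Implicit Arguments.
Unset Strict Implicit.
Unset Printing Implicit Defensive.

Import Order.TTheory GRing.Theory Num.Theory.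
Import numFieldNormedType.Exports.
Local Open Scope classical_set_scope.
Local Open Scope ring_scope.

(**
If F is outer for a weight W bounded above and below, then F^-1 is again a bounded H^2 function,
and |F(0)x|^2 is the minimum of the energies int <W(x+h), x+h> over the h in H^2 with h(0) = 0,
attained at x + h = F^-1 F(0)x. For W = I + eps Delta this energy is
  <(I + eps Delta^(0))x, x> + |h|^2 + 2 eps Re <Delta x, h> + eps <Delta h, h>.
Completing the square, where Bessel's inequality keeps only the positive frequencies of Delta x,
bounds it from below, and the competitors h = - eps sum_(1 <= n <= N) Delta^(n)x z^n bound it from
above, so that
  |F(0)x|^2 = <(I + eps Delta^(0))x, x> - eps^2 sum_(n >= 1) |Delta^(n)x|^2 + O(eps^3).
Since Delta^(0) depends only on the measures of the pieces, Delta and Delta' share the first-order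
part, whereas the second-order terms differ at some x.

The interpolation norm at 0 is |F(0)x|: the essential supremum of |F f| is at least its L^2 norm,
hence at least |F(0)f(0)|, and |F f| is constant for f = F^-1 F(0)x.

There are exactly three values: if two of the Delta_k coincided or a piece were null, then
Delta = A + 1_P E a.e. with the same A and E for both partitions, and the sum over n >= 1 of
|Delta^(n)x|^2 would be |Ex|^2 (m(P) - m(P)^2)/2, which depends only on m(P).
*)

(** * Square-integrable functions on the circle *)

(** The outer function is never computed: everything is read off the form [|F(0)x|^2], and one
    vector [x] with distinct second-order terms separates the matrices. Both estimates hold for each
    fixed eps, with coefficient [eps^2 / (1 - eps B)] in the lower one and [eps^2 (1 - eps B)] in
    the upper one, so nothing is differentiated in eps. Here [B] dominates the forms of all
    [Delta_k], and [eps B <= 1/2] keeps [W] between 1/2 and 3/2. The lower estimate concerns the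
    true minimizer [h], of which one knows only that it lies in H^2 with mean 0. It works because
    [h] cannot alter the frequencies [k <= 0]; turning this into a bound by the positive frequencies
    of [Delta x] takes Parseval, not just Bessel. So completeness of the characters is the analytic
    core. It starts from a trigonometric polynomial of degree 1 that separates an arc from its
    complement, sharpened to an indicator by the peak polynomials; Dynkin's lemma does the rest. As
    [W] is a step function, so is its inverse [V], and [V F^t*] is an inverse of [F] that is visibly
    measurable and bounded; the density clause in the definition of outer serves to put it in
    H^2. *)

Section complex_numbers.
Variable R : realType.
Local Notation C := R[i].
Local Notation Re := complex.Re.
Local Notation Im := complex.Im.
Implicit Types z w : C.

(** The squared modulus is kept real and polynomial in [Re] and [Im], so that identities and
    inequalities between energies are settled by [ring], [nra] and [lra], without square roots. *)
Definition nsq z : R := Re z ^+ 2 + Im z ^+ 2.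

Lemma complex_eqP z w : Re z = Re w -> Im z = Im w -> z = w.
Proof. by case: z w => [a b] [c d] /= -> ->. Qed.

Lemma ReD z w : Re (z + w) = Re z + Re w. Proof. by case: z; case: w. Qed.
Lemma ImD z w : Im (z + w) = Im z + Im w. Proof. by case: z; case: w. Qed.
Lemma ReN z : Re (- z) = - Re z. Proof. by case: z. Qed.
Lemma ImN z : Im (- z) = - Im z. Proof. by case: z. Qed.
Lemma ReM z w : Re (z * w) = Re z * Re w - Im z * Im w.
Proof. by case: z; case: w. Qed.
Lemma ImM z w : Im (z * w) = Re z * Im w + Im z * Re w.
Proof. by case: z; case: w. Qed.
Lemma Re_conj z : Re (z^*)%R = Re z. Proof. by case: z. Qed.
Lemma Im_conj z : Im (z^*)%R = - Im z. Proof. by case: z. Qed.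

Definition ReImE := (ReD, ImD, ReN, ImN, ReM, ImM, Re_conj, Im_conj).

Lemma Re_sum I (s : seq I) (P : pred I) (F : I -> C) :
  Re (\sum_(i <- s | P i) F i) = \sum_(i <- s | P i) Re (F i).
Proof. exact: (big_morph _ ReD (erefl _)). Qed.
Lemma Im_sum I (s : seq I) (P : pred I) (F : I -> C) :
  Im (\sum_(i <- s | P i) F i) = \sum_(i <- s | P i) Im (F i).
Proof. exact: (big_morph _ ImD (erefl _)). Qed.

Lemma nsq_normc z : ComplexField.Normc.normc z ^+ 2 = nsq z.
Proof. by case: z => a b /=; rewrite sqr_sqrtr// addr_ge0 ?sqr_ge0. Qed.

Lemma nsq_ge0 z : 0 <= nsq z. Proof. by rewrite addr_ge0 ?sqr_ge0. Qed.

Lemma nsq0 : nsq 0 = 0. Proof. by rewrite /nsq /= expr0n addr0. Qed.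

Lemma nsq1 : nsq 1 = 1. Proof. by rewrite /nsq /= expr0n expr1n addr0. Qed.

Lemma nsq_eq0 z : nsq z = 0 -> z = 0.
Proof.
by rewrite -nsq_normc => /eqP; rewrite expf_eq0 /= => /eqP/ComplexField.Normc.eq0_normc.
Qed.

Lemma nsqM z w : nsq (z * w) = nsq z * nsq w.
Proof. rewrite /nsq !ReImE; ring. Qed.

Lemma nsqX z n : nsq (z ^+ n) = nsq z ^+ n.
Proof. by elim: n => [|n ih]; rewrite ?expr0 ?nsq1// !exprS nsqM ih. Qed.

Lemma nsq_conj z : nsq (z^*)%R = nsq z.
Proof. by rewrite /nsq !ReImE sqrrN. Qed.

Lemma nsqN z : nsq (- z) = nsq z.
Proof. by rewrite /nsq !ReImE !sqrrN. Qed.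

Lemma nsqD_le z w : nsq (z + w) <= 2 * nsq z + 2 * nsq w.
Proof.
rewrite /nsq !ReImE -subr_ge0.
have -> : 2 * (Re z ^+ 2 + Im z ^+ 2) + 2 * (Re w ^+ 2 + Im w ^+ 2)
  - ((Re z + Re w) ^+ 2 + (Im z + Im w) ^+ 2)
  = (Re z - Re w) ^+ 2 + (Im z - Im w) ^+ 2 by ring.
by rewrite addr_ge0 ?sqr_ge0.
Qed.

Lemma nsqD z w : nsq (z + w) = nsq z + nsq w + 2 * Re ((z^*)%R * w).
Proof. rewrite /nsq !ReImE; ring. Qed.

Lemma mul_conj_nsq z : ((z^*)%R * z) = ((nsq z)%:C)%C.
Proof. by apply: complex_eqP; rewrite !ReImE /nsq /=; ring. Qed.

Lemma nsq_real (a : R) : nsq ((a%:C)%C) = a ^+ 2.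
Proof. by rewrite /nsq /= expr0n /= addr0. Qed.

Lemma normr_nsq z : `|z| = ((Num.sqrt (nsq z))%:C)%C.
Proof. exact: normc_def. Qed.

Lemma nsq_norm1 z : `|z| = 1 -> nsq z = 1.
Proof.
rewrite normr_nsq => /(congr1 (@complex.Re R)) /= h.
by rewrite -(sqr_sqrtr (nsq_ge0 z)) h expr1n.
Qed.

Lemma ReZ (a : R) z : Re ((a%:C)%C * z) = a * Re z.
Proof. by rewrite !ReImE /=; ring. Qed.
Lemma ImZ (a : R) z : Im ((a%:C)%C * z) = a * Im z.
Proof. by rewrite !ReImE /=; ring. Qed.

Lemma Re_le_nsq z : `|Re z| <= 1 + nsq z.
Proof. by rewrite ler_norml /nsq; apply/andP; split; nra. Qed.
Lemma Im_le_nsq z : `|Im z| <= 1 + nsq z.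
Proof. by rewrite ler_norml /nsq; apply/andP; split; nra. Qed.

Lemma norm_mul_le (a b : R) : `|a * b| <= (a ^+ 2 + b ^+ 2) / 2.
Proof.
rewrite ler_norml; apply/andP; split.
  by have := sqr_ge0 (a + b); lra.
by have := sqr_ge0 (a - b); lra.
Qed.

Lemma Re_mul_le z w : `|Re (z * w)| <= nsq z + nsq w.
Proof.
rewrite !ReImE (le_trans (ler_normB _ _))//.
rewrite (le_trans (lerD (norm_mul_le _ _) (norm_mul_le _ _)))// /nsq.
have := (sqr_ge0 (Re z), sqr_ge0 (Im z), sqr_ge0 (Re w), sqr_ge0 (Im w)).
by move=> [[[]]]; lra.
Qed.
Lemma Im_mul_le z w : `|Im (z * w)| <= nsq z + nsq w.
Proof.
rewrite !ReImE (le_trans (ler_normD _ _))//.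
rewrite (le_trans (lerD (norm_mul_le _ _) (norm_mul_le _ _)))// /nsq.
have := (sqr_ge0 (Re z), sqr_ge0 (Im z), sqr_ge0 (Re w), sqr_ge0 (Im w)).
by move=> [[[]]]; lra.
Qed.

End complex_numbers.

Section circle_integral.
Variable R : realType.
Local Notation C := R[i].
Local Notation Re := complex.Re.
Local Notation Im := complex.Im.
Local Notation m := (@arc_length R).
Implicit Types (f g : circle R -> C) (u v : circle R -> R).

Lemma arc_aeW (P : circle R -> Prop) : (forall z, P z) -> {ae m, forall z, P z}.
Proof.
by move=> h; exists set0; split; [exact: measurable0|exact: measure0|move=> z /=].
Qed.

Lemma arc_aeS (P Q : circle R -> Prop) : (forall z, P z -> Q z) ->
  {ae m, forall z, P z} -> {ae m, forall z, Q z}.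
Proof.
by move=> h [N [mN N0 PN]]; exists N; split => // z /= nQ; apply: PN => /h.
Qed.

Record rintegrable u : Prop := Rintegrable
  { rintegrable_int : m.-integrable setT (EFin \o u) }.

Lemma rintegrableD u v : rintegrable u -> rintegrable v ->
  rintegrable (fun z => u z + v z).
Proof. by move=> [iu] [iv]; split; apply: (integrableD measurableT iu iv). Qed.

Lemma rintegrableB u v : rintegrable u -> rintegrable v ->
  rintegrable (fun z => u z - v z).
Proof. by move=> [iu] [iv]; split; apply: (integrableB measurableT iu iv). Qed.

Lemma rintegrableZ (a : R) u : rintegrable u -> rintegrable (fun z => a * u z).
Proof. by move=> [iu]; split; apply: (integrableZl measurableT a iu). Qed.

Lemma rintegrable_cst (a : R) : rintegrable (fun=> a).
Proof. by split; exact: (finite_measure_integrable_cst (@arc_length R)). Qed.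

Lemma rintegrable_le_ae u v : measurable_fun setT u -> rintegrable v ->
  {ae m, forall z, `|u z| <= v z} -> rintegrable u.
Proof.
move=> mu [iv] [N [mN N0 Nuv]]; split.
apply/(negligible_integrable mN measurableT _ N0); first exact/measurable_EFinP.
apply: (@le_integrable _ _ _ _ _ _ _ (EFin \o v)).
- exact: measurableD.
- by apply: measurable_funTS; apply/measurable_EFinP.
- move=> z [_ zN] /=; rewrite lee_fin (le_trans _ (ler_norm _))//.
  by apply: contrapT => h; apply: zN; apply: Nuv.
- exact: (integrableS measurableT (measurableD measurableT mN) (@subsetT _ _) iv).
Qed.

Lemma rintegrable_le u v : measurable_fun setT u -> rintegrable v ->
  (forall z, `|u z| <= v z) -> rintegrable u.
Proof. by move=> mu iv uv; exact: (rintegrable_le_ae mu iv (arc_aeW uv)). Qed.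

Lemma rint_cst (a : R) : \int[m]_z a = a.
Proof. by rewrite Rintegral_cst// [X in fine X]arc_length_setT mulr1. Qed.

Lemma rint_le_ae u v : rintegrable u -> rintegrable v ->
  {ae m, forall z, u z <= v z} -> \int[m]_z u z <= \int[m]_z v z.
Proof.
move=> [iu] [iv] [N [mN N0 Nuv]]; rewrite /Rintegral.
rewrite (negligible_integral mN measurableT iu N0).
rewrite (negligible_integral mN measurableT iv N0).
have mD : measurable (setT `\` N) by exact: measurableD.
have iu' : m.-integrable (setT `\` N) (EFin \o u).
  exact: integrableS iu.
have iv' : m.-integrable (setT `\` N) (EFin \o v).
  exact: integrableS iv.
apply: le_Rintegral => //.
by move=> z [_ zN]; apply: contrapT => h; apply: zN; apply: Nuv.
Qed.

Lemma rint_le u v : rintegrable u -> rintegrable v ->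
  (forall z, u z <= v z) -> \int[m]_z u z <= \int[m]_z v z.
Proof. by move=> iu iv uv; exact: (rint_le_ae iu iv (arc_aeW uv)). Qed.

Lemma rint_ge0 u : (forall z, 0 <= u z) -> 0 <= \int[m]_z u z.
Proof. by move=> u0; apply: Rintegral_ge0. Qed.

Lemma rintD u v : rintegrable u -> rintegrable v ->
  \int[m]_z (u z + v z) = \int[m]_z u z + \int[m]_z v z.
Proof. by move=> [iu] [iv]; exact: (RintegralD measurableT iu iv). Qed.

Lemma rintB u v : rintegrable u -> rintegrable v ->
  \int[m]_z (u z - v z) = \int[m]_z u z - \int[m]_z v z.
Proof. by move=> [iu] [iv]; exact: (RintegralB measurableT iu iv). Qed.

Lemma rintZ a u : rintegrable u -> \int[m]_z (a * u z) = a * \int[m]_z u z.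
Proof. by move=> [iu]; exact: RintegralZl. Qed.

Lemma eq_rint u v : (forall z, u z = v z) -> \int[m]_z u z = \int[m]_z v z.
Proof. by move=> uv; congr Rintegral; apply/funext. Qed.

Lemma rint_ae_eq u v : rintegrable u -> rintegrable v ->
  {ae m, forall z, u z = v z} -> \int[m]_z u z = \int[m]_z v z.
Proof.
move=> iu iv uv; apply/eqP; rewrite eq_le; apply/andP; split.
  by apply: (rint_le_ae iu iv); apply: arc_aeS uv => z ->.
by apply: (rint_le_ae iv iu); apply: arc_aeS uv => z ->.
Qed.

Lemma rintegrable_sum I (s : seq I) (P : pred I) (U : I -> circle R -> R) :
  (forall i, P i -> rintegrable (U i)) ->
  rintegrable (fun z => \sum_(i <- s | P i) U i z).
Proof.
move=> iU; split; rewrite (_ : _ \o _ = (fun z => \sum_(i <- s | P i) (EFin \o U i) z)%E).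
  by apply: integrable_sum => // i Pi; case: (iU i Pi).
by apply/funext => z /=; rewrite sumEFin.
Qed.

Lemma rint_sum I (s : seq I) (P : pred I) (U : I -> circle R -> R) :
  (forall i, P i -> rintegrable (U i)) ->
  \int[m]_z (\sum_(i <- s | P i) U i z) = \sum_(i <- s | P i) \int[m]_z U i z.
Proof.
move=> iU; elim: s => [|i s ih].
  by rewrite big_nil -[RHS]rint_cst; apply: eq_rint => z; rewrite big_nil.
rewrite big_cons; case: ifPn => Pi; last first.
  by rewrite -ih; apply: eq_rint => z; rewrite big_cons (negPf Pi).
rewrite -ih -(rintD (iU _ Pi) (rintegrable_sum s iU)).
by apply: eq_rint => z; rewrite big_cons Pi.
Qed.

Record cmeasurable f : Prop := Cmeasurable
  { measurable_Re : measurable_fun setT (fun z => Re (f z));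
    measurable_Im : measurable_fun setT (fun z => Im (f z)) }.

Record cintegrable f : Prop := Cintegrable
  { rintegrable_Re : rintegrable (fun z => Re (f z));
    rintegrable_Im : rintegrable (fun z => Im (f z)) }.

Lemma cmeasurable_cst (a : C) : cmeasurable (fun=> a).
Proof. by split; exact: measurable_cst. Qed.

Lemma cmeasurableD f g : cmeasurable f -> cmeasurable g ->
  cmeasurable (fun z => f z + g z).
Proof.
move=> [rf jf] [rg jg]; split.
  by under eq_fun do rewrite ReD; apply: measurable_funD.
by under eq_fun do rewrite ImD; apply: measurable_funD.
Qed.

Lemma cmeasurableM f g : cmeasurable f -> cmeasurable g ->
  cmeasurable (fun z => f z * g z).
Proof.
move=> [rf jf] [rg jg]; split.
  by under eq_fun do rewrite ReM; apply: measurable_funB; exact: measurable_funM.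
by under eq_fun do rewrite ImM; apply: measurable_funD; exact: measurable_funM.
Qed.

Lemma cmeasurable_conj f : cmeasurable f -> cmeasurable (fun z => (f z)^*).
Proof.
move=> [rf jf]; split; first by under eq_fun do rewrite Re_conj.
under eq_fun do rewrite Im_conj; exact: measurableT_comp.
Qed.

Lemma cmeasurable_sum I (s : seq I) (P : pred I) (f : I -> circle R -> C) :
  (forall i, P i -> cmeasurable (f i)) ->
  cmeasurable (fun z => \sum_(i <- s | P i) f i z).
Proof.
move=> mf; elim: s => [|i s ih].
  by under eq_fun do rewrite big_nil; exact: cmeasurable_cst.
under eq_fun do rewrite big_cons.
case Pi: (P i); last exact: ih.
exact: (cmeasurableD (mf _ Pi) ih).
Qed.

Lemma measurable_nsq f : cmeasurable f -> measurable_fun setT (fun z => nsq (f z)).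
Proof. by move=> [rf jf]; apply: measurable_funD; exact: measurable_funX. Qed.

Lemma CintegralD f g : cintegrable f -> cintegrable g ->
  Cintegral (fun z => f z + g z) = Cintegral f + Cintegral g.
Proof.
move=> [rf jf] [rg jg]; apply: complex_eqP; rewrite ?ReD ?ImD /= -rintD//.
  by apply: eq_rint => z; rewrite ReD.
by apply: eq_rint => z; rewrite ImD.
Qed.

Lemma CintegralZ (a : C) f : cintegrable f ->
  Cintegral (fun z => a * f z) = a * Cintegral f.
Proof.
move=> [rf jf]; apply: complex_eqP; rewrite ?ReM ?ImM /=.
  rewrite -!rintZ// -(rintB (rintegrableZ _ rf) (rintegrableZ _ jf)).
  by apply: eq_rint => z; rewrite ReM.
rewrite -!rintZ// -(rintD (rintegrableZ _ jf) (rintegrableZ _ rf)).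
by apply: eq_rint => z; rewrite ImM.
Qed.

Lemma cintegrable_cst (a : C) : cintegrable (fun=> a).
Proof. by split; exact: rintegrable_cst. Qed.

Lemma Cintegral_cst (a : C) : Cintegral (fun=> a) = a.
Proof. by apply: complex_eqP; rewrite /= rint_cst. Qed.

Lemma cintegrableD f g : cintegrable f -> cintegrable g ->
  cintegrable (fun z => f z + g z).
Proof.
move=> [rf jf] [rg jg]; split.
  by under eq_fun do rewrite ReD; exact: rintegrableD.
by under eq_fun do rewrite ImD; exact: rintegrableD.
Qed.

Lemma cintegrableZ (a : C) f : cintegrable f -> cintegrable (fun z => a * f z).
Proof.
move=> [rf jf]; split.
  by under eq_fun do rewrite ReM; apply: rintegrableB; exact: rintegrableZ.
by under eq_fun do rewrite ImM; apply: rintegrableD; exact: rintegrableZ.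
Qed.

Lemma eq_Cintegral f g : f =1 g -> Cintegral f = Cintegral g.
Proof. by move=> fg; congr Cintegral; apply/funext. Qed.

Lemma CintegralB f g : cintegrable f -> cintegrable g ->
  Cintegral (fun z => f z - g z) = Cintegral f - Cintegral g.
Proof.
move=> cf cg; rewrite -mulN1r -CintegralZ// -CintegralD//; last exact: cintegrableZ.
by apply: eq_Cintegral => z; rewrite mulN1r.
Qed.

Lemma cintegrable_sum I (s : seq I) (P : pred I) (f : I -> circle R -> C) :
  (forall i, P i -> cintegrable (f i)) ->
  cintegrable (fun z => \sum_(i <- s | P i) f i z).
Proof.
move=> mf; elim: s => [|i s ih].
  by under eq_fun do rewrite big_nil; exact: cintegrable_cst.
under eq_fun do rewrite big_cons.
case Pi: (P i); last exact: ih.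
exact: (cintegrableD (mf _ Pi) ih).
Qed.

Lemma Cintegral_sum I (s : seq I) (P : pred I) (f : I -> circle R -> C) :
  (forall i, P i -> cintegrable (f i)) ->
  Cintegral (fun z => \sum_(i <- s | P i) f i z) = \sum_(i <- s | P i) Cintegral (f i).
Proof.
move=> mf; elim: s => [|i s ih].
  by rewrite big_nil -[RHS]Cintegral_cst; apply: eq_Cintegral => z; rewrite big_nil.
rewrite big_cons; case: ifPn => Pi; last first.
  by rewrite -ih; apply: eq_Cintegral => z; rewrite big_cons (negPf Pi).
rewrite -ih -(CintegralD (mf _ Pi) (cintegrable_sum s mf)).
by apply: eq_Cintegral => z; rewrite big_cons Pi.
Qed.

Lemma Cintegral_ae_eq f g : cintegrable f -> cintegrable g ->
  {ae m, forall z, f z = g z} -> Cintegral f = Cintegral g.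
Proof.
move=> [rf jf] [rg jg] fg; apply: complex_eqP; rewrite /=.
  by apply: (rint_ae_eq rf rg); apply: arc_aeS fg => z ->.
by apply: (rint_ae_eq jf jg); apply: arc_aeS fg => z ->.
Qed.

Lemma Cintegral_conj f : cintegrable f ->
  Cintegral (fun z => (f z)^*) = (Cintegral f)^*.
Proof.
move=> [rf jf]; apply: complex_eqP; rewrite ?Re_conj ?Im_conj /=.
  by apply: eq_rint => z; rewrite Re_conj.
rewrite -mulN1r -rintZ//.
by apply: eq_rint => z; rewrite Im_conj mulN1r.
Qed.

Lemma cintegrable_conj f : cintegrable f -> cintegrable (fun z => (f z)^*).
Proof.
move=> [rf jf]; split; first by under eq_fun do rewrite Re_conj.
by under eq_fun do rewrite Im_conj -mulN1r; exact: rintegrableZ.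
Qed.

Record L2 f : Prop := L2I
  { L2_measurable : cmeasurable f;
    L2_rintegrable : rintegrable (fun z => nsq (f z)) }.
Definition N2 f : R := \int[m]_z nsq (f z).

Lemma N2_ge0 f : 0 <= N2 f. Proof. by apply: rint_ge0 => z; exact: nsq_ge0. Qed.

Lemma eq_N2 f g : f =1 g -> N2 f = N2 g.
Proof. by move=> fg; apply: eq_rint => z; rewrite fg. Qed.

Lemma eq_L2 f g : f =1 g -> L2 f -> L2 g.
Proof. by move=> /funext ->. Qed.

Lemma L2_bounded f (M : R) : cmeasurable f ->
  {ae m, forall z, nsq (f z) <= M} -> L2 f.
Proof.
move=> mf fM; split => //.
apply: (rintegrable_le_ae (measurable_nsq mf) (rintegrable_cst M)).
by apply: arc_aeS fM => z; rewrite ger0_norm// nsq_ge0.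
Qed.

Lemma L2_cst a : L2 (fun=> a).
Proof.
by apply: (@L2_bounded _ (nsq a) (cmeasurable_cst a)); exact: arc_aeW.
Qed.

Lemma L2D f g : L2 f -> L2 g -> L2 (fun z => f z + g z).
Proof.
move=> [mf lf] [mg lg]; split; first exact: cmeasurableD.
have i1 := rintegrableD (rintegrableZ 2 lf) (rintegrableZ 2 lg).
apply: (rintegrable_le (measurable_nsq (cmeasurableD mf mg)) i1).
by move=> z; rewrite ger0_norm ?nsq_ge0// nsqD_le.
Qed.

Lemma L2M_bounded f g (M : R) : cmeasurable f ->
  {ae m, forall z, nsq (f z) <= M} -> L2 g -> L2 (fun z => f z * g z).
Proof.
move=> mf fM [mg lg]; split; first exact: cmeasurableM.
apply: (rintegrable_le_ae (measurable_nsq (cmeasurableM mf mg)) (rintegrableZ M lg)).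
apply: arc_aeS fM => z h; rewrite ger0_norm ?nsq_ge0// nsqM.
  by rewrite ler_wpM2r// nsq_ge0.
Qed.

Lemma N2M_bounded f g (M : R) : cmeasurable f ->
  {ae m, forall z, nsq (f z) <= M} -> L2 g ->
  N2 (fun z => f z * g z) <= M * N2 g.
Proof.
move=> mf fM lg; have [_ lfg] := L2M_bounded mf fM lg.
case: lg => _ lg; rewrite -rintZ//.
apply: (rint_le_ae lfg (rintegrableZ M lg)).
by apply: arc_aeS fM => z h; rewrite nsqM ler_wpM2r// nsq_ge0.
Qed.

Lemma L2Z a f : L2 f -> L2 (fun z => a * f z).
Proof.
have aM : {ae m, forall z : circle R, nsq a <= nsq a} by exact: arc_aeW.
exact: (L2M_bounded (cmeasurable_cst a) aM).
Qed.

Lemma N2Z a f : L2 f -> N2 (fun z => a * f z) = nsq a * N2 f.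
Proof.
by move=> [_ lf]; rewrite -rintZ//; apply: eq_rint => z; rewrite nsqM.
Qed.

Lemma L2B f g : L2 f -> L2 g -> L2 (fun z => f z - g z).
Proof.
move=> lf lg; apply: (@eq_L2 (fun z => f z + (-1) * g z)).
  by move=> z; rewrite mulN1r.
exact: (L2D lf (L2Z (-1) lg)).
Qed.

Lemma L2_conj f : L2 f -> L2 (fun z => (f z)^*).
Proof.
move=> [mf lf]; split; first exact: cmeasurable_conj.
by under eq_fun do rewrite nsq_conj.
Qed.

Lemma L2_sum I (s : seq I) (P : pred I) (f : I -> circle R -> C) :
  (forall i, P i -> L2 (f i)) -> L2 (fun z => \sum_(i <- s | P i) f i z).
Proof.
move=> mf; elim: s => [|i s ih].
  by under eq_fun do rewrite big_nil; exact: L2_cst.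
under eq_fun do rewrite big_cons.
case Pi: (P i); last exact: ih.
exact: (L2D (mf _ Pi) ih).
Qed.

(** L2 lies in L1 because the measure is finite: the constant 1 in the domination by [1 + nsq] is
    integrable. *)
Lemma L2_cintegrable f : L2 f -> cintegrable f.
Proof.
move=> [[rf jf] lf].
have i1 : rintegrable (fun z => 1 + nsq (f z)).
  by apply: rintegrableD => //; exact: rintegrable_cst.
by split; [apply: (rintegrable_le rf i1)|apply: (rintegrable_le jf i1)] => z;
  rewrite ?Re_le_nsq ?Im_le_nsq.
Qed.

Lemma L2_cintegrableM f g : L2 f -> L2 g -> cintegrable (fun z => f z * g z).
Proof.
move=> [mf lf] [mg lg]; have [rfg jfg] := cmeasurableM mf mg.
have i1 := rintegrableD lf lg.
by split; [apply: (rintegrable_le rfg i1)|apply: (rintegrable_le jfg i1)] => z;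
  rewrite ?Re_mul_le ?Im_mul_le.
Qed.

Lemma N2D f g : L2 f -> L2 g -> N2 (fun z => f z + g z) =
  N2 f + N2 g + 2 * Re (Cintegral (fun z => (f z)^* * g z)).
Proof.
move=> lf lg; have [i1 _] := L2_cintegrableM (L2_conj lf) lg.
case: lf lg => [_ lf] [_ lg].
rewrite /N2 /= -rintZ// -!rintD//; last 2 first.
- exact: rintegrableD.
- exact: rintegrableZ.
by apply: eq_rint => z; rewrite nsqD.
Qed.

Lemma N2_cst a : N2 (fun=> a) = nsq a.
Proof. exact: rint_cst. Qed.

(* Jensen: N2 (f - c) >= 0 at the mean value c of f. *)
Lemma nsq_Cintegral f : L2 f -> nsq (Cintegral f) <= N2 f.
Proof.
move=> lf; set c := Cintegral f.
have := N2_ge0 (fun z => (- c) + f z).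
rewrite N2D//; last exact: L2_cst.
rewrite CintegralZ; last exact: L2_cintegrable.
rewrite -/c N2_cst nsqN.
have -> : Re ((- c)^* * c) = - nsq c by rewrite !ReImE /nsq; ring.
by move: (N2 f) (nsq c) => x y; lra.
Qed.

Lemma N2_ae_eq f g : L2 f -> L2 g -> {ae m, forall z, f z = g z} -> N2 f = N2 g.
Proof.
by move=> [_ lf] [_ lg] fg; apply: (rint_ae_eq lf lg); apply: arc_aeS fg => z ->.
Qed.

End circle_integral.

Section transfer.
Variable R : realType.
Local Notation C := R[i].
Local Notation Re := complex.Re.
Local Notation Im := complex.Im.
Local Notation m := (@arc_length R).
Local Notation T := (lebesgueType R).

(** The measure on the line whose image under [circle_of] is [arc_length]; integrals over the circle
    are computed against it. *)
Definition unit_measure : set T -> \bar R :=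
  mrestr (@completed_lebesgue_measure R) (@measurable_unit_interval R).
HB.instance Definition _ := Measure.on unit_measure.
Local Notation mu := unit_measure.

(** The sigma-algebra of the circle is the image one, the largest for which [circle_of] is
    measurable. *)
Lemma measurable_circle (u : circle R -> R) :
  measurable_fun setT (u \o @circle_of R) -> measurable_fun setT u.
Proof.
move=> mu _ Y mY; have := mu measurableT Y mY.
by rewrite !setTI => h; rewrite /measurable /= /circle_measurable /image_set_system /= setTI.
Qed.

Lemma measurable_lebesgue (v : R -> R) :
  measurable_fun setT (v : measurableTypeR R -> R) ->
  measurable_fun setT (v : T -> R).
Proof.
move=> mv _ Y mY; have := mv measurableT Y mY.
rewrite !setTI; exact: sub_caratheodory.
Qed.

Lemma integral_unit_measure (v : circle R -> \bar R) :
  measurable_fun setT v -> (forall z, (0 <= v z)%E) ->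
  (\int[m]_z v z = \int[mu]_t v (circle_of t))%E.
Proof.
move=> mv v0; rewrite -[LHS]/(\int[pushforward mu (@circle_of R)]_z v z)%E.
by rewrite ge0_integral_pushforward//; exact: measurable_circle_of.
Qed.

Lemma mu_setT : mu setT = 1%E.
Proof.
have := arc_length_setT R.
by rewrite /arc_length /pushforward preimage_setT.
Qed.

Lemma mu_Borel (B : set R) : measurable (B : set (measurableTypeR R)) ->
  mu B = lebesgue_measure (B `&` `[0, 1[%classic).
Proof. by []. Qed.

(** The exceptional points 0 and [a] will be the two ends of an arc. *)
Lemma mu_null_ae (P : T -> Prop) (a : R) :
  (forall t : T, 0 < t :> R -> t < 1 :> R -> t <> a -> P t) ->
  {ae mu, forall t, P t}.
Proof.
move=> h; pose N : set R := ~` (`]0, 1[%classic `\` [set a]).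
have mN : measurable (N : set (measurableTypeR R)).
  by apply: measurableC; apply: measurableD.
exists N; split.
- exact: sub_caratheodory.
- rewrite mu_Borel// /N; apply/eqP; rewrite eq_le measure_ge0 andbT.
  apply: (@le_trans _ _ (lebesgue_measure ([set 0] `|` [set a] : set (measurableTypeR R)))).
    apply: le_measure; rewrite ?inE.
    + exact: measurableI.
    + exact: measurableU.
    + move=> t [/= nt]; rewrite !in_itv/= => /andP[t0 t1].
      case: (eqVneq t 0) => [->|tn0]; first by left.
      right; apply: contrapT => ta; apply: nt; split => //.
      by rewrite /= in_itv /= t1 lt_def tn0 t0.
  apply: (le_trans (measureU2 _ _ _)) => //.
  by rewrite [X in (X + _)%E](lebesgue_measure_set1 0) [X in (_ + X)%E](lebesgue_measure_set1 a) adde0.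
- move=> t /= nP [/= ]; rewrite in_itv /= => /andP[t0 t1] ta.
  exact/nP/h.
Qed.

End transfer.

(** * Density of trigonometric polynomials *)

Section laurent.
Variables (K : fieldType) (v : K).
Hypothesis v0 : v != 0.
Implicit Types (N M : nat) (P Q : {poly K}).

Lemma laurent_shift N M P : v ^- N * P.[v] = v ^- (N + M) * ('X^M * P).[v].
Proof. by rewrite hornerM hornerXn exprD invfM -mulrA mulKf// expf_neq0. Qed.

Lemma laurentD N M P Q :
  v ^- N * P.[v] + v ^- M * Q.[v] = v ^- (N + M) * ('X^M * P + 'X^N * Q).[v].
Proof. by rewrite hornerD mulrDr -laurent_shift addnC -laurent_shift. Qed.

Lemma laurentM N M P Q : v ^- N * P.[v] * (v ^- M * Q.[v]) = v ^- (N + M) * (P * Q).[v].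
Proof. by rewrite hornerM exprD invfM mulrACA. Qed.

Lemma laurent_wide N P L : (size P <= L)%N ->
  v ^- N * P.[v] = \sum_(i < L) P`_i * v ^ (i%:Z - N%:Z).
Proof.
move=> /horner_coef_wide ->; rewrite mulr_sumr; apply: eq_bigr => i _.
by rewrite expfzDr// exprnN mulrC -mulrA.
Qed.

End laurent.

Section trigonometric.
Variable R : realType.
Local Notation C := R[i].
Local Notation Re := complex.Re.
Local Notation Im := complex.Im.
Local Notation m := (@arc_length R).
Local Notation T := (lebesgueType R).
Implicit Types (p q : circle R -> C) (z : circle R).

Lemma nsq_circle z : nsq (val z : C) = 1.
Proof. by apply: nsq_norm1; apply/eqP; exact: (valP z). Qed.

Lemma circle_neq0 z : (val z : C) != 0.
Proof. by apply/eqP => z0; have := nsq_circle z; rewrite z0 nsq0 => /esym/eqP; rewrite oner_eq0. Qed.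

Lemma circle_conj z : ((val z : C)^*)%R = (val z)^-1.
Proof.
apply: (mulIf (circle_neq0 z)); rewrite mulVf ?circle_neq0//.
by rewrite mul_conj_nsq nsq_circle.
Qed.

Lemma circle_exp_Negz z n : (val z : C) ^ (Negz n) = ((val z : C)^*)%R ^+ n.+1.
Proof. by rewrite circle_conj exprVn. Qed.

Lemma nsq_circleX z (k : int) : nsq ((val z : C) ^ k) = 1.
Proof.
have h n : nsq ((val z : C) ^+ n) = 1 by rewrite nsqX nsq_circle expr1n.
case: k => n; first exact: h.
by rewrite circle_exp_Negz nsqX nsq_conj nsq_circle expr1n.
Qed.

Lemma circle_conjX z (k : int) : (((val z : C) ^ k)^*)%R = (val z) ^ (- k).
Proof.
by rewrite -exprz_inv -circle_conj rmorphXz// unitfE circle_neq0.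
Qed.

Lemma circle_expD z (j k : int) : (val z : C) ^ (j + k) = (val z) ^ j * (val z) ^ k.
Proof. by rewrite expfzDr ?circle_neq0. Qed.

Lemma val_circle_of (t : R) : val (@circle_of R t) = expi t.
Proof. by []. Qed.

Lemma cmeasurable_val : cmeasurable (fun z : circle R => (val z : C)).
Proof.
have mlin : measurable_fun setT (fun t : measurableTypeR R => 2 * pi * t : R).
  by apply: measurable_funM => //; exact: measurable_id.
split; apply: measurable_circle; apply: measurable_lebesgue => /=.
  by apply: (measurableT_comp _ mlin); apply: continuous_measurable_fun; exact: continuous_cos.
by apply: (measurableT_comp _ mlin); apply: continuous_measurable_fun; exact: continuous_sin.
Qed.

Lemma cmeasurableX (f : circle R -> C) n : cmeasurable f ->
  cmeasurable (fun z => f z ^+ n).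
Proof.
move=> mf; elim: n => [|n ih].
  by under eq_fun do rewrite expr0; exact: cmeasurable_cst.
by under eq_fun do rewrite exprS; exact: (cmeasurableM mf ih).
Qed.

Lemma cmeasurable_character (k : int) : cmeasurable (fun z : circle R => (val z : C) ^ k).
Proof.
case: k => n; first exact: (cmeasurableX n cmeasurable_val).
under eq_fun do rewrite circle_exp_Negz.
exact: (cmeasurableX n.+1 (cmeasurable_conj cmeasurable_val)).
Qed.

Lemma L2_character (k : int) : L2 (fun z : circle R => (val z : C) ^ k).
Proof.
apply: (L2_bounded (M := 1) (cmeasurable_character k)); apply: arc_aeW => z.
by rewrite nsq_circleX.
Qed.

(** A Laurent polynomial is a polynomial over a power of [z]; with a common denominator, sums and
    products become those of [{poly C}]. *)
Variant trigpoly p : Prop := Trigpoly N (P : {poly C}) of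
  forall z, p z = (val z : C) ^- N * P.[val z].

Lemma trigpoly_cst a : trigpoly (fun=> a).
Proof. by apply: (@Trigpoly _ 0%N a%:P) => z; rewrite hornerC expr0 invr1 mul1r. Qed.

Lemma trigpoly_val : trigpoly (fun z => val z).
Proof. by apply: (@Trigpoly _ 0%N 'X) => z; rewrite hornerX expr0 invr1 mul1r. Qed.

Lemma trigpoly_conj : trigpoly (fun z => ((val z : C)^*)%R).
Proof. by apply: (@Trigpoly _ 1%N 1) => z; rewrite circle_conj hornerC mulr1 expr1. Qed.

Lemma trigpolyD p q : trigpoly p -> trigpoly q -> trigpoly (fun z => p z + q z).
Proof.
move=> [N P hp] [M Q hq]; apply: Trigpoly => z.
rewrite hp hq; exact: (laurentD (circle_neq0 z)).
Qed.

Lemma trigpolyM p q : trigpoly p -> trigpoly q -> trigpoly (fun z => p z * q z).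
Proof.
move=> [N P hp] [M Q hq]; apply: Trigpoly => z.
rewrite hp hq; exact: laurentM.
Qed.

Lemma trigpolyZ a p : trigpoly p -> trigpoly (fun z => a * p z).
Proof. exact: (trigpolyM (trigpoly_cst a)). Qed.

Lemma trigpolyX p n : trigpoly p -> trigpoly (fun z => p z ^+ n).
Proof.
move=> hp; elim: n => [|n ih].
  by under eq_fun do rewrite expr0; exact: trigpoly_cst.
by under eq_fun do rewrite exprS; exact: (trigpolyM hp ih).
Qed.

Lemma L2_trigpoly p : trigpoly p -> L2 p.
Proof.
move=> [N P hp]; have h z := etrans (hp z) (laurent_wide (circle_neq0 z) N (leqnn (size P))).
apply: (eq_L2 (fun z => esym (h z))).
by apply: L2_sum => i _; apply: L2Z; exact: L2_character.
Qed.

End trigonometric.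

Import HBSimple HBNNSimple.

Section square_approximation.
Context d (T : measurableType d) (R : realType).
Variable mu : {measure set T -> \bar R}.
Local Notation C := R[i].
Local Notation Re := complex.Re.
Local Notation Im := complex.Im.
Implicit Types (f g p : T -> C) (B : set T).

Record tmeasurable f : Prop := Tmeasurable
  { tmeasurable_Re : measurable_fun setT (fun t => Re (f t));
    tmeasurable_Im : measurable_fun setT (fun t => Im (f t)) }.

Lemma tmeasurable_nsq f : tmeasurable f ->
  measurable_fun setT (fun t => (nsq (f t))%:E).
Proof.
move=> [rf jf]; apply/measurable_EFinP.
by apply: measurable_funD; exact: measurable_funX.
Qed.

Lemma tmeasurableD f g : tmeasurable f -> tmeasurable g ->
  tmeasurable (fun z => f z + g z).
Proof.
move=> [rf jf] [rg jg]; split.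
  by under eq_fun do rewrite ReD; exact: measurable_funD.
by under eq_fun do rewrite ImD; exact: measurable_funD.
Qed.

Lemma tmeasurableZ a f : tmeasurable f -> tmeasurable (fun z => a * f z).
Proof.
move=> [rf jf]; split.
  under eq_fun do rewrite ReM; apply: measurable_funB; apply: measurable_funM => //;
  exact: measurable_cst.
under eq_fun do rewrite ImM; apply: measurable_funD; apply: measurable_funM => //;
exact: measurable_cst.
Qed.

Lemma tmeasurableB f g : tmeasurable f -> tmeasurable g ->
  tmeasurable (fun z => f z - g z).
Proof.
move=> mf mg; rewrite (_ : (fun _ => _) = fun z => f z + (-1) * g z).
  exact: (tmeasurableD mf (tmeasurableZ (-1) mg)).
by apply/funext => z; rewrite mulN1r.
Qed.

(** With values in the extended reals, the triangle inequality holds for all measurable functions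
    and integrability need not be tracked. *)
Definition dist2 f g : \bar R := (\int[mu]_t (nsq (f t - g t))%:E)%E.

Lemma dist2_triangle f g h : tmeasurable f -> tmeasurable g -> tmeasurable h ->
  (dist2 f h <= 2%:E * dist2 f g + 2%:E * dist2 g h)%E.
Proof.
move=> mf mg mh; rewrite /dist2.
have n0 (u : T -> C) t : setT t -> (0 <= (nsq (u t))%:E)%E.
  by move=> _; rewrite lee_fin nsq_ge0.
have mfg := tmeasurable_nsq (tmeasurableB mf mg).
have mgh := tmeasurable_nsq (tmeasurableB mg mh).
have mfh := tmeasurable_nsq (tmeasurableB mf mh).
have two : (0 <= 2%:E :> \bar R)%E by rewrite lee_fin.
rewrite -(ge0_integralZl_EFin _ measurableT (n0 _) mfg)//.
rewrite -(ge0_integralZl_EFin _ measurableT (n0 _) mgh)//.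
rewrite -ge0_integralD//.
- apply: ge0_le_integral => //.
  + by move=> t _; rewrite lee_fin nsq_ge0.
  + by apply: emeasurable_funD; exact: measurable_funeM.
  + move=> t _; rewrite -!EFinM -EFinD lee_fin.
    have -> : f t - h t = (f t - g t) + (g t - h t) by rewrite addrA subrK.
    exact: nsqD_le.
- by move=> t _; rewrite -EFinM lee_fin mulr_ge0 ?nsq_ge0.
- exact: measurable_funeM.
- by move=> t _; rewrite -EFinM lee_fin mulr_ge0 ?nsq_ge0.
- exact: measurable_funeM.
Qed.

Lemma dist2_ge0 f g : (0 <= dist2 f g)%E.
Proof. by apply: integral_ge0 => t _; rewrite lee_fin nsq_ge0. Qed.

Lemma halves_le (x y : \bar R) (e : R) : (0 <= x)%E -> (0 <= y)%E ->
  (x <= (e / 4)%:E)%E -> (y <= (e / 4)%:E)%E -> (2%:E * x + 2%:E * y <= e%:E)%E.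
Proof.
move=> x0 y0 xe ye.
apply: (@le_trans _ _ (2%:E * (e / 4)%:E + 2%:E * (e / 4)%:E)%E).
  by apply: leeD; apply: lee_pmul.
by rewrite -EFinM -EFinD lee_fin; lra.
Qed.

(** [V] stands for an algebra of measurable functions containing the constants. It is instantiated
    twice: by trigonometric polynomials pulled back to the line, where indicators are approximated,
    and by trigonometric polynomials on the circle. *)
Variable V : set (T -> C).
Hypothesis V_measurable : forall p, V p -> tmeasurable p.
Hypothesis V_cst : forall a, V (fun=> a).
Hypothesis VD : forall p q, V p -> V q -> V (fun t => p t + q t).
Hypothesis VM : forall p q, V p -> V q -> V (fun t => p t * q t).

Definition approximable f := tmeasurable f /\
  forall e : R, 0 < e -> exists2 p, V p & (dist2 f p <= e%:E)%E.

Lemma approximable_id p : V p -> approximable p.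
Proof.
move=> Vp; split; first exact: V_measurable.
move=> e e0; exists p => //; rewrite /dist2.
under eq_integral do rewrite subrr nsq0.
by rewrite integral0 lee_fin ltW.
Qed.

Lemma approximable_limit f : tmeasurable f ->
  (forall e : R, 0 < e -> exists2 g, approximable g & (dist2 f g <= e%:E)%E) ->
  approximable f.
Proof.
move=> mf h; split=> // e e0.
(* [dist2] is a squared distance, so its triangle inequality carries a factor 2 and each of the two
   terms gets a quarter of [e]. *)
have e4 : 0 < e / 4 by rewrite divr_gt0.
have [g [mg ag] fg] := h _ e4; have [p tp gp] := ag _ e4; exists p => //.
have mp := V_measurable tp.
apply: (le_trans (dist2_triangle mf mg mp)).
exact: (halves_le (dist2_ge0 _ _) (dist2_ge0 _ _) fg gp).
Qed.

Lemma approximableD f g : approximable f -> approximable g ->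
  approximable (fun t => f t + g t).
Proof.
move=> [mf af] [mg ag]; split; first exact: tmeasurableD.
move=> e e0; have e4 : 0 < e / 4 by rewrite divr_gt0.
have [p tp fp] := af _ e4; have [q tq gq] := ag _ e4.
exists (fun z => p z + q z); first exact: VD.
have mp := V_measurable tp.
have mq := V_measurable tq.
have tri := dist2_triangle (tmeasurableD mf mg) (tmeasurableD mp mg) (tmeasurableD mp mq).
apply: (le_trans tri).
have -> : dist2 (fun z => f z + g z) (fun z => p z + g z) = dist2 f p.
  by apply: eq_integral => t _; rewrite opprD addrACA subrr addr0.
have -> : dist2 (fun z => p z + g z) (fun z => p z + q z) = dist2 g q.
  by apply: eq_integral => t _; rewrite opprD addrACA subrr add0r.
exact: (halves_le (dist2_ge0 _ _) (dist2_ge0 _ _) fp gq).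
Qed.

Lemma approximableZ a f : approximable f -> approximable (fun t => a * f t).
Proof.
move=> [mf af]; split; first exact: tmeasurableZ.
(* The divisor is [1 + nsq a] since [a] may vanish. *)
move=> e e0; have M0 : 0 < 1 + nsq a by rewrite ltr_pwDl ?nsq_ge0.
have [p tp fp] := af (e / (1 + nsq a)) (divr_gt0 e0 M0).
exists (fun z => a * p z); first exact: (VM (V_cst a) tp).
have mp := V_measurable tp.
have -> : dist2 (fun t => a * f t) (fun t => a * p t) = ((nsq a)%:E * dist2 f p)%E.
  rewrite /dist2 -ge0_integralZl_EFin ?nsq_ge0//.
  - by apply: eq_integral => t _; rewrite -mulrBr nsqM EFinM.
  - by move=> t _; rewrite lee_fin nsq_ge0.
  - exact: (tmeasurable_nsq (tmeasurableB mf mp)).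
rewrite (_ : e = (1 + nsq a) * (e / (1 + nsq a))); last first.
  by rewrite mulrC divfK// gt_eqF.
rewrite [(_ * _)%:E]EFinM; apply: lee_pmul => //.
- by rewrite lee_fin nsq_ge0.
- exact: dist2_ge0.
- by rewrite lee_fin lerDr.
Qed.

Lemma approximable_cst a : approximable (fun=> a).
Proof. exact: (approximable_id (V_cst a)). Qed.

Lemma approximable_sum n (f : 'I_n -> T -> C) : (forall i, approximable (f i)) ->
  approximable (fun t => \sum_(i < n) f i t).
Proof.
elim: n f => [|n ih] f af.
  by under eq_fun do rewrite big_ord0; exact: approximable_cst.
by under eq_fun do rewrite big_ord_recr; apply: approximableD; [exact: ih|exact: af].
Qed.

(** Dominated convergence, applied to the squared distances themselves: pointwise limits of
    approximable functions are approximable. *)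
Lemma approximable_dominated f (g : nat -> T -> C) (G : T -> R) : tmeasurable f ->
  (forall n, approximable (g n)) -> mu.-integrable setT (EFin \o G) ->
  {ae mu, forall t, (nsq (f t - g n t)) @[n --> \oo] --> (0 : R)} ->
  (forall n t, nsq (f t - g n t) <= G t) -> approximable f.
Proof.
move=> mf ag iG cv dom; apply: (approximable_limit mf) => e e0.
have mg n := tmeasurable_nsq (tmeasurableB mf (proj1 (ag n))).
have cv' : {ae mu, forall t, setT t ->
    (fun n => (nsq (f t - g n t))%:E) @ \oo --> ((cst 0%E : T -> \bar R) t)}.
  by apply: filterS cv => t ct _; apply: cvg_EFin => //; exact: nearW.
have dom' : {ae mu, forall t n, setT t ->
    (`|(nsq (f t - g n t))%:E| <= (EFin \o G) t)%E}.
  by apply: aeW => t n _; rewrite gee0_abs ?lee_fin ?nsq_ge0//; exact: dom.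
have [_ _ lim0] := dominated_convergence measurableT mg (measurable_cst _) cv' iG dom'.
move: lim0; rewrite integral0 => /fine_cvgP[finN /cvgrPdist_lt/(_ _ e0) ltN].
near \oo => N; exists (g N) => //.
have dfin : dist2 f (g N) \is a fin_num by near: N.
rewrite -(fineK dfin) lee_fin ltW//.
have : `|0 - fine (dist2 f (g N))| < e by near: N.
by rewrite sub0r normrN ger0_norm// fine_ge0// dist2_ge0.
Unshelve. all: by end_near. Qed.

Lemma tmeasurable_indic B : measurable B -> tmeasurable (fun t => ((\1_B t)%:C)%C).
Proof. by move=> mB; split => /=; [exact: measurable_indic|exact: measurable_cst]. Qed.

Hypothesis indicV : forall B, measurable B -> approximable (fun t => ((\1_B t)%:C)%C).

(** Increasing simple functions [g n] below [u] satisfy [(u - g n)^2 <= u^2], which is the required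
    domination. *)
Lemma approximable_ge0 (u : T -> R) : measurable_fun setT u ->
  (forall t, 0 <= u t) -> mu.-integrable setT (EFin \o (fun t => u t ^+ 2)) ->
  approximable (fun t => ((u t)%:C)%C).
Proof.
move=> mu' u0 iu.
have mEu : measurable_fun setT (EFin \o u) by exact/measurable_EFinP.
pose g := nnsfun_approx measurableT mEu.
have gcv t : g n t @[n --> \oo] --> u t.
  have uE0 x : setT x -> (0 <= (EFin \o u) x)%E by rewrite lee_fin u0.
  exact: (fine_cvg (cvg_nnsfun_approx measurableT mEu uE0 I)).
have gu n t : g n t <= u t.
  rewrite -(cvg_lim _ (gcv t))//; apply: nondecreasing_cvgn_le.
    by move=> i j ij; have /lefP := nd_nnsfun_approx measurableT mEu ij; apply.
  by apply/cvg_ex; exists (u t); exact: gcv.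
apply: (@approximable_dominated _ (fun n t => ((g n t)%:C)%C) (fun t => u t ^+ 2)) => //.
- move=> n.
  have [N [c [B [mB gE]]]] : exists N (c : 'I_N -> R) (B : 'I_N -> set T),
      (forall i, measurable (B i)) /\ forall t, g n t = \sum_(i < N) c i * \1_(B i) t.
    do 3 eexists; split; last exact: (fimfunEord (g n)).
    by move=> i; exact: measurable_sfunP.
  rewrite (_ : (fun _ => _) = fun t => \sum_(i < N) ((c i)%:C)%C * ((\1_(B i) t)%:C)%C).
    by apply: approximable_sum => i; apply: approximableZ; apply: indicV.
  by apply/funext => t; rewrite gE rmorph_sum /=; apply: eq_bigr => i _; rewrite rmorphM.
- apply: aeW => t.
  rewrite (_ : (fun n => _) = fun n => (u t - g n t) * (u t - g n t)).
    by rewrite -[X in _ --> X](mulr0 0) -(subrr (u t)); apply: cvgM; apply: cvgB => //; exact: cvg_cst.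
  by apply/funext => n; rewrite -rmorphB nsq_real expr2.
- move=> n t; rewrite -rmorphB nsq_real ler_sqr ?nnegrE ?subr_ge0//.
  by rewrite lerBlDr lerDl.
Qed.

Lemma approximable_L2 f : tmeasurable f ->
  mu.-integrable setT (fun t => (nsq (f t))%:E) -> approximable f.
Proof.
move=> [rf jf] iF.
have real_case (u : T -> R) : measurable_fun setT u ->
    (forall t, u t ^+ 2 <= nsq (f t)) -> approximable (fun t => ((u t)%:C)%C).
  move=> mu' uf.
  have posu : measurable_fun setT (fun t => Num.max (u t) 0).
    by apply: measurable_maxr => //; exact: measurable_cst.
  have negu : measurable_fun setT (fun t => Num.max (- u t) 0).
    by apply: measurable_maxr; [exact: measurableT_comp|exact: measurable_cst].
  have ile (v : T -> R) : measurable_fun setT v -> (forall t, v t ^+ 2 <= u t ^+ 2) ->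
      mu.-integrable setT (EFin \o (fun t => v t ^+ 2)).
    move=> mv vu; apply: (le_integrable measurableT) iF => //=.
      by apply/measurable_EFinP; exact: measurable_funX.
    move=> t _; rewrite lee_fin !ger0_norm ?nsq_ge0 ?sqr_ge0//.
    by rewrite (le_trans (vu t)).
  have ap : approximable (fun t => ((Num.max (u t) 0)%:C)%C).
    apply: approximable_ge0 => //; first by move=> t; rewrite le_max lexx orbT.
    by apply: ile => // t; case: (leP (u t) 0) => // _; rewrite expr0n sqr_ge0.
  have an : approximable (fun t => ((Num.max (- u t) 0)%:C)%C).
    apply: approximable_ge0 => //; first by move=> t; rewrite le_max lexx orbT.
    by apply: ile => // t; case: (leP (- u t) 0) => // _; rewrite ?expr0n ?sqrrN ?sqr_ge0.
  have := approximableD ap (approximableZ (-1) an).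
  rewrite (_ : (fun t => _ + _) = fun t => ((u t)%:C)%C)//.
  apply/funext => t; rewrite mulN1r -rmorphB; congr (_%:C)%C.
  case: (ltrgtP (u t) 0) => ut.
  - by rewrite max_l ?sub0r ?opprK// oppr_ge0 ltW.
  - by rewrite max_r ?subr0// oppr_le0 ltW.
  - by rewrite ut oppr0 maxxx subrr.
have aR : approximable (fun t => ((Re (f t))%:C)%C).
  by apply: real_case => // t; rewrite /nsq lerDl sqr_ge0.
have aI : approximable (fun t => ((Im (f t))%:C)%C).
  by apply: real_case => // t; rewrite /nsq lerDr sqr_ge0.
have := approximableD aR (approximableZ (Complex 0 1) aI).
rewrite (_ : (fun t => _ + _) = f)//.
by apply/funext => t; apply: complex_eqP; rewrite !ReImE /=; ring.
Qed.

End square_approximation.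

Section peak.
Variable R : realType.
Implicit Types (x y q : R).

Lemma bernoulli_le x n : -1 <= x -> 1 + n%:R * x <= (1 + x) ^+ n.
Proof.
move=> x1; elim: n => [|n ih]; first by rewrite mul0r addr0 expr0.
rewrite exprS; have x0 : 0 <= 1 + x by lra.
apply: le_trans (ler_wpM2l x0 ih); rewrite -natr1.
have : 0 <= n%:R * x ^+ 2 by rewrite mulr_ge0 ?sqr_ge0.
nra.
Qed.

(** Bernoulli's inequality at [- q ^+ n]. The exponent [2 ^ n] places the threshold at [q = 1/2],
    where [2 * q] crosses 1. *)
Lemma peak_low q n : 0 <= q -> q < 1 / 2 ->
  1 - (1 - q ^+ n) ^+ (2 ^ n) <= (2 * q) ^+ n.
Proof.
move=> q0 q2; have qn1 : q ^+ n <= 1 by rewrite exprn_ile1//; lra.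
have := @bernoulli_le (- q ^+ n) (2 ^ n) _.
by rewrite lerN2 => /(_ qn1); rewrite exprMn natrX; lra.
Qed.

(** Put [y = q ^+ n] and [k = 2 ^ n], so that [k y = (2 q)^n]. By Bernoulli, [(1 - y)^k (k y) <= (1
    - y)^k (1 + y)^k = (1 - y^2)^k <= 1]. *)
Lemma peak_high q n : 1 / 2 < q -> q <= 1 ->
  (1 - q ^+ n) ^+ (2 ^ n) <= ((2 * q)^-1) ^+ n.
Proof.
move=> q2 q1; have q0 : 0 < q by lra.
set y := q ^+ n; have y0 : 0 < y by rewrite exprn_gt0.
have y1 : y <= 1 by rewrite exprn_ile1// ltW.
have ky : (2 * q) ^+ n = (2 ^ n)%:R * y by rewrite exprMn natrX.
have k0 : 0 < (2 ^ n)%:R * y by rewrite -ky exprn_gt0// mulr_gt0.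
rewrite exprVn ky -[leRHS]mul1r ler_pdivlMr//.
have y1' : 0 <= (1 - y) ^+ (2 ^ n) by rewrite exprn_ge0// subr_ge0.
have B : 1 + (2 ^ n)%:R * y <= (1 + y) ^+ (2 ^ n) by apply: bernoulli_le; lra.
apply: (@le_trans _ _ ((1 - y) ^+ (2 ^ n) * (1 + y) ^+ (2 ^ n))).
  by apply: ler_wpM2l => //; apply: le_trans B; rewrite lerDr.
rewrite -exprMn exprn_ile1//.
  by apply: mulr_ge0; lra.
nra.
Qed.

(* The polynomial step of the Brosowski-Deutsch proof of the Stone-Weierstrass theorem: as n
   grows, it tends to 1 for q < 1/2 and to 0 for q > 1/2. *)
Definition peak q n := (1 - q ^+ n) ^+ (2 ^ n).

Lemma peak_itv q n : 0 <= q <= 1 -> 0 <= peak q n <= 1.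
Proof.
move=> /andP[q0 q1]; have h : q ^+ n <= 1 by rewrite exprn_ile1.
have h0 : 0 <= q ^+ n by rewrite exprn_ge0.
by rewrite /peak exprn_ge0 ?subr_ge0//= exprn_ile1 ?subr_ge0// gerBl.
Qed.

Lemma cvg_peak_low q : 0 <= q -> q < 1 / 2 -> peak q n @[n --> \oo] --> (1 : R).
Proof.
move=> q0 q2; have c0 : (fun n => (2 * q) ^+ n) @ \oo --> (0 : R).
  by apply: cvg_expr; rewrite ger0_norm; lra.
have c1 : (fun n => 1 - (2 * q) ^+ n) @ \oo --> (1 : R).
  by rewrite -[X in _ --> X]subr0; apply: cvgB => //; exact: cvg_cst.
apply: (squeeze_cvgr (f := fun n => 1 - (2 * q) ^+ n) (h := fun=> 1) _ c1 (cvg_cst _)).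
apply: nearW => n.
have q01 : 0 <= q <= 1 by rewrite q0; lra.
have /andP[_ ->] := peak_itv n q01; rewrite andbT.
by have := peak_low n q0 q2; rewrite /peak; lra.
Qed.

Lemma cvg_peak_high q : 1 / 2 < q -> q <= 1 -> peak q n @[n --> \oo] --> (0 : R).
Proof.
move=> q2 q1; have c0 : (fun n => ((2 * q)^-1) ^+ n) @ \oo --> (0 : R).
  apply: cvg_expr; rewrite ger0_norm ?invr_ge0; last lra.
  by rewrite invf_lt1; lra.
apply: (squeeze_cvgr (f := fun=> 0) (h := fun n => ((2 * q)^-1) ^+ n) _ (cvg_cst _) c0).
apply: nearW => n.
have q01 : 0 <= q <= 1 by rewrite q1; lra.
have /andP[-> _] := peak_itv n q01.
exact: peak_high.
Qed.

End peak.

Section arcs.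
Variable R : realType.
Local Notation C := R[i].
Local Notation T := (lebesgueType R).
Local Notation mu := (@unit_measure R).

(* A trigonometric polynomial of degree 1 exceeding 1/2 exactly on the arc 0 < t < b. *)
Definition arc_test (b t : R) : R := 1 / 2 - sin (pi * t) * sin (pi * t - pi * b) / 2.

Lemma arc_test_itv (b t : R) : 0 <= arc_test b t <= 1.
Proof.
have h (x : R) : -1 <= sin x <= 1 by rewrite sin_geN1 sin_le1.
have := h (pi * t); have := h (pi * t - pi * b); rewrite /arc_test.
move: (sin _) (sin _) => x y /andP[x1 x2] /andP[y1 y2].
by apply/andP; split; nra.
Qed.

Lemma arc_test_high (b t : R) : b <= 1 -> 0 < t -> t < b -> 1 / 2 < arc_test b t.
Proof.
move=> b1 t0 tb; have p0 := @pi_gt0 R.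
have s1 : 0 < sin (pi * t) by apply: sin_gt0_pi; apply/andP; split; nra.
have s2 : 0 < sin (pi * b - pi * t) by apply: sin_gt0_pi; apply/andP; split; nra.
have e : pi * t - pi * b = - (pi * b - pi * t) by ring.
by rewrite /arc_test e sinN; nra.
Qed.

Lemma arc_test_low (b t : R) : 0 <= b -> b < t -> t < 1 -> arc_test b t < 1 / 2.
Proof.
move=> b1 t0 tb; have p0 := @pi_gt0 R.
have s1 : 0 < sin (pi * t) by apply: sin_gt0_pi; apply/andP; split; nra.
have s2 : 0 < sin (pi * t - pi * b) by apply: sin_gt0_pi; apply/andP; split; nra.
rewrite /arc_test; nra.
Qed.

(** The product of sines in [arc_test] written as a sum: [arc_test b t = 1/2 - cos (pi b) / 4 + cos
    (2 pi t - pi b) / 4], where the last cosine is half of [z] times the conjugate of [expi (b / 2)]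
    plus its conjugate. *)
Definition arc_trig (b : R) (z : circle R) : C :=
  ((1 / 8)%:C)%C * (val z * ((expi (b / 2))^*)%R + ((val z : C)^*)%R * expi (b / 2))
  + ((1 / 2 - cos (pi * b) / 4)%:C)%C.

Lemma trigpoly_arc_trig b : trigpoly (arc_trig b).
Proof.
apply: trigpolyD; last exact: trigpoly_cst.
apply: trigpolyZ; apply: trigpolyD; apply: trigpolyM.
- exact: trigpoly_val.
- exact: trigpoly_cst.
- exact: trigpoly_conj.
- exact: trigpoly_cst.
Qed.

Lemma arc_trigE (b t : R) : arc_trig b (@circle_of R t) = ((arc_test b t)%:C)%C.
Proof.
rewrite /arc_trig val_circle_of; apply: complex_eqP; rewrite !ReImE /=; last by ring.
have -> : 2 * pi * t = (pi * t) *+ 2 by rewrite mulr2n; ring.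
have -> : 2 * pi * (b / 2) = pi * b by field.
rewrite sin_mulr2n cos_mulr2n /arc_test sinB !mulr2n.
have := cos2Dsin2 (pi * t).
move: (cos (pi * t)) (sin (pi * t)) (cos (pi * b)) (sin (pi * b)) => c s c' s' h.
have -> : c ^+ 2 = 1 - s ^+ 2 by rewrite -h addrK.
by field.
Qed.

Definition pulled_trigpoly : set (T -> C) :=
  [set f | exists2 p, trigpoly p & f = fun t => p (circle_of t)].

Local Notation approximable := (approximable mu pulled_trigpoly).

Lemma pulled_measurable f : pulled_trigpoly f -> tmeasurable f.
Proof.
move=> [p /L2_trigpoly[[rp jp] _] ->].
by split; [apply: (measurableT_comp rp)|apply: (measurableT_comp jp)];
  exact: measurable_circle_of.
Qed.

Lemma pulled_cst a : pulled_trigpoly (fun=> a).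
Proof. by exists (fun=> a) => //; exact: trigpoly_cst. Qed.

Lemma pulledD f g : pulled_trigpoly f -> pulled_trigpoly g ->
  pulled_trigpoly (fun t => f t + g t).
Proof.
move=> [p tp ->] [q tq ->].
by exists (fun z => p z + q z) => //; exact: trigpolyD.
Qed.

Lemma pulledM f g : pulled_trigpoly f -> pulled_trigpoly g ->
  pulled_trigpoly (fun t => f t * g t).
Proof.
move=> [p tp ->] [q tq ->].
by exists (fun z => p z * q z) => //; exact: trigpolyM.
Qed.

Lemma mu_integrable_cst (a : R) : mu.-integrable setT (EFin \o cst a).
Proof.
apply: measurable_bounded_integrable => //; first by rewrite [X in (X < _)%E]mu_setT ltry.
exact: bounded_cst.
Qed.

Lemma measurable_cara (B : set R) : measurable (B : set (measurableTypeR R)) ->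
  measurable (B : set T).
Proof. exact: sub_caratheodory. Qed.

(** Inside the arc [arc_test] exceeds 1/2, where [peak] tends to 0, and outside it is below 1/2,
    where [peak] tends to 1. Hence [1 - peak] tends to the indicator, and each of its terms is a
    trigonometric polynomial. *)
Lemma approximable_ray (x : R) : approximable (fun t => ((\1_(`]-oo, x[%classic) t)%:C)%C).
Proof.
have mB : measurable (`]-oo, x[%classic : set T) by apply: measurable_cara; exact: measurable_itv.
(* The measure lives on [[0, 1[], where the ray is the interval from 0 to [x] clamped to
   [[0, 1]]. *)
pose b := Num.min (Num.max x 0) 1.
have b0 : 0 <= b by rewrite /b le_min le_max lexx orbT ler01.
have b1 : b <= 1 by rewrite /b ge_min lexx orbT.
have mf := tmeasurable_indic R mB.
pose g n (t : T) := 1 - (1 - arc_trig b (circle_of t) ^+ n) ^+ (2 ^ n).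
have dominated := approximable_dominated pulled_measurable mf.
apply: (dominated mu g (fun=> 1)); rewrite /g {dominated}.
- move=> n; apply: (approximable_id mu pulled_measurable).
  exists (fun z => 1 - (1 - arc_trig b z ^+ n) ^+ (2 ^ n)) => //.
  have h p : trigpoly p -> trigpoly (fun z => 1 - p z).
    move=> tp; under eq_fun do rewrite -mulN1r.
    by apply: trigpolyD; [exact: trigpoly_cst|exact: trigpolyZ].
  by apply/h/trigpolyX/h/trigpolyX/trigpoly_arc_trig.
- exact: mu_integrable_cst.
(* At 0 and at [b] the test takes the value 1/2, where the limit of [peak] is neither 0 nor 1. *)
- apply: (@mu_null_ae _ _ b) => t t0 t1 tb.
  set L : R := \1_(`]-oo, x[%classic) t.
  rewrite (_ : (fun n => _) = fun n => (L - (1 - peak (arc_test b t) n)) *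
      (L - (1 - peak (arc_test b t) n))); last first.
    apply/funext => n; rewrite arc_trigE /peak -rmorphXn -(rmorph1 (real_complex R)).
    by rewrite -rmorphB -rmorphXn -!rmorphB nsq_real expr2.
  suff cv : peak (arc_test b t) n @[n --> \oo] --> (1 - L : R).
    have cv0 : (L - (1 - peak (arc_test b t) n)) @[n --> \oo] --> (0 : R).
      rewrite [X in _ --> X](_ : 0 = L - (1 - (1 - L))); last by ring.
      by apply: cvgB; [exact: cvg_cst|apply: cvgB => //; exact: cvg_cst].
    by rewrite -(mulr0 0); exact: cvgM.
  have /andP[T0 T1] := arc_test_itv b t.
  have [tltb|blet] := ltP (t : R) b.
    have -> : L = 1.
      rewrite /L indicE mem_set// /= in_itv /=; move: tltb.
      by rewrite /b !lt_min lt_max => /andP[/orP[//|]]; lra.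
    by rewrite subrr; apply: cvg_peak_high => //; exact: arc_test_high.
  have bt : b < (t : R) by rewrite lt_neqAle blet andbT eq_sym; exact/eqP.
  have -> : L = 0.
    rewrite /L indicE memNset// /= in_itv /= => tx; move: bt.
    by rewrite /b gt_min gt_max => /orP[/andP[]|]; lra.
  by rewrite subr0; apply: cvg_peak_low => //; exact: arc_test_low.
- move=> n t; rewrite arc_trigE -rmorphXn -(rmorph1 (real_complex R)).
  rewrite -rmorphB -rmorphXn -!rmorphB nsq_real.
  have /andP[] := peak_itv n (arc_test_itv b t); rewrite /peak.
  move: ((1 - _) ^+ _) => y y0 y1; rewrite indicE; case: (_ \in _) => /=; nra.
Qed.

End arcs.

Section trigpoly_density.
Variable R : realType.
Local Notation C := R[i].
Local Notation T := (lebesgueType R).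
Local Notation mu := (@unit_measure R).
Local Notation m := (@arc_length R).
Local Notation approx := (approximable mu (@pulled_trigpoly R)).

Lemma approximable_setC (B : set T) : approx (fun t => ((\1_B t)%:C)%C) ->
  approx (fun t => ((\1_(~` B) t)%:C)%C).
Proof.
move=> aB.
have h := approximableD (@pulled_measurable R) (@pulledD R)
  (approximable_cst mu (@pulled_measurable R) (@pulled_cst R) 1)
  (approximableZ (@pulled_measurable R) (@pulled_cst R) (@pulledM R) (-1) aB).
rewrite (_ : (fun t => _) = fun t : T => 1 + -1 * ((\1_B t)%:C)%C)//.
apply/funext => t; rewrite !indicE in_setC.
by case: (t \in B) => /=; rewrite mulN1r ?subrr ?subr0// rmorph0 ?subr0.
Qed.

Lemma sum_indic_trivIset (F : (set T)^nat) (t : T) k n : trivIset [set: nat] F -> F k t ->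
  \sum_(i < n) \1_(F i) t = (k < n)%:R :> R.
Proof.
move=> tF Fkt; have e i : \1_(F i) t = (i == k)%:R :> R.
  rewrite indicE; suff -> : (t \in F i) = (i == k) by [].
  apply/idP/eqP => [|->]; last by rewrite mem_set.
  move=> /set_mem Fit; apply: contrapT => /eqP ik.
  have /trivIsetP/(_ i k I I ik)/seteqP[+ _] := tF.
  by move=> /(_ t); apply.
under eq_bigr do rewrite e.
case: ltnP => kn.
  rewrite (bigD1 (Ordinal kn))//= eqxx big1 ?addr0// => i.
  by rewrite -val_eqE /= => /negPf ->.
by rewrite big1// => i _; rewrite ltn_eqF// (leq_trans (ltn_ord i)).
Qed.

(** The union minus a finite partial sum is the indicator of the remaining sets, so it is bounded by
    1 and vanishes eventually at each point. *)
Lemma approximable_bigcup (F : (set T)^nat) : (forall n, measurable (F n)) ->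
  trivIset [set: nat] F -> (forall n, approx (fun t => ((\1_(F n) t)%:C)%C)) ->
  approx (fun t => ((\1_(\bigcup_k F k) t)%:C)%C).
Proof.
move=> mF tF aF.
have mf := tmeasurable_indic R (bigcupT_measurable F mF).
have dominated := approximable_dominated (@pulled_measurable R) mf.
pose g n (t : T) := \sum_(i < n) ((\1_(F i) t)%:C)%C : C.
have gE n t : ((\1_(\bigcup_k F k) t)%:C)%C - g n t =
    ((if `[< exists2 k, (n <= k)%N & F k t >] then 1 else 0 : R)%:C)%C.
  rewrite /g -rmorph_sum -rmorphB; congr (_%:C)%C.
  have [[k _ Fkt]|nF] := pselect ((\bigcup_k F k) t).
    rewrite indicE mem_set; last by exists k.
    rewrite (sum_indic_trivIset _ tF Fkt).
    case: asboolP => [[j nj Fjt]|nk].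
      have -> : k = j.
        apply: contrapT => /eqP kj.
        have /trivIsetP/(_ k j I I kj)/seteqP[+ _] := tF.
        by move=> /(_ t); apply.
      by rewrite ltnNge nj subr0.
    case: ltnP => kn; first by rewrite subrr.
    by exfalso; apply: nk; exists k.
  rewrite indicE memNset// big1 ?subrr => [|i _].
    by case: asboolP => // -[k _ Fkt]; exfalso; apply: nF; exists k.
  by rewrite indicE memNset// => Fit; apply: nF; exists i.
apply: (dominated mu g (fun=> 1)); rewrite {dominated}.
- move=> n; exact: (approximable_sum (@pulled_measurable R) (@pulled_cst R) (@pulledD R)).
- exact: mu_integrable_cst.
- apply: aeW => t; under eq_fun do rewrite gE nsq_real.
  have [[k _ Fkt]|nF] := pselect ((\bigcup_k F k) t); last first.
    rewrite (_ : (fun n => _) = fun=> 0); first exact: cvg_cst.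
    apply/funext => n; case: asboolP => [[j _ Fjt]|_]; last by rewrite expr0n.
    by exfalso; apply: nF; exists j.
  apply: cvg_near_cst; exists k.+1 => // n /= kn.
  case: asboolP => [[j nj Fjt]|_]; last by rewrite expr0n.
  have kj : k != j by rewrite neq_ltn (leq_trans kn nj).
  have /trivIsetP/(_ k j I I kj)/seteqP[+ _] := tF.
  by move=> /(_ t (conj Fkt Fjt)).
- by move=> n t; rewrite gE nsq_real; case: asboolP => _; rewrite ?expr1n ?expr0n.
Qed.

(** Dynkin's lemma: open left rays generate the Borel sets and are stable under intersection. *)
Lemma approximable_Borel (B : set R) : measurable (B : set (measurableTypeR R)) ->
  approx (fun t => ((\1_B t)%:C)%C).
Proof.
have mE := RGenInftyO.measurableE R.
move=> mB; move: (mB); rewrite [X in X _ -> _]mE; move: B {mB}.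
apply: (@dynkin_induction _ (measurableTypeR R) _
  (fun B : set R => approx (fun t => ((\1_B t)%:C)%C))).
- exact: mE.
- move=> _ _ [x ->] [y ->]; exists (Num.min x y).
  by apply/seteqP; split => t /=; rewrite !in_itv /= lt_min => /andP.
- rewrite (_ : (fun t => _) = fun=> 1); last first.
    by apply/funext => t; rewrite indicE in_setT.
  exact: (approximable_cst mu (@pulled_measurable R) (@pulled_cst R) 1).
- by move=> _ [x ->]; exact: approximable_ray.
- by move=> S mS; exact: approximable_setC.
- move=> F mF tF; apply: approximable_bigcup tF => n.
  exact: measurable_cara (mF n).
Qed.

(** A Lebesgue measurable set is a Borel set up to a subset of a Borel null set, and [dist2] does
    not see the difference. *)
Lemma approximable_Lebesgue (B : set T) : measurable B ->
  approx (fun t => ((\1_B t)%:C)%C).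
Proof.
move=> mB; move: (mB); rewrite -completed_caratheodory_measurable.
rewrite g_sigma_completed_algebra_genE => -[X mX [N [M [mM M0 NM]] XN]].
apply: (approximable_limit (@pulled_measurable R) (tmeasurable_indic R mB)) => e e0.
exists (fun t => ((\1_X t)%:C)%C); first exact: approximable_Borel.
rewrite /dist2 (ae_eq_integral (cst 0%E)).
- by rewrite integral_cst//= mul0e lee_fin ltW.
- exact: measurableT.
- apply: tmeasurable_nsq; apply: tmeasurableB; apply: tmeasurable_indic => //.
  exact: measurable_cara.
- exact: measurable_cst.
- exists M; split.
  + exact: measurable_cara.
  + apply/eqP; rewrite eq_le measure_ge0 andbT [X in (X <= _)%E](mu_Borel mM) -M0.
    by apply: le_measure; rewrite ?inE//; exact: measurableI.
  + move=> t /= h; apply: contrapT => nM; apply: h => _.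
    have tN : ~ N t by move=> /NM.
    congr (_%:E); rewrite !indicE -XN.
    have -> : (t \in X `|` N) = (t \in X).
      by apply/idP/idP => /set_mem; [case=> // ?; exact: mem_set|move=> ?; apply/mem_set; left].
    by rewrite subrr nsq0.
Qed.

Lemma trigpoly_tmeasurable p : trigpoly p -> tmeasurable (p : circle R -> C).
Proof. by move=> /L2_trigpoly[[rp jp] _]. Qed.

Lemma approximable_circle_indic (A : set (circle R)) : measurable A ->
  approximable m (@trigpoly R) (fun z => ((\1_A z)%:C)%C).
Proof.
move=> mA; split; first exact: tmeasurable_indic.
move=> e e0.
have mB : measurable (@circle_of R @^-1` A).
  by rewrite -[_ @^-1` _]setTI; exact: measurable_circle_of.
have [_ /(_ e e0)[_ [p tp ->] pe]] := approximable_Lebesgue mB.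
exists p => //; apply: le_trans pe; rewrite /dist2.
have mp := trigpoly_tmeasurable tp.
rewrite (integral_unit_measure (v := fun z => (nsq (((\1_A z)%:C)%C - p z))%:E)).
- by [].
- exact: (tmeasurable_nsq (tmeasurableB (tmeasurable_indic R mA) mp)).
- by move=> z; rewrite lee_fin nsq_ge0.
Qed.

(** The abstract approximation theorem is run on the circle itself, its hypothesis on indicators
    having been obtained on the line. *)
Theorem trigpoly_dense (f : circle R -> C) (e : R) : L2 f -> 0 < e ->
  exists2 p, trigpoly p & N2 (fun z => f z - p z) <= e.
Proof.
move=> lf e0; have [[rf jf] [int_f]] := lf.
have mf : tmeasurable f by [].
have [_ /(_ e e0)[p tp pe]] := approximable_L2 trigpoly_tmeasurable
  (@trigpoly_cst R) (@trigpolyD R) (@trigpolyM R) approximable_circle_indic mf int_f.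
exists p => //.
have [_ [/(integrable_fin_num measurableT) i1]] := L2B lf (L2_trigpoly tp).
by rewrite -lee_fin /N2 /Rintegral fineK.
Qed.

End trigpoly_density.

(** * Fourier coefficients *)

Section characters.
Variable R : realType.
Local Notation C := R[i].
Local Notation Re := complex.Re.
Local Notation Im := complex.Im.
Local Notation T := (lebesgueType R).
Local Notation mu := (@unit_measure R).
Local Notation m := (@arc_length R).
Local Notation leb := (@lebesgue_measure R).

(** Leads from the completed measure back to Lebesgue measure on the Borel sets, where the
    fundamental theorem of calculus applies. *)
Lemma integral_mu_lebesgue (v : R -> R) :
  measurable_fun setT (v : measurableTypeR R -> R) -> (forall t, 0 <= v t) ->
  (\int[mu]_t (v t)%:E = \int[leb]_(t in `[0%R, 1%R]) (v t)%:E)%E.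
Proof.
move=> mv v0.
pose D : set (measurableTypeR R) := `[0, 1[%classic.
have mD : measurable D by exact: measurable_itv.
have mDT : measurable (D : set T) by exact: measurable_cara.
have mEv : measurable_fun setT (fun t : measurableTypeR R => (v t)%:E).
  by apply/measurable_EFinP.
have mEvT : measurable_fun setT (fun t : T => (v t)%:E).
  by apply/measurable_EFinP; exact: measurable_lebesgue.
have mid : measurable_fun setT ((fun t => t) : T -> measurableTypeR R).
  by move=> _ B mB; rewrite setTI; exact: measurable_cara.
have muD : mu (~` (D : set T)) = 0%E.
  by rewrite [LHS](mu_Borel (measurableC mD)) setIC setICr measure0.
rewrite (ge0_negligible_integral (measurableC mDT) measurableT mEvT _ muD); last first.
  by move=> t _; rewrite lee_fin.
rewrite setTD setCK.
transitivity (\int[pushforward mu ((fun t => t) : T -> measurableTypeR R)]_(t in D) (v t)%:E)%E.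
  rewrite ge0_integral_pushforward//.
  - exact: measurable_funTS.
  - by move=> t _; rewrite lee_fin.
transitivity (\int[leb]_(t in D) (v t)%:E)%E; last first.
  rewrite /D integral_itv_bndo_bndc//.
  by apply/measurable_EFinP; exact: measurable_funTS.
apply: eq_measure_integral => A mA AD.
by rewrite -[LHS]/(leb (A `&` `[0, 1[%classic)) setIidl.
Qed.

Lemma expiD (s t : R) : expi (s + t) = expi s * expi t.
Proof.
rewrite /expi mulrDr cosD sinD; apply: complex_eqP; rewrite /= ?addrA//.
by rewrite addrC.
Qed.

Lemma expiX (t : R) n : expi t ^+ n = expi (n%:R * t).
Proof.
elim: n => [|n ih]; last by rewrite exprS ih -expiD -natr1; congr expi; ring.
by rewrite mul0r expr0 /expi mulr0 cos0 sin0.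
Qed.

Lemma integral_wave (w a b : R) : w != 0 -> cos w = 1 -> sin w = 0 ->
  (\int[leb]_(t in `[0%R, 1%R]) (1 + (a * cos (w * t) + b * sin (w * t)))%:E = 1%:E)%E.
Proof.
move=> w0 cw sw.
pose F t := t + (a * (w^-1 * sin (w * t)) - b * (w^-1 * cos (w * t))).
have dl (t : R) : is_derive t (1 : R) (fun t : R => w * t) w.
  have h := is_deriveZ w (is_derive_id t (1 : R)).
  by apply: (is_derive_eq h); rewrite /GRing.scale /= mulr1.
have dF (t : R) : is_derive t (1 : R) F (1 + (a * cos (w * t) + b * sin (w * t))).
  have ds : is_derive t (1 : R) (fun t => sin (w * t)) (w * cos (w * t)).
    have h := @is_derive1_comp _ sin (fun t => w * t) t _ _ (is_derive_sin _) (dl t).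
    by apply: (is_derive_eq h); rewrite mulrC.
  have dc : is_derive t (1 : R) (fun t => cos (w * t)) (- (w * sin (w * t))).
    have h := @is_derive1_comp _ cos (fun t => w * t) t _ _ (is_derive_cos _) (dl t).
    by apply: (is_derive_eq h); rewrite mulNr mulrC.
  have h := is_deriveD (is_derive_id t (1 : R))
    (is_deriveB (is_deriveZ (a / w) ds) (is_deriveZ (b / w) dc)).
  rewrite (_ : F = id + ((a / w) \*: (fun t => sin (w * t)) - (b / w) \*: (fun t => cos (w * t)))).
    by apply: (is_derive_eq h); rewrite /GRing.scale /=; field.
  by apply/funext => s; rewrite /F !fctE /= /GRing.scale /= !mulrA.
have cF (t : R) : {for t, continuous F}.
  by apply: differentiable_continuous; apply/derivable1_diffP; case: (dF t).
rewrite (@continuous_FTC2 _ _ F 0 1)//.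
- rewrite -EFinB; congr (_%:E); rewrite /F !mulr1 !mulr0 cw sw cos0 sin0; ring.
- apply: continuous_subspaceT => t.
  apply: cvgD; first exact: cvg_cst.
  by apply: cvgD; apply: cvgMr; apply: (@continuous_comp _ _ _ (fun t => w * t));
   [exact: mulrl_continuous|exact: continuous_cos|exact: mulrl_continuous|exact: continuous_sin].
- split; [by move=> t _; case: (dF t)| |].
  + by apply: cvg_at_right_filter; exact: cF.
  + by apply: cvg_at_left_filter; exact: cF.
- by move=> t _; rewrite derive1E; case: (dF t).
Qed.

(** The added constant 1 makes the integrand nonnegative, as the change of variables for nonnegative
    functions demands. The choices [(1, 0)] and [(0, 1)] of [(a, b)] then isolate the real and
    imaginary parts. *)
Lemma integral_character_wave (a b : R) (n : nat) : `|a| + `|b| <= 1 ->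
  \int[m]_z (1 + (a * Re ((val z : C) ^+ n.+1) + b * Im ((val z : C) ^+ n.+1))) = 1.
Proof.
move=> ab; pose w : R := pi *+ 2 *+ n.+1.
have pi0 : pi != 0 :> R by apply: lt0r_neq0; exact: pi_gt0.
have w0 : w != 0 by rewrite /w mulrn_eq0 mulrn_eq0 (negbTE pi0).
have cw : cos w = 1 by rewrite -(add0r w) (periodicn (@cosD2pi R)) cos0.
have sw : sin w = 0 by rewrite -(add0r w) (periodicn (@sinD2pi R)) sin0.
have ge0 (c s : R) : c ^+ 2 + s ^+ 2 = 1 -> 0 <= 1 + (a * c + b * s).
  move=> cs; have c1 : `|c| <= 1 by rewrite ler_norml; apply/andP; split; nra.
  have s1 : `|s| <= 1 by rewrite ler_norml; apply/andP; split; nra.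
  have h1 : - `|a| <= a * c.
    by rewrite lerNl (le_trans (ler_norm _))// normrN normrM ler_piMr.
  have h2 : - `|b| <= b * s.
    by rewrite lerNl (le_trans (ler_norm _))// normrN normrM ler_piMr.
  lra.
pose v (t : R) := 1 + (a * cos (w * t) + b * sin (w * t)).
have v0 t : 0 <= v t by apply: ge0; rewrite cos2Dsin2.
have vE (t : R) : 1 + (a * Re (expi t ^+ n.+1) + b * Im (expi t ^+ n.+1)) = v t.
  rewrite expiX /expi /= /v (_ : 2 * pi * (n.+1%:R * t) = w * t)//.
  by rewrite /w -[_ *+ n.+1]mulr_natr mulr2n; ring.
have mf := cmeasurableX n.+1 (@cmeasurable_val R).
have mu' : measurable_fun setT (fun z : circle R =>
    1 + (a * Re ((val z : C) ^+ n.+1) + b * Im ((val z : C) ^+ n.+1))).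
  case: mf => mr mi; apply: measurable_funD; first exact: measurable_cst.
  by apply: measurable_funD; apply: measurable_funM => //; exact: measurable_cst.
have mlin : measurable_fun setT (fun t : measurableTypeR R => w * t : R).
  by apply: measurable_funM => //; exact: measurable_id.
have mv : measurable_fun setT (v : measurableTypeR R -> R).
  apply: measurable_funD; first exact: measurable_cst.
  apply: measurable_funD; apply: measurable_funM; try exact: measurable_cst.
    by apply: (measurableT_comp _ mlin); apply: continuous_measurable_fun; exact: continuous_cos.
  by apply: (measurableT_comp _ mlin); apply: continuous_measurable_fun; exact: continuous_sin.
rewrite /Rintegral integral_unit_measure.
- under eq_integral do rewrite vE.
  by rewrite (integral_mu_lebesgue mv v0) integral_wave.
- exact/measurable_EFinP.
- by move=> z; rewrite lee_fin ge0// -[LHS]/(nsq _) nsqX nsq_circle expr1n.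
Qed.

Lemma Cintegral_characterS n : Cintegral (fun z : circle R => (val z : C) ^+ n.+1) = 0.
Proof.
have [rf jf] := L2_cintegrable (L2_character R n.+1).
have i1 := @rintegrable_cst R 1.
apply: complex_eqP => /=.
  have := @integral_character_wave 1 0 n.
  rewrite normr0 normr1 addr0 => /(_ (lexx _)).
  under eq_rint do rewrite mul0r addr0 mul1r.
  by rewrite rintD// rint_cst; lra.
have := @integral_character_wave 0 1 n.
rewrite normr0 normr1 add0r => /(_ (lexx _)).
under eq_rint do rewrite mul0r add0r mul1r.
by rewrite rintD// rint_cst; lra.
Qed.

Lemma Cintegral_character (k : int) :
  Cintegral (fun z : circle R => (val z : C) ^ k) = (k == 0)%:R.
Proof.
case: k => [[|n]|n] /=.
- by rewrite (eq_Cintegral (g := fun=> 1)) ?Cintegral_cst.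
- exact: Cintegral_characterS.
- rewrite (eq_Cintegral (g := fun z => (((val z : C) ^+ n.+1)^*)%R)).
    by rewrite (Cintegral_conj (L2_cintegrable (L2_character R n.+1))) Cintegral_characterS rmorph0.
  by move=> z; rewrite circle_exp_Negz rmorphXn.
Qed.

End characters.

Section fourier_coefficients.
Variable R : realType.
Local Notation C := R[i].
Local Notation Re := complex.Re.
Local Notation Im := complex.Im.
Implicit Types (f g : circle R -> C) (j k : int).

Definition coef f k : C := Cintegral (fun z => (val z : C) ^ (- k) * f z).

Lemma L2_characterM k f : L2 f -> L2 (fun z => (val z : C) ^ k * f z).
Proof.
have h1 : {ae @arc_length R, forall z, nsq ((val z : C) ^ k) <= 1}.
  by apply: arc_aeW => z; rewrite nsq_circleX.
exact: (L2M_bounded (cmeasurable_character R k) h1).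
Qed.

Lemma N2_characterM k f : N2 (fun z => (val z : C) ^ k * f z) = N2 f.
Proof. by apply: eq_rint => z; rewrite nsqM nsq_circleX mul1r. Qed.

Lemma cintegrable_coef k f : L2 f -> cintegrable (fun z => (val z : C) ^ k * f z).
Proof. by move=> lf; exact: (L2_cintegrable (L2_characterM k lf)). Qed.

Lemma eq_coef f g k : f =1 g -> coef f k = coef g k.
Proof. by move=> fg; apply: eq_Cintegral => z; rewrite fg. Qed.

Lemma coefD f g k : L2 f -> L2 g -> coef (fun z => f z + g z) k = coef f k + coef g k.
Proof.
move=> lf lg; rewrite -(CintegralD (cintegrable_coef _ lf) (cintegrable_coef _ lg)).
by apply: eq_Cintegral => z; rewrite mulrDr.
Qed.

Lemma coefZ a f k : L2 f -> coef (fun z => a * f z) k = a * coef f k.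
Proof.
move=> lf; rewrite -(CintegralZ _ (cintegrable_coef _ lf)).
by apply: eq_Cintegral => z; rewrite mulrCA.
Qed.

Lemma coefB f g k : L2 f -> L2 g -> coef (fun z => f z - g z) k = coef f k - coef g k.
Proof.
move=> lf lg; rewrite -mulN1r -(coefZ (-1) k lg) -(coefD k lf (L2Z (-1) lg)).
by apply: eq_coef => z; rewrite mulN1r.
Qed.

Lemma coef_sum I (s : seq I) (P : pred I) (f : I -> circle R -> C) k :
  (forall i, P i -> L2 (f i)) ->
  coef (fun z => \sum_(i <- s | P i) f i z) k = \sum_(i <- s | P i) coef (f i) k.
Proof.
move=> lf; rewrite -Cintegral_sum; last by move=> i Pi; exact: (cintegrable_coef _ (lf i Pi)).
by apply: eq_Cintegral => z; rewrite mulr_sumr.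
Qed.

Lemma coef_cst (a : C) k : coef (fun=> a) k = if k == 0 then a else 0.
Proof.
rewrite /coef; under eq_Cintegral do rewrite mulrC.
rewrite CintegralZ; last exact: (L2_cintegrable (L2_character R _)).
by rewrite Cintegral_character oppr_eq0; case: eqP => _; rewrite ?mulr1 ?mulr0.
Qed.

Lemma coef_characterM f j k : coef (fun z => (val z : C) ^ j * f z) k = coef f (k - j).
Proof. by apply: eq_Cintegral => z; rewrite mulrA -circle_expD opprB addrC. Qed.

Lemma coef_character j k : coef (fun z => (val z : C) ^ j) k = (k == j)%:R.
Proof.
rewrite -subr_eq0 -[RHS](_ : (if k - j == 0 then 1 else 0) = _); last by case: eqP.
by rewrite -coef_cst -coef_characterM; apply: eq_coef => z; rewrite mulr1.
Qed.

Lemma coef_conj f k : L2 f -> coef (fun z => ((f z)^*)%R) k = ((coef f (- k))^*)%R.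
Proof.
move=> lf; rewrite -(Cintegral_conj (cintegrable_coef _ lf)).
by apply: eq_Cintegral => z; rewrite rmorphM /= circle_conjX !opprK.
Qed.

Lemma nsq_coef_le f k : L2 f -> nsq (coef f k) <= N2 f.
Proof.
move=> lf; rewrite -(N2_characterM (- k)).
exact: (nsq_Cintegral (L2_characterM _ lf)).
Qed.

Lemma coef_ae_eq f g k : L2 f -> L2 g -> {ae @arc_length R, forall z, f z = g z} ->
  coef f k = coef g k.
Proof.
move=> lf lg fg; apply: (Cintegral_ae_eq (cintegrable_coef _ lf) (cintegrable_coef _ lg)).
by apply: arc_aeS fg => z ->.
Qed.

Lemma N2B_character f (a : C) k : L2 f ->
  N2 (fun z => f z - a * (val z : C) ^ k) =
  N2 f - nsq (coef f k) + nsq (coef f k - a).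
Proof.
move=> lf; rewrite (eq_N2 (g := fun z => f z + (- a) * (val z : C) ^ k)); last first.
  by move=> z; rewrite mulNr.
rewrite (N2D lf (L2Z (- a) (L2_character R k))).
rewrite (N2Z _ (L2_character R k)) nsqN.
have -> : N2 (fun z : circle R => (val z : C) ^ k) = 1.
  by rewrite -[RHS]rint_cst; apply: eq_rint => z; exact: nsq_circleX.
have -> : Cintegral (fun z => ((f z)^*)%R * (- a * (val z : C) ^ k)) = - a * ((coef f k)^*)%R.
  rewrite -(Cintegral_conj (cintegrable_coef _ lf)).
  rewrite -(CintegralZ _ (cintegrable_conj (cintegrable_coef _ lf))).
  by apply: eq_Cintegral => z; rewrite rmorphM /= circle_conjX opprK mulrCA (mulrC (((f z)^*)%R)).
by rewrite /nsq !ReImE; ring.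
Qed.

(** Frequencies are removed one at a time; by orthogonality this leaves the coefficients still to be
    treated unchanged. The identity yields Bessel when [c] consists of the coefficients of [f], and
    Parseval when [c] comes from a good approximation. *)
Lemma N2B_trigpoly f (c : nat -> C) (N L : nat) : L2 f ->
  let p n z := \sum_(i < n) c i * (val z : C) ^ (i%:Z - N%:Z) in
  N2 (fun z => f z - p L z) =
  N2 f - \sum_(i < L) nsq (coef f (i%:Z - N%:Z)) +
    \sum_(i < L) nsq (coef f (i%:Z - N%:Z) - c i).
Proof.
move=> lf p.
have lp n : L2 (p n) by apply: L2_sum => i _; exact: (L2Z _ (L2_character R _)).
have cp n (k : nat) : (n <= k)%N -> coef (p n) (k%:Z - N%:Z) = 0.
  move=> nk; rewrite /p coef_sum => [|i _]; last exact: (L2Z _ (L2_character R _)).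
  rewrite big1// => i _; rewrite coefZ; last exact: L2_character.
  rewrite coef_character (inj_eq (addIr _)) eqz_nat gtn_eqF ?mulr0//.
  exact: (leq_trans (ltn_ord i)).
elim: L => [|L ih].
  by rewrite !big_ord0 subr0 addr0; apply: eq_N2 => z; rewrite /p big_ord0 subr0.
rewrite (eq_N2 (g := fun z => (f z - p L z) - c L * (val z : C) ^ (L%:Z - N%:Z))); last first.
  by move=> z; rewrite /p big_ord_recr /= opprD addrA.
rewrite N2B_character; last exact: (L2B lf (lp L)).
rewrite ih (coefB _ lf (lp L)) cp// subr0 !big_ord_recr /=.
by ring.
Qed.

End fourier_coefficients.

Section parseval.
Variable R : realType.
Local Notation C := R[i].
Implicit Types (f g : circle R -> C).

Definition pos_energy f M : R := \sum_(i < M) nsq (coef f i.+1%:Z).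
Definition neg_energy f M : R := \sum_(i < M) nsq (coef f (- i.+1%:Z)).

Lemma pos_energy_ge0 f M : 0 <= pos_energy f M.
Proof. by apply: sumr_ge0 => i _; exact: nsq_ge0. Qed.

Lemma neg_energy_ge0 f M : 0 <= neg_energy f M.
Proof. by apply: sumr_ge0 => i _; exact: nsq_ge0. Qed.

Lemma pos_energy_mono f M N : (M <= N)%N -> pos_energy f M <= pos_energy f N.
Proof.
move=> /subnKC <-; rewrite /pos_energy big_split_ord /= lerDl.
by apply: sumr_ge0 => i _; exact: nsq_ge0.
Qed.

Lemma neg_energy_mono f M N : (M <= N)%N -> neg_energy f M <= neg_energy f N.
Proof.
move=> /subnKC <-; rewrite /neg_energy big_split_ord /= lerDl.
by apply: sumr_ge0 => i _; exact: nsq_ge0.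
Qed.

Lemma window_energy f M : \sum_(i < M + M.+1) nsq (coef f (i%:Z - M%:Z)) =
  neg_energy f M + nsq (coef f 0) + pos_energy f M.
Proof.
rewrite big_split_ord /= -addrA; congr (_ + _).
  rewrite /neg_energy (reindex_inj rev_ord_inj) /=; apply: eq_bigr => i _.
  congr (nsq (coef f _)); rewrite -subzn; last exact: ltn_ord.
  by rewrite addrAC subrr add0r.
rewrite big_ord_recl /= addn0 subrr; congr (_ + _).
apply: eq_bigr => i _; congr (nsq (coef f _)).
by rewrite PoszD addrAC subrr add0r.
Qed.

Lemma bessel f M : L2 f -> neg_energy f M + nsq (coef f 0) + pos_energy f M <= N2 f.
Proof.
move=> lf; rewrite -window_energy -subr_ge0.
have := N2B_trigpoly (fun i => coef f (i%:Z - M%:Z)) M (M + M.+1) lf.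
rewrite [X in _ + X]big1 => [|i _]; last by rewrite subrr nsq0.
by rewrite addr0 => <-; exact: N2_ge0.
Qed.

(** On the frequencies of an approximating trigonometric polynomial, the Fourier coefficients do at
    least as well as its own coefficients. Monotonicity in the window then gives all larger [N]. *)
Lemma parseval f e : L2 f -> 0 < e -> exists M, forall N, (M <= N)%N ->
  N2 f <= neg_energy f N + nsq (coef f 0) + pos_energy f N + e.
Proof.
move=> lf e0; have [p tp pe] := trigpoly_dense lf e0.
have [N P hp] := tp; pose M := (N + size P)%N; exists M => K MK.
suff h : N2 f <= neg_energy f M + nsq (coef f 0) + pos_energy f M + e.
  apply: (le_trans h); rewrite lerD2r; apply: lerD; last exact: pos_energy_mono.
  by rewrite lerD2r; exact: neg_energy_mono.
(* The extra power makes the lowest frequency index equal to [- M], and the size of [Q] stays within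
   the symmetric window of length [2 M + 1]. *)
pose Q := 'X^(size P) * P.
have sQ : (size Q <= M + M.+1)%N.
  apply: (leq_trans (size_polyMleq _ _)); rewrite size_polyXn /M; lia.
have pE z : p z = \sum_(i < M + M.+1) Q`_i * (val z : C) ^ (i%:Z - M%:Z).
  rewrite hp (laurent_shift (circle_neq0 z) N (size P)).
  exact: (laurent_wide (circle_neq0 z)).
have := N2B_trigpoly (fun i => Q`_i) M (M + M.+1) lf.
rewrite window_energy /= -(eq_N2 (f := fun z => f z - p z)); last by move=> z; rewrite pE.
set s := \sum_(i < _) _ => h.
have s0 : 0 <= s by apply: sumr_ge0 => i _; exact: nsq_ge0.
by rewrite -lerBlDl; apply: le_trans pe; rewrite h lerDl.
Qed.

Record hardy f : Prop := Hardy
  { hardy_L2 : L2 f; hardy_coef : forall k : int, k < 0 -> coef f k = 0 }.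

Lemma hardyD f g : hardy f -> hardy g -> hardy (fun z => f z + g z).
Proof.
move=> [lf cf] [lg cg]; split; first exact: (L2D lf lg).
by move=> k k0; rewrite (coefD k lf lg) cf// cg// addr0.
Qed.

Lemma hardyZ a f : hardy f -> hardy (fun z => a * f z).
Proof.
move=> [lf cf]; split; first exact: (L2Z a lf).
by move=> k k0; rewrite (coefZ a k lf) cf// mulr0.
Qed.

Lemma hardy_sum I (s : seq I) (f : I -> circle R -> C) :
  (forall i, hardy (f i)) -> hardy (fun z => \sum_(i <- s) f i z).
Proof.
move=> hf; split; first by apply: L2_sum => i _; exact: (hardy_L2 (hf i)).
move=> k k0; rewrite coef_sum => [|i _]; last exact: (hardy_L2 (hf i)).
by rewrite big1// => i _; rewrite (hardy_coef (hf i)).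
Qed.

Lemma hardy_cst a : hardy (fun=> a).
Proof.
by split; [exact: L2_cst|move=> k k0; rewrite coef_cst lt_eqF].
Qed.

Lemma hardy_character (n : nat) : hardy (fun z => (val z : C) ^+ n).
Proof.
split; first exact: (L2_character R n).
by move=> k k0; rewrite (coef_character R n k) lt_eqF// (lt_le_trans k0).
Qed.

Definition taylor f n : circle R -> C :=
  fun z => \sum_(i < n) coef f i * (val z : C) ^+ i.

Lemma hardy_taylor f n : hardy (taylor f n).
Proof.
by apply: hardy_sum => i; apply: hardyZ; exact: hardy_character.
Qed.

(** The condition [0 < n] keeps the constant term in the Taylor polynomial, which [taylor_mulr_coef]
    has to read off. *)
Lemma hardy_approx f e : hardy f -> 0 < e -> exists2 n, (0 < n)%N &
  N2 (fun z => f z - taylor f n z) <= e.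
Proof.
move=> [lf cf] e0; have [M /(_ M (leqnn _)) h] := parseval lf e0; exists M.+1 => //.
have := N2B_trigpoly (fun i => coef f i) 0 M.+1 lf.
rewrite [X in _ + X]big1 => [|i _]; last by rewrite !subr0 subrr nsq0.
rewrite addr0 big_ord_recl subr0 /= -(eq_N2 (f := fun z => f z - taylor f M.+1 z)).
  move=> ->; move: h; rewrite /neg_energy big1 ?add0r => [h|i _].
    rewrite lerBlDl; apply: (le_trans h); rewrite lerD2r lerD2l le_eqVlt.
    by apply/orP; left; apply/eqP/eq_bigr => i _; rewrite subr0.
  by rewrite cf ?nsq0// oppr_lt0.
by move=> z; congr (_ - _); apply: eq_bigr => i _; rewrite subr0.
Qed.

(** Multiplication by [z ^+ i] with [i > 0] brings only negative frequencies of [f] to a frequency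
    [k <= 0], so the constant term of [g] alone contributes. *)
Lemma taylor_mulr_coef f g n k : L2 f -> k <= 0 -> (0 < n)%N ->
  (forall j : int, j < 0 -> coef f j = 0) ->
  coef (fun z => f z * taylor g n z) k = if k == 0 then coef f 0 * coef g 0 else 0.
Proof.
move=> lf k0 n0 cf.
have lfi (i : nat) : L2 (fun z => (val z : C) ^ i%:Z * f z) by exact: L2_characterM.
rewrite (eq_coef (g := fun z => \sum_(i < n) coef g i * ((val z : C) ^ i%:Z * f z))).
  rewrite coef_sum; last by move=> i _; exact: (L2Z _ (lfi i)).
  have e (i : 'I_n) : coef (fun z => coef g i * ((val z : C) ^ i%:Z * f z)) k
      = coef g i * coef f (k - i%:Z).
    by rewrite (coefZ _ _ (lfi i)) coef_characterM.
  under eq_bigr do rewrite e.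
  case: n n0 {e} => // n _; rewrite big_ord_recl big1 ?addr0 => [|i _]; last first.
    by rewrite cf ?mulr0// subr_lt0 (le_lt_trans k0).
  rewrite mulrC; case: eqP => [->//|/eqP kn0].
  by rewrite cf ?mul0r// lt_neqAle kn0.
by move=> z; rewrite mulr_sumr; apply: eq_bigr => i _; rewrite mulrCA (mulrC (f z)).
Qed.

Lemma small_eq0 (x : R) : 0 <= x -> (forall e, 0 < e -> x <= e) -> x = 0.
Proof.
move=> x0 h; apply/eqP; rewrite eq_le x0 andbT; apply/ler_addgt0Pl => e e0.
by rewrite addr0 h.
Qed.

(* Approximate the second factor by its Taylor polynomials. *)
Lemma hardyM_coef f g (B : R) k : hardy f -> hardy g ->
  {ae @arc_length R, forall z, nsq (f z) <= B} -> k <= 0 ->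
  coef (fun z => f z * g z) k = if k == 0 then coef f 0 * coef g 0 else 0.
Proof.
move=> [lf cf] hg fB k0; have mf := L2_measurable lf.
have lg := hardy_L2 hg; have lfg := L2M_bounded mf fB lg.
apply/eqP; rewrite -subr_eq0; apply/eqP/nsq_eq0/small_eq0; first exact: nsq_ge0.
(* [B] has no prescribed sign; this is a positive constant above it. *)
move=> e e0; have B0 : 0 < `|B| + 1 by rewrite ltr_pwDr.
have [n n0 hn] := hardy_approx hg (divr_gt0 e0 B0).
have lt := hardy_L2 (hardy_taylor g n).
have lgt := L2B lg lt; have lft := L2M_bounded mf fB lt.
rewrite -(taylor_mulr_coef g lf k0 n0 cf) -(coefB k lfg lft).
rewrite (eq_coef (g := fun z => f z * (g z - taylor g n z))); last first.
  by move=> z; rewrite mulrBr.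
apply: (le_trans (nsq_coef_le k (L2M_bounded mf fB lgt))).
apply: (le_trans (N2M_bounded mf fB lgt)).
apply: (@le_trans _ _ ((`|B| + 1) * N2 (fun z => g z - taylor g n z))).
  by apply: ler_wpM2r; [exact: N2_ge0|rewrite (le_trans (ler_norm _))// lerDl].
by rewrite mulrC -ler_pdivlMr.
Qed.

Lemma hardyM f g (B : R) : hardy f -> hardy g ->
  {ae @arc_length R, forall z, nsq (f z) <= B} -> hardy (fun z => f z * g z).
Proof.
move=> hf hg fB; split.
  exact: (L2M_bounded (L2_measurable (hardy_L2 hf)) fB (hardy_L2 hg)).
by move=> k k0; rewrite (hardyM_coef hf hg fB (ltW k0)) lt_eqF.
Qed.

Lemma hardyM_coef0 f g (B : R) : hardy f -> hardy g ->
  {ae @arc_length R, forall z, nsq (f z) <= B} ->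
  coef (fun z => f z * g z) 0 = coef f 0 * coef g 0.
Proof. by move=> hf hg fB; rewrite (hardyM_coef hf hg fB (lexx 0)) eqxx. Qed.

End parseval.

(** * Holomorphic extension to the disc *)

Section holomorphic_extension.
Variable R : realType.
Local Notation C := R[i].
Local Notation Re := complex.Re.
Local Notation Im := complex.Im.
Local Notation normc := ComplexField.Normc.normc.
Implicit Types (f g : circle R -> C) (z w h : C) (x : circle R).

Lemma normc_ge0 z : 0 <= normc z.
Proof. by case: z => a b; exact: sqrtr_ge0. Qed.

Lemma normr_normc z : `|z| = ((normc z)%:C)%C.
Proof. by case: z. Qed.

Lemma normc_lt1 z : (`|z| < 1) = (normc z < 1).
Proof. by rewrite normr_normc -ltcR. Qed.

Lemma cvg_complex (u : nat -> C) (l : C) :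
  (nsq (u n - l)) @[n --> \oo] --> (0 : R) ->
  (u : nat -> (C)^o) @ \oo --> (l : (C)^o).
Proof.
move=> ul; apply/cvgrPdist_lt => e e0.
have [e1 e2] : Im e = 0 /\ 0 < Re e.
  by move: e0; rewrite ltcE /= => /andP[/eqP -> ->].
move/cvgrPdist_lt: ul => /(_ (Re e ^+ 2)).
rewrite exprn_gt0// => /(_ isT); apply: filterS => n.
rewrite sub0r normrN ger0_norm ?nsq_ge0// => h.
rewrite distrC normr_normc ltcE /= e1 eqxx /=.
by rewrite -(ltr_pXn2r (n := 2)) ?nnegrE ?normc_ge0 ?(ltW e2)// nsq_normc.
Qed.

Lemma cvg_geometric_bound (c q : R) : 0 <= q -> q < 1 ->
  (fun n => q ^+ n * c) @ \oo --> (0 : R).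
Proof.
move=> q0 q1; rewrite -(mul0r c); apply: cvgMl; apply: cvg_expr.
by rewrite ger0_norm.
Qed.

Lemma geometric_bound_le0 (a c q : R) : 0 <= q -> q < 1 ->
  (forall n, a <= q ^+ n.+1 * c) -> a <= 0.
Proof.
move=> q0 q1 h; apply/ler_addgt0Pl => e e0; rewrite addr0.
have /cvgrPdist_lt/(_ _ e0)[N _ /(_ N.+1 (leqnSn _))] := cvg_geometric_bound c q0 q1.
rewrite /= sub0r normrN => hN; apply: le_trans (h N) _.
exact: le_trans (ler_norm _) (ltW hN).
Qed.

(** On the circle the conjugate of [x] is its inverse, so this is [x / (x - z)], the sum of the
    [z^k x^(-k)] over [k >= 0]. *)
Definition cauchy_kernel z x : C := (1 - z * ((val x : C)^*)%R)^-1.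

Lemma cauchy_kernel_neq0 z x : normc z < 1 -> 1 - z * ((val x : C)^*)%R != 0.
Proof.
move=> z1; apply/eqP => /eqP; rewrite subr_eq0 => /eqP e.
have := nsq1 R; rewrite [X in nsq X]e nsqM nsq_conj nsq_circle mulr1 -nsq_normc => e1.
have := normc_ge0 z; nra.
Qed.

Lemma nsq_cauchy_kernel_le (r : R) z x : normc z <= r -> r < 1 ->
  nsq (cauchy_kernel z x) <= (1 - r) ^- 2.
Proof.
move=> zr r1; have z1 : normc z < 1 by exact: le_lt_trans r1.
rewrite /cauchy_kernel -nsq_normc ComplexField.Normc.normcV exprVn.
have d0 : 0 < 1 - r by rewrite subr_gt0.
rewrite lef_pV2 ?posrE ?exprn_gt0//; last first.
  rewrite lt_def normc_ge0 andbT; apply/eqP => /ComplexField.Normc.eq0_normc/eqP.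
  by rewrite (negbTE (cauchy_kernel_neq0 x z1)).
rewrite ler_pXn2r ?nnegrE ?normc_ge0 ?(ltW d0)//.
have := le_normcD (1 - z * ((val x : C)^*)%R) (z * ((val x : C)^*)%R).
rewrite subrK ComplexField.Normc.normc1 ComplexField.Normc.normcM.
have -> : normc ((val x : C)^*)%R = 1.
  by apply/eqP; rewrite -(eqrXn2 (n := 2))// ?normc_ge0// nsq_normc nsq_conj nsq_circle expr1n.
rewrite mulr1; move: (normc (1 - _)) => a; lra.
Qed.

Lemma cmeasurableV f : cmeasurable f -> cmeasurable (fun x => (f x)^-1).
Proof.
move=> mf; have mi : measurable_fun setT (fun x => (nsq (f x))^-1).
  under eq_fun do rewrite -powR_inv1 ?nsq_ge0//.
  by apply: (measurableT_comp (@measurable_powR R (-1))); exact: measurable_nsq.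
case: mf => rf jf.
have ReV (z : C) : Re (z^-1) = Re z * (nsq z)^-1 by case: z.
have ImV (z : C) : Im (z^-1) = - (Im z * (nsq z)^-1) by case: z.
split; first by under eq_fun do rewrite ReV; exact: measurable_funM.
under eq_fun do rewrite ImV -mulNr -mulN1r.
exact: (measurable_funM (measurable_funM (measurable_cst _) jf) mi).
Qed.

Lemma cmeasurable_cauchy_kernel z : cmeasurable (cauchy_kernel z).
Proof.
apply: cmeasurableV; under eq_fun do rewrite -mulN1r.
apply: (cmeasurableD (cmeasurable_cst (1 : C))).
apply: (cmeasurableM (cmeasurable_cst (-1 : C))).
apply: (cmeasurableM (cmeasurable_cst z)).
exact: (cmeasurable_conj (cmeasurable_val R)).
Qed.

Lemma cauchy_kernel_ae (r : R) z : normc z <= r -> r < 1 ->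
  {ae @arc_length R, forall x, nsq (cauchy_kernel z x) <= (1 - r) ^- 2}.
Proof. by move=> zr r1; apply: arc_aeW => x; exact: nsq_cauchy_kernel_le. Qed.

Lemma L2_cauchy z f : normc z < 1 -> L2 f -> L2 (fun x => cauchy_kernel z x * f x).
Proof.
move=> z1; exact: (L2M_bounded (cmeasurable_cauchy_kernel z) (cauchy_kernel_ae (lexx _) z1)).
Qed.

Definition cauchy_transform f z := Cintegral (fun x => cauchy_kernel z x * f x).

(** With [w = z / x], the remainder of the geometric series is [w^n] times the kernel; [z^n] comes
    out of the integral and [x^(-n)] is absorbed by [coef]. *)
Lemma cauchy_partial f z n : normc z < 1 -> L2 f ->
  cauchy_transform f z - \sum_(k < n) z ^+ k * coef f k =
  z ^+ n * coef (fun x => cauchy_kernel z x * f x) n.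
Proof.
move=> z1 lf; have lk := L2_cauchy z1 lf.
have e k : z ^+ k * coef f k = Cintegral (fun x => (z * ((val x : C)^*)%R) ^+ k * f x).
  rewrite -(CintegralZ _ (cintegrable_coef _ lf)); apply: eq_Cintegral => x.
  by rewrite exprMn -mulrA circle_conj exprVn exprnN.
have i k : cintegrable (fun x => (z * ((val x : C)^*)%R) ^+ k * f x).
  rewrite (_ : (fun x => _) = fun x => z ^+ k * ((val x : C) ^ (- k%:Z) * f x)).
    exact: (cintegrableZ _ (cintegrable_coef _ lf)).
  by apply/funext => x; rewrite exprMn -mulrA circle_conj exprVn exprnN.
under eq_bigr do rewrite e.
rewrite -Cintegral_sum; last by move=> k _; exact: i.
rewrite -(CintegralB (L2_cintegrable lk) (cintegrable_sum _ (fun (k : 'I_n) _ => i k))).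
rewrite -(CintegralZ _ (cintegrable_coef _ lk)); apply: eq_Cintegral => x.
rewrite -mulr_suml -mulrBl mulrA mulrA; congr (_ * _).
have w1 := cauchy_kernel_neq0 x z1.
rewrite -exprnN -exprVn -circle_conj -exprMn /cauchy_kernel.
set w := z * _ in w1 *; set S := \sum_(k < n) _.
have h : w ^+ n - 1 = (w - 1) * S by exact: subrX1.
apply: (mulIf w1); rewrite mulrBl mulVf// mulfVK//.
have -> : S * (1 - w) = - ((w - 1) * S) by ring.
by rewrite -h; ring.
Qed.

Lemma holo_series f z : normc z < 1 -> L2 f ->
  lim (series (fun k => z ^+ k * coef f k : (C)^o) @ \oo) = cauchy_transform f z.
Proof.
move=> z1 lf; apply: cvg_lim => //; apply: cvg_complex.
have q0 := nsq_ge0 z.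
have q1 : nsq z < 1 by rewrite -nsq_normc expr_lt1// normc_ge0.
have c0 := cvg_geometric_bound (N2 (fun x => cauchy_kernel z x * f x)) q0 q1.
apply: (squeeze_cvgr (f := fun=> 0) _ (cvg_cst _) c0); apply: nearW => n.
rewrite nsq_ge0 /= -nsqN opprB /series /= big_mkord.
rewrite (cauchy_partial _ z1 lf) nsqM nsqX; apply: ler_wpM2l; first exact: exprn_ge0.
exact: (nsq_coef_le _ (L2_cauchy z1 lf)).
Qed.

Lemma cauchy_kernelB z h x : normc z < 1 -> normc (z + h) < 1 ->
  cauchy_kernel (z + h) x - cauchy_kernel z x =
  h * (((val x : C)^*)%R * (cauchy_kernel (z + h) x * cauchy_kernel z x)).
Proof.
move=> z1 zh1; have := cauchy_kernel_neq0 x z1; have := cauchy_kernel_neq0 x zh1.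
rewrite /cauchy_kernel; move: (((val x : C)^*)%R) => c a0 b0; field.
by rewrite a0 b0.
Qed.

(** By [cauchy_kernelB] the difference quotient is itself an integral, and a second use of the same
    identity shows that it differs from the integral of [K1] by [h] times a bounded quantity. *)
Lemma derivable_cauchy_transform f z : normc z < 1 -> L2 f ->
  derivable (cauchy_transform f : (C)^o -> (C)^o) z 1.
Proof.
have half (a b c : R) : c <= a + b -> b < (1 - a) / 2 -> c <= (1 + a) / 2 by lra.
have sq_ge (b : R) : 0 <= b -> b <= (1 + b) ^+ 2 by nra.
move=> z1 lf.
pose K1 := fun x => ((val x : C)^*)%R * (cauchy_kernel z x * (cauchy_kernel z x * f x)).
(* For [h] of modulus at most [(1 - normc z) / 2], the point [z + h] stays in the disc of radius
   [r], where the kernels are uniformly bounded. *)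
pose r : R := (1 + normc z) / 2.
have r1 : r < 1 by rewrite /r; lra.
have zr : normc z <= r by rewrite /r; lra.
have d0 : 0 < (1 - normc z) / 2 by rewrite divr_gt0// subr_gt0.
have l1 := L2_cauchy z1 (L2_cauchy z1 lf).
have conjb : {ae @arc_length R, forall x, nsq ((val x : C)^*)%R <= 1}.
  by apply: arc_aeW => x; rewrite nsq_conj nsq_circle.
have mconj := cmeasurable_conj (cmeasurable_val R).
have lK1 : L2 K1 by exact: (L2M_bounded mconj conjb l1).
have l2 : L2 (fun x => ((val x : C)^*)%R * K1 x) by exact: (L2M_bounded mconj conjb lK1).
pose B := (1 - r) ^- 2 * N2 (fun x => ((val x : C)^*)%R * K1 x).
have B0 : 0 <= B.
  by rewrite mulr_ge0 ?N2_ge0// invr_ge0 exprn_ge0// subr_ge0 ltW.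
apply/cvg_ex; exists (Cintegral K1 : (C)^o); apply/cvgrPdist_lt => e e0.
have [e1 e2] : Im e = 0 /\ 0 < Re e.
  by move: e0; rewrite ltcE /= => /andP[/eqP -> ->].
pose dl := Num.min ((1 - normc z) / 2) (Re e / (1 + B)).
have dl0 : 0 < dl by rewrite lt_min d0 divr_gt0// ltr_pwDl.
have dlC : 0 < ((dl%:C)%C : C) by rewrite -ltcR in dl0.
near=> h.
have hn0 : h != 0 by near: h; exact: nbhs_dnbhs_neq.
have : `|h| < ((dl%:C)%C : C) by near: h; exact: dnbhs0_lt.
rewrite normr_normc ltcR /dl lt_min => /andP[hd he].
have zhr : normc (z + h) <= r.
  exact: half (le_normcD z h) hd.
have zh1 : normc (z + h) < 1 by exact: le_lt_trans r1.
have -> : h^-1 *: (cauchy_transform f (h *: (1 : (C)^o) + z) - cauchy_transform f z) =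
    Cintegral (fun x => ((val x : C)^*)%R * (cauchy_kernel (z + h) x * (cauchy_kernel z x * f x))).
  have lzh := L2_cauchy zh1 lf.
  have -> : h *: (1 : (C)^o) + z = z + h by rewrite /GRing.scale /= mulr1 addrC.
  rewrite /cauchy_transform -(CintegralB (L2_cintegrable lzh) (L2_cintegrable (L2_cauchy z1 lf))).
  rewrite /GRing.scale /= -CintegralZ; last first.
    exact: (L2_cintegrable (L2B lzh (L2_cauchy z1 lf))).
  apply: eq_Cintegral => x; rewrite -mulrBl cauchy_kernelB//.
  by rewrite -mulrA mulKf// !mulrA.
have lL : L2 (fun x => ((val x : C)^*)%R * (cauchy_kernel (z + h) x * (cauchy_kernel z x * f x))).
  exact: (L2M_bounded mconj conjb (L2_cauchy zh1 (L2_cauchy z1 lf))).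
rewrite distrC -(CintegralB (L2_cintegrable lL) (L2_cintegrable lK1)).
rewrite (eq_Cintegral (g := fun x => h * (cauchy_kernel (z + h) x * (((val x : C)^*)%R * K1 x)))); last first.
  move=> x; rewrite /K1 -mulrBr -mulrBl (cauchy_kernelB x z1 zh1).
  move: (cauchy_kernel (z + h) x) (cauchy_kernel z x) ((val x : C)^*)%R (f x) => a b c d.
  ring.
have lq := L2_cauchy zh1 l2.
rewrite (CintegralZ _ (L2_cintegrable lq)).
rewrite normr_normc ltcE /= e1 eqxx /= ComplexField.Normc.normcM.
(* Jensen bounds the squared modulus by [B], and [B <= (1 + B)^2] turns this into a bound on the
   modulus. *)
have cb : normc (Cintegral (fun x => cauchy_kernel (z + h) x * (((val x : C)^*)%R * K1 x))) <= 1 + B.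
  rewrite -(ler_pXn2r (n := 2)) ?nnegrE ?normc_ge0 ?addr_ge0// nsq_normc.
  apply: (le_trans _ (sq_ge _ B0)).
  apply: (le_trans (nsq_Cintegral lq)).
  exact: (N2M_bounded (cmeasurable_cauchy_kernel _) (cauchy_kernel_ae zhr r1) l2).
apply: (@le_lt_trans _ _ (normc h * (1 + B))); first by rewrite ler_wpM2l ?normc_ge0.
by rewrite -ltr_pdivlMr// ltr_pwDl.
Unshelve. all: by end_near. Qed.

Lemma Cintegral_cauchy_kernel z : normc z < 1 -> Cintegral (cauchy_kernel z) = 1.
Proof.
move=> z1; have l1 := L2_cst (1 : C).
have e n : Cintegral (cauchy_kernel z) - 1 = z ^+ n.+1 * coef (fun x => cauchy_kernel z x * 1) n.+1.
  rewrite -(cauchy_partial _ z1 l1) /cauchy_transform.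
  rewrite big_ord_recl expr0 mul1r coef_cst eqxx big1 => [|i _]; last by rewrite coef_cst mulr0.
  by rewrite addr0; congr (_ - _); apply: eq_Cintegral => x; rewrite mulr1.
apply/eqP; rewrite -subr_eq0; apply/eqP/nsq_eq0/eqP; rewrite eq_le nsq_ge0 andbT.
have q1 : nsq z < 1 by rewrite -nsq_normc expr_lt1// normc_ge0.
apply: (geometric_bound_le0 (nsq_ge0 z) q1) => n.
rewrite (e n) nsqM nsqX; apply: ler_wpM2l; first by apply: exprn_ge0; exact: nsq_ge0.
exact: (nsq_coef_le _ (L2_cauchy z1 l1)).
Qed.

(** The conjugate of a Hardy function has no positive frequencies, so its Cauchy transform is
    constant in [z]. *)
Lemma conj_cauchy_transform f z : normc z < 1 -> hardy f ->
  Cintegral (fun x => ((cauchy_kernel z x)^*)%R * f x) = Cintegral f.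
Proof.
move=> z1 [lf cf]; pose g := fun x => ((f x)^*)%R.
have lg : L2 g by exact: (L2_conj lf).
have q1 : nsq z < 1 by rewrite -nsq_normc expr_lt1// normc_ge0.
have cg n : coef g n.+1%:Z = 0 by rewrite coef_conj// cf ?rmorph0.
have e : cauchy_transform g z = coef g 0.
  apply/eqP; rewrite -subr_eq0; apply/eqP/nsq_eq0/eqP; rewrite eq_le nsq_ge0 andbT.
  apply: (geometric_bound_le0 (nsq_ge0 z) q1) => n.
  have -> : coef g 0 = \sum_(k < n.+1) z ^+ k * coef g k.
    rewrite big_ord_recl expr0 mul1r big1 ?addr0// => i _.
    by rewrite cg mulr0.
  rewrite (cauchy_partial _ z1 lg) nsqM nsqX; apply: ler_wpM2l.
    by apply: exprn_ge0; exact: nsq_ge0.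
  exact: (nsq_coef_le _ (L2_cauchy z1 lg)).
have eg : ((coef g 0)^*)%R = Cintegral f.
  rewrite (coef_conj 0 lf) conjCK oppr0; apply: eq_Cintegral => x.
  by rewrite oppr0 expr0z mul1r.
have := congr1 (fun w => (w^*)%R) e.
rewrite eg /cauchy_transform -(Cintegral_conj (L2_cintegrable (L2_cauchy z1 lg))) => <-.
by apply: eq_Cintegral => x; rewrite rmorphM /= /g conjCK.
Qed.

(** The right-hand side is the Poisson kernel [(1 - |z|^2) / |x - z|^2]. *)
Lemma cauchy_kernel_poisson z x : normc z < 1 ->
  cauchy_kernel z x + ((cauchy_kernel z x)^*)%R - 1 =
  (((1 - nsq z) * nsq (cauchy_kernel z x))%:C)%C.
Proof.
move=> z1; have k0 := cauchy_kernel_neq0 x z1.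
have nk : nsq (1 - z * ((val x : C)^*)%R) != 0.
  by apply/eqP => /nsq_eq0 /eqP; rewrite (negbTE k0).
rewrite rmorphM /= -mul_conj_nsq.
have kk : cauchy_kernel z x * (1 - z * ((val x : C)^*)%R) = 1 by rewrite mulVf.
have kk' : ((cauchy_kernel z x)^*)%R * (1 - (z^*)%R * val x) = 1.
  have := congr1 (fun w => (w^*)%R) kk.
  by rewrite rmorphM rmorphB rmorphM /= conjCK rmorph1.
have vv : ((val x : C)^*)%R * val x = 1 by rewrite mul_conj_nsq nsq_circle.
rewrite rmorphB /= rmorph1 -mul_conj_nsq.
move: kk kk' vv; move: (cauchy_kernel z x) ((cauchy_kernel z x)^*)%R => K K'.
move: (val x : C) ((val x : C)^*)%R (z^*)%R => v v' z' kk kk' vv.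
have -> : (1 - z' * z) * (K' * K) = K' * K - (K' * (z' * v)) * (K * (z * v')).
  rewrite (_ : K' * (z' * v) * (K * (z * v')) = z' * z * (v' * v) * (K' * K)); last by ring.
  by rewrite vv; ring.
have -> : K' * (z' * v) = K' - 1 by rewrite -kk'; ring.
have -> : K * (z * v') = K - 1 by rewrite -kk; ring.
ring.
Qed.

(** For a Hardy function the conjugate kernel and the constant 1 have the same integral against [f],
    so the Cauchy transform is the Poisson integral, an average for the probability density [p].
    Real and imaginary parts are averaged separately, whence the factor 2. *)
Lemma cauchy_transform_bounded f z (B : R) : hardy f -> 0 <= B ->
  {ae @arc_length R, forall x, nsq (f x) <= B} -> normc z < 1 ->
  nsq (cauchy_transform f z) <= 2 * B.
Proof.
move=> hf B0 fB z1; have lf := hardy_L2 hf.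
pose p x := (1 - nsq z) * nsq (cauchy_kernel z x).
have q1 : nsq z < 1 by rewrite -nsq_normc expr_lt1// normc_ge0.
have p0 x : 0 <= p x by rewrite mulr_ge0 ?nsq_ge0// subr_ge0 ltW.
have lk := L2_cauchy z1 lf.
have lK : L2 (cauchy_kernel z).
  exact: (L2_bounded (cmeasurable_cauchy_kernel z) (cauchy_kernel_ae (lexx _) z1)).
have lK' := L2_conj lK.
have lk' : L2 (fun x => ((cauchy_kernel z x)^*)%R * f x).
  have b : {ae @arc_length R, forall x, nsq ((cauchy_kernel z x)^*)%R <= (1 - normc z) ^- 2}.
    by apply: arc_aeS (cauchy_kernel_ae (lexx _) z1) => x; rewrite nsq_conj.
  exact: (L2M_bounded (cmeasurable_conj (cmeasurable_cauchy_kernel z)) b lf).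
have ip : rintegrable p by exact: (rintegrableZ _ (L2_rintegrable lK)).
have pE : \int[@arc_length R]_x p x = 1.
  have e1 := CintegralD (L2_cintegrable lK) (L2_cintegrable lK').
  have e2 := CintegralB (L2_cintegrable (L2D lK lK')) (L2_cintegrable (L2_cst (1 : C))).
  move: e2; rewrite e1 Cintegral_cst (Cintegral_conj (L2_cintegrable lK)).
  rewrite (Cintegral_cauchy_kernel z1) rmorph1 addrK => /(congr1 (@complex.Re R)) /= <-.
  by apply: eq_rint => x; rewrite cauchy_kernel_poisson.
have fp : cauchy_transform f z = Cintegral (fun x => ((p x)%:C)%C * f x).
  rewrite -[LHS](addrK (Cintegral f)) -{1}(conj_cauchy_transform z1 hf).
  rewrite -(CintegralD (L2_cintegrable lk) (L2_cintegrable lk')).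
  rewrite -(CintegralB (L2_cintegrable (L2D lk lk')) (L2_cintegrable lf)).
  apply: eq_Cintegral => x; rewrite -cauchy_kernel_poisson//.
  by rewrite mulrBl mulrDl mul1r.
have lpf : cintegrable (fun x => ((p x)%:C)%C * f x).
  rewrite (_ : (fun x => _) = fun x => (cauchy_kernel z x * f x + ((cauchy_kernel z x)^*)%R * f x) - f x).
    exact: (L2_cintegrable (L2B (L2D lk lk') lf)).
  apply/funext => x; rewrite -cauchy_kernel_poisson//.
  by rewrite mulrBl mulrDl mul1r.
have bnd (u : circle R -> R) : rintegrable (fun x => p x * u x) ->
    {ae @arc_length R, forall x, u x ^+ 2 <= B} -> (\int[@arc_length R]_x (p x * u x)) ^+ 2 <= B.
  move=> iu uB; have s0 := sqrtr_ge0 B.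
  have ub : {ae @arc_length R, forall x, `|u x| <= Num.sqrt B}.
    by apply: arc_aeS uB => x h; rewrite -sqrtr_sqr ler_wsqrtr.
  have h1 : \int[@arc_length R]_x (p x * u x) <= Num.sqrt B.
    rewrite -[leRHS]mulr1 -pE -rintZ//.
    apply: (rint_le_ae iu (rintegrableZ _ ip)); apply: arc_aeS ub => x h.
    by rewrite mulrC ler_wpM2r// (le_trans (ler_norm _)).
  have h2 : - Num.sqrt B <= \int[@arc_length R]_x (p x * u x).
    rewrite -[leLHS]mulr1 -pE -rintZ//.
    apply: (rint_le_ae (rintegrableZ _ ip) iu); apply: arc_aeS ub => x h.
    by rewrite [leRHS]mulrC ler_wpM2r// lerNl (le_trans (ler_norm _))// normrN.
  by rewrite -[leRHS](sqr_sqrtr B0); nra.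
rewrite fp /nsq mulr_natl mulr2n; case: lpf => /= i1 i2.
have e1 : (fun x => Re (((p x)%:C)%C * f x)) = fun x => p x * Re (f x).
  by apply/funext => x; rewrite ReZ.
have e2 : (fun x => Im (((p x)%:C)%C * f x)) = fun x => p x * Im (f x).
  by apply/funext => x; rewrite ImZ.
rewrite e1 in i1 *; rewrite e2 in i2 *; apply: lerD.
  by apply: bnd => //; apply: arc_aeS fB => x; apply: le_trans; rewrite /nsq lerDl sqr_ge0.
by apply: bnd => //; apply: arc_aeS fB => x; apply: le_trans; rewrite /nsq lerDr sqr_ge0.
Qed.

End holomorphic_extension.

(** * Hermitian forms *)

Local Open Scope sesquilinear_scope.

Section hermitian_forms.
Variable R : realType.
Local Notation C := R[i].
Local Notation Re := complex.Re.
Local Notation Im := complex.Im.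
Local Notation normc := ComplexField.Normc.normc.
Implicit Types p q n : nat.

Lemma adjE p q (A : 'M[C]_(p, q)) i j : (A ^t*) i j = ((A j i)^*)%R.
Proof. by rewrite !mxE. Qed.

Lemma adjM p q n (A : 'M[C]_(p, q)) (B : 'M[C]_(q, n)) :
  (A *m B) ^t* = B ^t* *m A ^t*.
Proof. by rewrite trmx_mul map_mxM. Qed.

Lemma adjD p q (A B : 'M[C]_(p, q)) : (A + B) ^t* = A ^t* + B ^t*.
Proof. by apply/matrixP => i j; rewrite !mxE rmorphD. Qed.

Lemma adjZ p q a (A : 'M[C]_(p, q)) : (a *: A) ^t* = (a^*)%R *: A ^t*.
Proof. by apply/matrixP => i j; rewrite !mxE rmorphM. Qed.

Definition nsqmx p q (A : 'M[C]_(p, q)) : R := \sum_i \sum_j nsq (A i j).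

Lemma nsqmx_ge0 p q (A : 'M[C]_(p, q)) : 0 <= nsqmx A.
Proof. by apply: sumr_ge0 => i _; apply: sumr_ge0 => j _; exact: nsq_ge0. Qed.

Lemma hsnormE p q (A : 'M[C]_(p, q)) : hsnorm A = Num.sqrt (nsqmx A).
Proof.
congr Num.sqrt; apply: eq_bigr => i _; apply: eq_bigr => j _; exact: nsq_normc.
Qed.

Lemma hsnorm_sq p q (A : 'M[C]_(p, q)) : hsnorm A ^+ 2 = nsqmx A.
Proof. by rewrite hsnormE sqr_sqrtr// nsqmx_ge0. Qed.

Lemma nsq_le_nsqmx p q (A : 'M[C]_(p, q)) i j : nsq (A i j) <= nsqmx A.
Proof.
rewrite /nsqmx (bigD1 i)//= (bigD1 j)//= -addrA lerDl addr_ge0//.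
  by apply: sumr_ge0 => k _; exact: nsq_ge0.
by apply: sumr_ge0 => k _; apply: sumr_ge0 => l _; exact: nsq_ge0.
Qed.

Lemma nsqmx_col n (x : 'cV[C]_n) : nsqmx x = \sum_i nsq (x i 0).
Proof. by apply: eq_bigr => i _; rewrite big_ord1. Qed.

Definition form n (A : 'M[C]_n) (x : 'cV[C]_n) : C := (x ^t* *m A *m x) 0 0.

Lemma formE n (A : 'M[C]_n) x :
  form A x = \sum_i \sum_j (x i 0)^* * A i j * x j 0.
Proof.
rewrite /form mxE exchange_big /=; apply: eq_bigr => j _.
rewrite mxE mulr_suml; apply: eq_bigr => i _.
by rewrite adjE.
Qed.

Lemma formD n (A B : 'M[C]_n) x : form (A + B) x = form A x + form B x.
Proof. by rewrite /form mulmxDr mulmxDl mxE. Qed.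

Lemma formZ n a (A : 'M[C]_n) x : form (a *: A) x = a * form A x.
Proof. by rewrite /form -scalemxAr -scalemxAl mxE. Qed.

Lemma formB n (A B : 'M[C]_n) x : form (A - B) x = form A x - form B x.
Proof. by rewrite formD -scaleN1r formZ mulN1r. Qed.

Lemma form_gram p n (A : 'M[C]_(p, n)) x :
  form (A ^t* *m A) x = ((nsqmx (A *m x))%:C)%C.
Proof.
rewrite /form mulmxA -adjM -mulmxA mxE nsqmx_col rmorph_sum /=.
by apply: eq_bigr => i _; rewrite adjE mul_conj_nsq.
Qed.

Lemma form1 n (x : 'cV[C]_n) : form 1%:M x = ((nsqmx x)%:C)%C.
Proof.
rewrite -[X in nsqmx X](mul1mx x) -form_gram; congr form.
by rewrite mulmx1; apply/matrixP => i j; rewrite !mxE rmorph_nat eq_sym.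
Qed.

Lemma form_adj n (A : 'M[C]_n) x : form (A ^t*) x = ((form A x)^*)%R.
Proof.
rewrite !formE rmorph_sum exchange_big /=; apply: eq_bigr => i _.
rewrite rmorph_sum /=; apply: eq_bigr => j _.
by rewrite !rmorphM /= conjCK adjE; ring.
Qed.

Lemma formxD n (A : 'M[C]_n) x y : form A (x + y) =
  form A x + form A y + ((x ^t* *m A *m y) 0 0 + (y ^t* *m A *m x) 0 0).
Proof.
rewrite /form adjD mulmxDr !mulmxDl [LHS]mxE [X in X + _]mxE [X in _ + X = _]mxE.
have ac (a b c d : C) : a + d + (c + b) = a + b + (c + d) by ring.
exact: ac.
Qed.

(** Polarization: the vectors [e i + a *: e j] with [a = 1] and [a = i] give the sum and the
    difference of the entries [(i, j)] and [(j, i)]. With complex scalars no symmetry of [A] is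
    assumed. *)
Lemma form_eq0 n (A : 'M[C]_n) : (forall x, form A x = 0) -> A = 0.
Proof.
move=> A0; pose e (i : 'I_n) : 'cV[C]_n := delta_mx i 0.
have sandwich (x y : C) i j :
    ((x *: e i) ^t* *m A *m (y *: e j)) 0 0 = (x^*)%R * A i j * y.
  rewrite /e adjZ -scalemxAr -!scalemxAl !mxE.
  rewrite (bigD1 j)//= big1 ?addr0 => [|m /negPf mj]; last by rewrite !mxE mj mulr0.
  rewrite !mxE !eqxx /= mulr1 (bigD1 i)//= big1 ?addr0 => [|m /negPf mi]; last first.
    by rewrite !mxE mi rmorph0 mul0r.
  by rewrite !mxE !eqxx rmorph1 mul1r; ring.
have cross (a : C) i j : i != j -> (a^*)%R * A j i + a * A i j = 0.
  move=> ij; have := A0 (1 *: e i + a *: e j); rewrite formxD.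
  rewrite (A0 (1 *: e i)) (A0 (a *: e j)) (sandwich 1 a i j) (sandwich a 1 j i).
  rewrite addr0 add0r rmorph1 => h.
  by rewrite -[RHS]h; ring.
apply/matrixP => i j; rewrite [RHS]mxE; case: (eqVneq i j) => [->|ij].
  have := A0 (1 *: e j); rewrite /form (sandwich 1 1).
  by rewrite rmorph1 mul1r mulr1.
have h1 := cross 1 i j ij; have h2 := cross (Complex 0 1) i j ij.
rewrite rmorph1 !mul1r in h1.
have ci : ((Complex 0 1)^*)%R = - Complex 0 1 :> C.
  by apply: complex_eqP; rewrite !ReImE /= ?oppr0.
rewrite ci mulNr addrC -mulrBr in h2; move/eqP: h2; rewrite mulf_eq0 => /orP[/eqP h|].
  by have := congr1 (@complex.Im R) h; rewrite /= => /eqP; rewrite oner_eq0.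
rewrite subr_eq0 => /eqP h2; move: h1; rewrite -h2 -mulr2n => /eqP.
by rewrite mulrn_eq0 /= => /eqP.
Qed.

Lemma form_inj n (A B : 'M[C]_n) : (forall x, form A x = form B x) -> A = B.
Proof.
move=> AB; apply/eqP; rewrite -subr_eq0; apply/eqP/form_eq0 => x.
by rewrite formB AB subrr.
Qed.

Lemma posmx_selfadjoint n (A : 'M[C]_n) : posmx A -> A ^t* = A.
Proof.
move=> A0; apply: form_inj => x; rewrite form_adj.
by apply: conj_Creal; apply: ger0_real; exact: A0.
Qed.

Lemma sqrtmx_ex n (A : 'M[C]_n) : posmx A -> exists B, posmx B /\ B *m B = A.
Proof.
move=> A0; have hA := posmx_selfadjoint A0.
have nA : A \is normalmx by apply/normalmxP; rewrite hA.
have /orthomx_spectralP := nA; set P := spectralmx A; set d := spectral_diag A => AE.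
have PU : P \is unitarymx by exact: spectral_unitarymx.
rewrite (invmx_unitary PU) in AE.
have PP : P *m P ^t* = 1%:M by exact/unitarymxP.
(* An eigenvalue is the value of the form at the corresponding unit eigenvector, a column of
   [P ^t*]. *)
have d0 i : 0 <= d 0 i.
  have := A0 (P ^t* *m delta_mx i 0); rewrite AE adjM trmxCK !mulmxA.
  rewrite -(mulmxA _ P (P ^t*)) PP mulmx1 -(mulmxA _ P (P ^t*)) PP mulmx1.
  rewrite mxE (bigD1 i)//= big1 ?addr0 => [|j /negPf ji]; last by rewrite !mxE ji mulr0.
  rewrite [delta_mx i 0 i 0]mxE !eqxx mulr1 mul_mx_diag mxE adjE mxE !eqxx rmorph1 mul1r.
  by [].
pose s : 'rV[C]_n := \row_i sqrtC (d 0 i).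
exists (P ^t* *m diag_mx s *m P); split.
  move=> x; pose y := P *m x.
  have -> : x ^t* *m (P ^t* *m diag_mx s *m P) *m x = y ^t* *m diag_mx s *m y.
    by rewrite /y adjM !mulmxA.
  rewrite mxE; apply: sumr_ge0 => i _; rewrite mul_mx_diag mxE adjE [s _ _]mxE.
  by rewrite mulrAC mulr_ge0 ?sqrtC_ge0// mulrC mul_conjC_ge0.
have ss : diag_mx s *m diag_mx s = diag_mx d.
  by rewrite mulmx_diag; congr diag_mx; apply/rowP => i; rewrite !mxE -expr2 sqrtCK.
rewrite [RHS]AE -ss !mulmxA -(mulmxA (P ^t* *m diag_mx s) P (P ^t*)) PP mulmx1.
exact: erefl.
Qed.

Lemma sqrtmxP n (A : 'M[C]_n) : posmx A -> posmx (sqrtmx A) /\ sqrtmx A *m sqrtmx A = A.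
Proof.
move=> /sqrtmx_ex[B hB].
exact: (@xgetPex _ 0 [set B | posmx B /\ B *m B = A] (ex_intro _ B hB)).
Qed.

Lemma ell2norm_sqrtmx n (A : 'M[C]_n) x : posmx A ->
  ((nsqmx (sqrtmx A *m x))%:C)%C = form A x.
Proof.
move=> /sqrtmxP[s0 ss]; rewrite -form_gram.
by rewrite (posmx_selfadjoint s0) ss.
Qed.

Lemma ell2norm_eq n (A : 'M[C]_n) (B : 'M[C]_n) :
  ell2norm A = ell2norm B -> A ^t* *m A = B ^t* *m B.
Proof.
move=> AB; apply: form_inj => x; rewrite !form_gram.
by have := congr1 (fun f => f x ^+ 2) AB; rewrite /ell2norm !hsnorm_sq => ->.
Qed.

Lemma form_selfadjoint_real n (A : 'M[C]_n) x : selfadjoint A ->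
  form A x = ((Re (form A x))%:C)%C.
Proof.
move=> hA; have := form_adj A x; rewrite hA => e.
apply: complex_eqP => //=; have := congr1 (@complex.Im R) e.
by rewrite Im_conj; lra.
Qed.

(** A crude norm that dominates both the quadratic form and the operator norm, so that a single
    constant controls the positivity of the weights and the essential norm of [Delta]. *)
Definition absmx p q (A : 'M[C]_(p, q)) : R := \sum_i \sum_j normc (A i j).

Lemma absmx_ge0 p q (A : 'M[C]_(p, q)) : 0 <= absmx A.
Proof. by apply: sumr_ge0 => i _; apply: sumr_ge0 => j _; exact: normc_ge0. Qed.

Lemma Re_le_normc (z : C) : `|Re z| <= normc z.
Proof.
rewrite -(ler_pXn2r (n := 2)) ?nnegrE ?normc_ge0// nsq_normc -normrX ger0_norm ?sqr_ge0//.
by rewrite /nsq lerDl sqr_ge0.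
Qed.

Lemma Re_form_le n (A : 'M[C]_n) x : `|Re (form A x)| <= absmx A * nsqmx x.
Proof.
rewrite formE Re_sum (le_trans (ler_norm_sum _ _ _))// mulr_suml; apply: ler_sum => i _.
rewrite Re_sum (le_trans (ler_norm_sum _ _ _))// mulr_suml; apply: ler_sum => j _.
rewrite (le_trans (Re_le_normc _))// !ComplexField.Normc.normcM mulrAC mulrC.
apply: ler_wpM2l; first exact: normc_ge0.
have nc : normc ((x i 0)^*)%R = normc (x i 0) by case: (x i 0) => a b /=; rewrite sqrrN.
rewrite nc (le_trans (ler_norm _))// (le_trans (norm_mul_le _ _))// !nsq_normc.
have := nsq_le_nsqmx x i 0; have := nsq_le_nsqmx x j 0.
by lra.
Qed.

Lemma hsnorm_mulmx_le n (A : 'M[C]_n) (x : 'cV[C]_n) : hsnorm x <= 1 -> hsnorm (A *m x) <= absmx A.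
Proof.
move=> x1; rewrite -(ler_pXn2r (n := 2)) ?nnegrE ?absmx_ge0 ?sqrtr_ge0//.
have xj j : normc (x j 0) <= 1.
  rewrite -(ler_pXn2r (n := 2)) ?nnegrE ?normc_ge0// nsq_normc expr1n.
  by rewrite (le_trans (nsq_le_nsqmx _ _ _))// -hsnorm_sq expr_le1// sqrtr_ge0.
have row_le i : normc ((A *m x) i 0) <= \sum_j normc (A i j).
  rewrite mxE -[leLHS]/(`|_ : Rcomplex R|) (le_trans (ler_norm_sum _ _ _))//.
  apply: ler_sum => j _; rewrite [leLHS]ComplexField.Normc.normcM.
  by rewrite ler_piMr// normc_ge0.
rewrite hsnorm_sq nsqmx_col /absmx.
have r0 i : 0 <= \sum_j normc (A i j) by apply: sumr_ge0 => j _; exact: normc_ge0.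
apply: (@le_trans _ _ (\sum_i (\sum_j normc (A i j)) ^+ 2)).
  apply: ler_sum => i _; rewrite -nsq_normc ler_pXn2r ?nnegrE ?normc_ge0//.
rewrite [leRHS]expr2 mulr_suml; apply: ler_sum => i _; rewrite expr2 ler_wpM2l//.
by rewrite [leRHS](bigD1 i)//= lerDl; apply: sumr_ge0.
Qed.

Lemma opnorm_le n (A : 'M[C]_n) : opnorm A <= absmx A.
Proof.
apply: ge_sup; last by move=> _ [x x1 <-]; exact: hsnorm_mulmx_le.
exists (hsnorm (A *m (0 : 'cV[C]_n))), 0 => //=; rewrite hsnormE nsqmx_col big1 ?sqrtr0// => i _.
by rewrite mxE nsq0.
Qed.

End hermitian_forms.

(** * Outer functions and the interpolation norm *)

Section bounded_functions.
Variable R : realType.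
Local Notation C := R[i].
Local Notation m := (@arc_length R).
Implicit Types (f g : circle R -> C).

Lemma arc_aeI (P Q : circle R -> Prop) : {ae m, forall z, P z} ->
  {ae m, forall z, Q z} -> {ae m, forall z, P z /\ Q z}.
Proof.
move=> [N [mN N0 PN]] [M [mM M0 QM]]; exists (N `|` M); split.
- exact: measurableU.
- exact: null_set_setU.
- move=> z /= /not_andP[nP|nQ]; [left; exact: PN|right; exact: QM].
Qed.

Lemma arc_aeP (P : circle R -> Prop) : {ae m, forall z, P z} -> exists z, P z.
Proof.
move=> [N [mN N0 PN]]; apply: contrapT => nP.
have : (m setT <= m N)%E.
  apply: le_measure; rewrite ?inE// => z _; apply: PN => /= Pz.
  by apply: nP; exists z.
by rewrite N0 [X in (X <= _)%E]arc_length_setT lee_fin ler10.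
Qed.

Record bounded_ae f : Prop := BoundedAE
  { bounded_measurable : cmeasurable f;
    bounded_bound : exists2 B : R, 0 <= B & {ae m, forall z, nsq (f z) <= B} }.

Lemma bounded_L2 f : bounded_ae f -> L2 f.
Proof. by move=> [mf [B _ fB]]; exact: (L2_bounded mf fB). Qed.

Lemma bounded_cst a : bounded_ae (fun=> a).
Proof.
split; first exact: cmeasurable_cst.
by exists (nsq a); [exact: nsq_ge0|exact: arc_aeW].
Qed.

Lemma bounded_conj f : bounded_ae f -> bounded_ae (fun z => ((f z)^*)%R).
Proof.
move=> [mf [B B0 fB]]; split; first exact: cmeasurable_conj.
by exists B => //; apply: arc_aeS fB => z; rewrite nsq_conj.
Qed.

Lemma boundedD f g : bounded_ae f -> bounded_ae g -> bounded_ae (fun z => f z + g z).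
Proof.
move=> [mf [B B0 fB]] [mg [B' B0' gB]]; split; first exact: cmeasurableD.
exists (2 * B + 2 * B'); first by rewrite addr_ge0// mulr_ge0.
apply: arc_aeS (arc_aeI fB gB) => z [h1 h2].
by rewrite (le_trans (nsqD_le _ _))// lerD// ler_wpM2l.
Qed.

Lemma boundedM f g : bounded_ae f -> bounded_ae g -> bounded_ae (fun z => f z * g z).
Proof.
move=> [mf [B B0 fB]] [mg [B' B0' gB]]; split; first exact: cmeasurableM.
exists (B * B'); first by rewrite mulr_ge0.
apply: arc_aeS (arc_aeI fB gB) => z [h1 h2].
by rewrite nsqM ler_pM ?nsq_ge0.
Qed.

Lemma bounded_sum I (s : seq I) (f : I -> circle R -> C) :
  (forall i, bounded_ae (f i)) -> bounded_ae (fun z => \sum_(i <- s) f i z).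
Proof.
move=> bf; elim: s => [|i s ih].
  by under eq_fun do rewrite big_nil; exact: bounded_cst.
by under eq_fun do rewrite big_cons; exact: (boundedD (bf i) ih).
Qed.

Lemma boundedM_L2 f g : bounded_ae f -> L2 g -> L2 (fun z => f z * g z).
Proof. by move=> [mf [B _ fB]] lg; exact: (L2M_bounded mf fB lg). Qed.

Lemma bounded_hardyM f g : bounded_ae f -> hardy f -> hardy g ->
  hardy (fun z => f z * g z).
Proof. by move=> [_ [B _ fB]] hf hg; exact: (hardyM hf hg fB). Qed.

Lemma bounded_hardyM_coef0 f g : bounded_ae f -> hardy f -> hardy g ->
  coef (fun z => f z * g z) 0 = coef f 0 * coef g 0.
Proof. by move=> [_ [B _ fB]] hf hg; exact: (hardyM_coef0 hf hg fB). Qed.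

Lemma nsq_sum_le n (a : 'I_n -> C) :
  nsq (\sum_(i < n) a i) <= 2 ^+ n * \sum_(i < n) nsq (a i).
Proof.
elim: n a => [|n ih] a; first by rewrite !big_ord0 nsq0 mulr0.
rewrite !big_ord_recr /= (le_trans (nsqD_le _ _))// exprS [leRHS]mulrDr.
have s0 : 0 <= nsq (a ord_max) by exact: nsq_ge0.
apply: lerD; first by rewrite -mulrA ler_wpM2l.
by rewrite ler_wpM2r// ler_peMr// exprn_ege1// ler1n.
Qed.

End bounded_functions.

Lemma subE (C : pzRingType) p q (A B : 'M[C]_(p, q)) i j : (A - B) i j = A i j - B i j.
Proof. by rewrite !mxE. Qed.

Section matrix_hardy.
Variable R : realType.
Local Notation C := R[i].
Local Notation m := (@arc_length R).
Implicit Types p q n : nat.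

Lemma sqnormL2E p q (F : circle R -> 'M[C]_(p, q)) :
  (forall i j, L2 (fun z => F z i j)) ->
  sqnormL2 F = (\sum_i \sum_j N2 (fun z => F z i j))%:E.
Proof.
move=> lF.
have iF i : rintegrable (fun z => \sum_j nsq (F z i j)).
  by apply: rintegrable_sum => j _; exact: (L2_rintegrable (lF i j)).
have iFF := rintegrable_sum (index_enum 'I_p) (fun i (_ : true) => iF i).
have -> : \sum_i \sum_j N2 (fun z => F z i j) = \int[m]_z nsqmx (F z).
  rewrite [RHS](rint_sum _ (fun i (_ : true) => iF i)).
  apply: eq_bigr => i _.
  by rewrite (rint_sum _ (fun j (_ : true) => L2_rintegrable (lF i j))).
rewrite /Rintegral fineK; last first.
  by apply: integrable_fin_num => //; case: iFF.
by apply: eq_integral => z _; rewrite hsnorm_sq.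
Qed.

Lemma rintegrable_ge0 (u : circle R -> R) : measurable_fun setT u ->
  (forall z, 0 <= u z) -> (\int[m]_z (u z)%:E < +oo)%E -> rintegrable u.
Proof.
move=> mu u0 iu; split; apply/integrableP; split; first exact/measurable_EFinP.
by under eq_integral do rewrite /= ger0_norm//.
Qed.

Lemma H2_hardy p q (F : circle R -> 'M[C]_(p, q)) i j : H2 F ->
  hardy (fun z => F z i j).
Proof.
move=> [mF nF cF].
have cm k l : cmeasurable (fun z => F z k l) by case: (mF k l).
have mN : measurable_fun setT (fun z => nsqmx (F z)).
  by apply: measurable_sum => k; apply: measurable_sum => l; exact: (measurable_nsq (cm k l)).
have iN : rintegrable (fun z => nsqmx (F z)).
  apply: (rintegrable_ge0 mN) => [z|]; first exact: nsqmx_ge0.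
  rewrite (_ : (\int[m]_z _)%E = sqnormL2 F)//.
  by apply: eq_integral => z _; rewrite hsnorm_sq.
split.
  split; first exact: cm.
  apply: (rintegrable_le (measurable_nsq (cm i j)) iN) => z.
  by rewrite ger0_norm ?nsq_ge0// nsq_le_nsqmx.
move=> k k0; have := congr1 (fun A : 'M[C]_(p, q) => A i j) (cF k k0).
by rewrite !mxE.
Qed.

Lemma hardy_H2 p q (F : circle R -> 'M[C]_(p, q)) :
  (forall i j, hardy (fun z => F z i j)) -> H2 F.
Proof.
move=> hF; split.
- by move=> i j; case: (L2_measurable (hardy_L2 (hF i j))).
- by rewrite (sqnormL2E (fun i j => hardy_L2 (hF i j))) ltry.
- move=> k k0; apply/matrixP => i j; rewrite !mxE.
  exact: (hardy_coef (hF i j) k0).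
Qed.

Lemma holo_extE p q (F : circle R -> 'M[C]_(p, q)) z i j :
  `|z| < 1 -> L2 (fun z => F z i j) ->
  holo_ext F z i j = cauchy_transform (fun z => F z i j) z.
Proof.
rewrite normc_lt1 => z1 lF; rewrite -(holo_series z1 lF) /holo_ext /mxseries mxE.
suff -> : (fun k : nat => (z ^+ k *: fourier F k%:Z) i j) =
    (fun k : nat => z ^+ k * coef (fun z => F z i j) k%:Z) by [].
by apply/funext => k; rewrite !mxE.
Qed.

Lemma holo_ext0E p q (F : circle R -> 'M[C]_(p, q)) i j :
  L2 (fun z => F z i j) -> holo_ext F 0 i j = coef (fun z => F z i j) 0.
Proof.
move=> lF; rewrite holo_extE ?normr0//; apply: eq_Cintegral => z.
by rewrite /cauchy_kernel mul0r subr0 invr1 oppr0 expr0z.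
Qed.

End matrix_hardy.

Section outer.
Variables (R : realType) (n : nat).
Local Notation C := R[i].
Local Notation m := (@arc_length R).
Variables W V F : circle R -> 'M[C]_n.
Hypothesis bW : forall i j, bounded_ae (fun z => W z i j).
Hypothesis bV : forall i j, bounded_ae (fun z => V z i j).
Hypothesis VW : forall z, V z *m W z = 1%:M.
Hypothesis outerF : right_outer W F.

Let F0 := holo_ext F 0.

(** From [F ^t* *m F = W] and [V *m W = 1] this is a left inverse of [F]. Written through [V], it is
    measurable and bounded by construction. *)
Definition outer_inverse z := V z *m (F z) ^t*.
Local Notation G := outer_inverse.

Lemma outer_hardy i j : hardy (fun z => F z i j).
Proof. by case: outerF => hF _ _; exact: H2_hardy. Qed.

Lemma outer_bounded i j : bounded_ae (fun z => F z i j).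
Proof.
case: outerF => _ FW _; split; first exact: (L2_measurable (hardy_L2 (outer_hardy i j))).
have [_ [B B0 WB]] := bW j j; exists (1 + B); first by rewrite addr_ge0.
apply: arc_aeS (arc_aeI FW WB) => z [FWz WBz].
have e : W z j j = ((\sum_k nsq (F z k j))%:C)%C.
  rewrite -FWz mxE rmorph_sum /=; apply: eq_bigr => k _.
  by rewrite adjE mul_conj_nsq.
apply: (@le_trans _ _ (complex.Re (W z j j))).
  rewrite e /= (bigD1 i)//= lerDl; apply: sumr_ge0 => k _; exact: nsq_ge0.
apply: (le_trans (ler_norm _)); apply: (le_trans (Re_le_nsq _)).
by rewrite lerD2l.
Qed.

Lemma outer_inverse_bounded i j : bounded_ae (fun z => G z i j).
Proof.
under eq_fun do rewrite mxE; apply: bounded_sum => k.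
apply: (boundedM (bV i k)).
by under eq_fun do rewrite adjE; exact: (bounded_conj (outer_bounded j k)).
Qed.

Lemma outer_inverseV : {ae m, forall z, G z *m F z = 1%:M}.
Proof.
case: outerF => _ FW _; apply: arc_aeS FW => z FWz.
by rewrite /G -mulmxA FWz VW.
Qed.

Lemma outerV : {ae m, forall z, F z *m G z = 1%:M}.
Proof. by apply: arc_aeS outer_inverseV => z; exact: mulmx1C. Qed.

(* By density F K approximates 1 with K in H^2, so that G = F^-1 is a limit of such K. *)
Lemma outer_inverse_hardy i j : hardy (fun z => G z i j).
Proof.
split; first exact: (bounded_L2 (outer_inverse_bounded i j)).
move=> k k0; apply/nsq_eq0/small_eq0; first exact: nsq_ge0.
move=> e e0.
have bnd l := bounded_bound (outer_inverse_bounded i l).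
pose B l := sval (cid2 (bnd l)).
have B0 l : 0 <= B l by rewrite /B; case: (cid2 (bnd l)).
have GB l : {ae m, forall z, nsq (G z i l) <= B l} by rewrite /B; case: (cid2 (bnd l)).
pose M := 2 ^+ n * \sum_l B l.
have M0 : 0 <= M by rewrite mulr_ge0 ?exprn_ge0//; apply: sumr_ge0.
have M1 : 0 < 1 + M by rewrite ltr_pwDl.
have h1 : H2 (fun _ : circle R => 1%:M : 'M[C]_n).
  by apply: hardy_H2 => a b; exact: hardy_cst.
have [_ _ /(_ _ h1 _ (divr_gt0 e0 M1))[K [hK FK]]] := outerF.
have hKij a b := H2_hardy a b hK.
pose E z := F z *m K z - 1%:M.
have lE a b : L2 (fun z => E z a b).
  rewrite /E; under eq_fun do rewrite mxE.
  apply: L2D; last first.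
    under eq_fun do rewrite mxE; exact: L2_cst.
  under eq_fun do rewrite mxE; apply: L2_sum => l _.
  exact: (boundedM_L2 (outer_bounded a l) (hardy_L2 (hKij l b))).
have NE a b : N2 (fun z => E z a b) <= e / (1 + M).
  move: FK; rewrite (sqnormL2E lE) lte_fin => /ltW; apply: le_trans.
  rewrite (bigD1 a)//= (bigD1 b)//= -addrA lerDl addr_ge0//.
    by apply: sumr_ge0 => c _; exact: N2_ge0.
  by apply: sumr_ge0 => c _; apply: sumr_ge0 => d _; exact: N2_ge0.
have lGE l : L2 (fun z => G z i l * E z l j) by exact: (boundedM_L2 (outer_inverse_bounded i l) (lE l j)).
(* Almost everywhere [G - K = - G E], and [K] has no coefficient at the negative frequency [k]; so
   the coefficient of [G] is controlled by the small [E]. *)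
have ek : coef (fun z => G z i j) k = - \sum_l coef (fun z => G z i l * E z l j) k.
  have lG := bounded_L2 (outer_inverse_bounded i j).
  transitivity (coef (fun z => G z i j - K z i j) k).
    by rewrite (coefB k lG (hardy_L2 (hKij i j))) (hardy_coef (hKij i j) k0) subr0.
  rewrite -coef_sum => [|l _]; last exact: lGE.
  have lS : L2 (fun z => \sum_l G z i l * E z l j) by apply: L2_sum => l _; exact: lGE.
  rewrite -mulN1r -(coefZ _ k lS).
  apply: (coef_ae_eq k (L2B lG (hardy_L2 (hKij i j))) (L2Z (-1) lS)).
  apply: arc_aeS outer_inverseV => z GF; rewrite mulN1r.
  have -> : \sum_l G z i l * E z l j = (G z *m E z) i j by rewrite mxE.
  by rewrite /E mulmxBr mulmxA GF mul1mx mulmx1 subE opprB.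
rewrite ek nsqN (le_trans (nsq_sum_le _))//.
apply: (@le_trans _ _ (M * (e / (1 + M)))); last first.
  by rewrite mulrCA ler_piMr ?(ltW e0)// ler_pdivrMr// mul1r lerDr.
rewrite /M -mulrA ler_wpM2l ?exprn_ge0// mulr_suml; apply: ler_sum => l _.
apply: (le_trans (nsq_coef_le k (lGE l))).
apply: (le_trans (N2M_bounded (bounded_measurable (outer_inverse_bounded i l)) (GB l) (lE l j))).
by rewrite ler_wpM2l.
Qed.

Lemma F0E i j : F0 i j = coef (fun z => F z i j) 0.
Proof. by rewrite /F0 (holo_ext0E (hardy_L2 (outer_hardy i j))). Qed.

Definition mean_mx p q (A : circle R -> 'M[C]_(p, q)) := \matrix_(i, j) coef (fun z => A z i j) 0.

(** The mean is the value at 0 of the holomorphic extension, hence multiplicative on Hardy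
    functions; boundedness of [A] keeps the product in L2. *)
Lemma mean_mulmx p q r (A : circle R -> 'M[C]_(p, q)) (B : circle R -> 'M[C]_(q, r)) :
  (forall i j, bounded_ae (fun z => A z i j)) -> (forall i j, hardy (fun z => A z i j)) ->
  (forall i j, hardy (fun z => B z i j)) ->
  mean_mx (fun z => A z *m B z) = mean_mx A *m mean_mx B.
Proof.
move=> bA hA hB; apply/matrixP => i j; rewrite !mxE.
rewrite (eq_coef (g := fun z => \sum_k A z i k * B z k j)); last by move=> z; rewrite mxE.
rewrite coef_sum => [|k _]; last exact: (boundedM_L2 (bA i k) (hardy_L2 (hB k j))).
apply: eq_bigr => k _; rewrite !mxE.
exact: (bounded_hardyM_coef0 (bA i k) (hA i k) (hB k j)).
Qed.

Lemma mean_outer : mean_mx F = F0.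
Proof. by apply/matrixP => i j; rewrite mxE F0E. Qed.

Lemma mean_outer_inverse : F0 *m mean_mx G = 1%:M.
Proof.
rewrite -mean_outer -(mean_mulmx outer_bounded outer_hardy outer_inverse_hardy).
apply/matrixP => i j; rewrite mxE.
have l1 : L2 (fun z => (F z *m G z) i j).
  under eq_fun do rewrite mxE; apply: L2_sum => l _.
  exact: (boundedM_L2 (outer_bounded i l) (hardy_L2 (outer_inverse_hardy l j))).
rewrite (coef_ae_eq 0 l1 (L2_cst (1%:M i j))) ?coef_cst ?eqxx//.
by apply: arc_aeS outerV => z ->.
Qed.

(** The vector [F0 *m mean_mx g] is the mean of [F g], so this is Jensen's inequality in each
    coordinate. *)
Lemma outer_energy (g : circle R -> 'cV[C]_n) : (forall i, hardy (fun z => g z i 0)) ->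
  nsqmx (F0 *m mean_mx g) <= \sum_i N2 (fun z => (F z *m g z) i 0).
Proof.
move=> hg; have hg' i j : hardy (fun z => g z i j) by rewrite ord1.
rewrite -mean_outer -(mean_mulmx outer_bounded outer_hardy hg') nsqmx_col.
apply: ler_sum => i _; rewrite mxE; apply: nsq_coef_le.
under eq_fun do rewrite mxE; apply: L2_sum => l _.
exact: (boundedM_L2 (outer_bounded i l) (hardy_L2 (hg l))).
Qed.

(** The function with value [x] at 0 whose product with [F] is constant, which is the case of
    equality in Jensen. *)
Definition outer_extremal (x : 'cV[C]_n) z := G z *m (F0 *m x).

Lemma outer_extremal_bounded x i : bounded_ae (fun z => outer_extremal x z i 0).
Proof.
under eq_fun do rewrite mxE; apply: bounded_sum => k.
exact: (boundedM (outer_inverse_bounded i k) (bounded_cst _)).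
Qed.

Lemma outer_extremal_hardy x i : hardy (fun z => outer_extremal x z i 0).
Proof.
under eq_fun do rewrite mxE; apply: hardy_sum => k.
exact: (bounded_hardyM (outer_inverse_bounded i k) (outer_inverse_hardy i k) (hardy_cst _)).
Qed.

Lemma outer_extremal_mean x : mean_mx (outer_extremal x) = x.
Proof.
rewrite (mean_mulmx (B := fun=> F0 *m x) outer_inverse_bounded outer_inverse_hardy); last first.
  by move=> i j; exact: hardy_cst.
have -> : mean_mx (fun=> F0 *m x) = F0 *m x.
  by apply/matrixP => i j; rewrite mxE coef_cst eqxx.
by rewrite mulmxA (mulmx1C mean_outer_inverse) mul1mx.
Qed.

Lemma outer_extremalE x : {ae m, forall z, F z *m outer_extremal x z = F0 *m x}.
Proof. by apply: arc_aeS outerV => z FG; rewrite mulmxA FG mul1mx. Qed.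

Lemma outer_extremal_energy x :
  \sum_i N2 (fun z => (F z *m outer_extremal x z) i 0) = nsqmx (F0 *m x).
Proof.
rewrite nsqmx_col; apply: eq_bigr => i _; rewrite -[RHS]N2_cst.
apply: N2_ae_eq.
- under eq_fun do rewrite mxE; apply: L2_sum => l _.
  exact: (boundedM_L2 (outer_bounded i l) (hardy_L2 (outer_extremal_hardy x l))).
- exact: L2_cst.
- by apply: arc_aeS (outer_extremalE x) => z ->.
Qed.

End outer.

Section interpolation.
Variables (R : realType) (n : nat).
Local Notation C := R[i].
Local Notation m := (@arc_length R).
Variables W V F w : circle R -> 'M[C]_n.
Hypothesis bW : forall i j, bounded_ae (fun z => W z i j).
Hypothesis bV : forall i j, bounded_ae (fun z => V z i j).
Hypothesis VW : forall z, V z *m W z = 1%:M.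
Hypothesis outerF : right_outer W F.
Hypothesis wW : forall z x, ((nsqmx (w z *m x))%:C)%C = form (W z) x.

Let F0 := holo_ext F 0.

Lemma ell2norm_outer : {ae m, forall z, forall x : 'cV[C]_n,
  ell2norm (w z) x = Num.sqrt (nsqmx (F z *m x))}.
Proof.
case: outerF => _ FW _; apply: arc_aeS FW => z FWz x.
rewrite /ell2norm hsnormE; congr Num.sqrt; apply: (@complexI R).
by rewrite wW -FWz form_gram.
Qed.

Lemma interp0_ge x : ((ell2norm F0 x)%:E <= interp0 (ell2family w) x)%E.
Proof.
apply: le_ereal_inf_tmp => _ [f [g [_ [hg fg] f0 ->]]].
have hgi i : hardy (fun z => g z i 0) by exact: H2_hardy.
have gx : mean_mx g = x.
  rewrite -f0 fg ?normr0//; apply/matrixP => i j; rewrite mxE ord1.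
  by rewrite (holo_ext0E (hardy_L2 (hgi i))).
(* The essential supremum is the infimum of the essential upper bounds; [-oo] is not one of them,
   since a property true almost everywhere holds at some point. *)
apply: le_ereal_inf_tmp => -[r| |] /= hr; last 2 first.
- by rewrite leey.
- by have [z] := arc_aeP hr.
have h2 : {ae m, forall z, nsqmx (F z *m g z) <= r ^+ 2 /\ 0 <= r}.
  apply: arc_aeS (arc_aeI hr ell2norm_outer) => z [].
  rewrite /ell2family lee_fin => wr /(_ (g z)) e; rewrite e in wr.
  have r0 : 0 <= r by apply: le_trans wr; exact: sqrtr_ge0.
  split => //; rewrite -(sqr_sqrtr (nsqmx_ge0 _)).
  by rewrite ler_pXn2r ?nnegrE ?sqrtr_ge0.
have r0 : 0 <= r by have [z []] := arc_aeP h2.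
have lFg i : L2 (fun z => (F z *m g z) i 0).
  under eq_fun do rewrite mxE; apply: L2_sum => l _.
  exact: (boundedM_L2 (outer_bounded bW outerF i l) (hardy_L2 (hgi l))).
rewrite lee_fin /ell2norm -(ler_pXn2r (n := 2)) ?nnegrE ?sqrtr_ge0// hsnorm_sq -gx.
apply: (le_trans (outer_energy bW outerF hgi)).
rewrite -(rint_sum _ (fun i (_ : true) => L2_rintegrable (lFg i))) -[leRHS]rint_cst.
apply: rint_le_ae.
- by apply: rintegrable_sum => i _; exact: (L2_rintegrable (lFg i)).
- exact: rintegrable_cst.
- by apply: arc_aeS h2 => z [h _]; rewrite -nsqmx_col.
Qed.

Lemma bounded_analytic_holo_ext (g : circle R -> 'cV[C]_n) :
  (forall i, hardy (fun z => g z i 0)) -> (forall i, bounded_ae (fun z => g z i 0)) ->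
  bounded_analytic (holo_ext g).
Proof.
move=> hg bg; split.
  move=> z i z1; have zn : ComplexField.Normc.normc z < 1 by rewrite -normc_lt1.
  (* The power series is identified with the Cauchy transform inside the disc only, so the two are
     compared on a neighbourhood of [z]. *)
  apply: (near_eq_derivable _ (derivable_cauchy_transform zn (hardy_L2 (hg i)))).
  have d0 : 0 < 1 - `|z| by rewrite subr_gt0.
  have /cvgrPdist_lt/(_ _ d0) := @cvg_id _ (nbhs (z : (C)^o)).
  apply: filterS => u zu; rewrite (holo_extE _ (hardy_L2 (hg i)))//.
  rewrite -(subrK z u) (le_lt_trans (ler_normD _ _))// distrC.
  by move: zu; rewrite -ltrBrDr.
pose B i := sval (cid2 (bounded_bound (bg i))).
have B0 i : 0 <= B i by rewrite /B; case: (cid2 _).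
have gB i : {ae m, forall z, nsq (g z i 0) <= B i} by rewrite /B; case: (cid2 _).
exists (Num.sqrt (\sum_i 2 * B i)) => z z1; rewrite hsnormE nsqmx_col; apply: ler_wsqrtr.
apply: ler_sum => i _; rewrite (holo_extE z1 (hardy_L2 (hg i))).
by apply: (cauchy_transform_bounded (hg i) (B0 i) (gB i)); rewrite -normc_lt1.
Qed.

Lemma interp0_le x : (interp0 (ell2family w) x <= (ell2norm F0 x)%:E)%E.
Proof.
pose g := outer_extremal V F x.
have hg i := outer_extremal_hardy bW bV VW outerF x i.
have bg i := outer_extremal_bounded bW bV outerF x i.
have hg2 : H2 g by apply: hardy_H2 => i j; rewrite ord1; exact: hg.
apply: (@le_trans _ _ (ess_sup m (fun z => (ell2family w z (g z))%:E))).
  apply: ereal_inf_lbound; exists (holo_ext g), g; split => //.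
    exact: bounded_analytic_holo_ext.
  rewrite -[RHS](outer_extremal_mean bW bV VW outerF x).
  by apply/matrixP => i j; rewrite [RHS]mxE ord1 (holo_ext0E (hardy_L2 (hg i))).
apply/ess_supP; apply: arc_aeS (arc_aeI ell2norm_outer (outer_extremalE VW outerF x)).
move=> z [e1 e2]; rewrite lee_fin /ell2family e1 e2 /ell2norm.
by rewrite hsnormE.
Qed.

Lemma interp0_outer x : interp0 (ell2family w) x = (ell2norm F0 x)%:E.
Proof. by apply/eqP; rewrite eq_le interp0_le interp0_ge. Qed.

End interpolation.

(** * Second-order expansion of the outer function at 0 *)

Lemma cvgn_sum (K : numFieldType) (V : pseudoMetricNormedZmodType K) (I : Type) (r : seq I)
    (P : pred I) (f : I -> nat -> V) (l : I -> V) :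
  (forall i, P i -> f i N @[N --> \oo] --> l i) ->
  \sum_(i <- r | P i) f i N @[N --> \oo] --> \sum_(i <- r | P i) l i.
Proof.
move=> fl; elim: r => [|i r IHr].
  by under eq_fun do rewrite big_nil; rewrite big_nil; exact: cvg_cst.
under eq_fun do rewrite big_cons; rewrite big_cons.
by case: ifPn => // Pi; exact: (cvgD (fl i Pi) IHr).
Qed.

Section total_energy.
Variable R : realType.
Local Notation C := R[i].
Local Notation Re := complex.Re.
Implicit Types (f g h u : circle R -> C).

Definition total_energy u : R := sup (range (pos_energy u)).

Lemma pos_energy_has_sup u : L2 u -> has_sup (range (pos_energy u)).
Proof.
move=> lu; split; first by exists (pos_energy u 0), 0%N.
exists (N2 u) => _ [M _ <-]; apply: le_trans (bessel M lu).
by rewrite lerDr addr_ge0 ?neg_energy_ge0 ?nsq_ge0.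
Qed.

Lemma pos_energy_le_total u M : L2 u -> pos_energy u M <= total_energy u.
Proof.
by move=> /pos_energy_has_sup[_ ub]; apply: ub_le_sup => //; exists M.
Qed.

Lemma total_energy_ge0 u : L2 u -> 0 <= total_energy u.
Proof.
by move=> lu; apply: le_trans (pos_energy_le_total 0 lu); exact: pos_energy_ge0.
Qed.

Lemma cvg_pos_energy u : L2 u -> pos_energy u M @[M --> \oo] --> total_energy u.
Proof.
move=> lu; apply: nondecreasing_cvgn; first by move=> a b; exact: pos_energy_mono.
by case: (pos_energy_has_sup lu).
Qed.

(* Complete the square: by Bessel only the frequencies k <= 0 of c h + e u, which are those of
   e u, are needed to bound its norm from below. *)
Lemma completed_square_ge h u (c e : R) : hardy h -> coef h 0 = 0 -> L2 u -> 0 < c ->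
  - (e ^+ 2 / c * total_energy u) <=
  c * N2 h + 2 * e * Re (Cintegral (fun z => ((h z)^*)%R * u z)).
Proof.
move=> [lh ch] h0 lu c0; set J := Re _.
pose f z := ((c%:C)%C) * h z + ((e%:C)%C) * u z.
have lch := L2Z ((c%:C)%C) lh; have leu := L2Z ((e%:C)%C) lu.
have lf : L2 f by exact: (L2D lch leu).
have cf k : k <= 0 -> coef f k = ((e%:C)%C) * coef u k.
  move=> k0; rewrite /f (coefD k lch leu) (coefZ _ _ lh) (coefZ _ _ lu).
  have -> : coef h k = 0.
    by move: k0; rewrite le_eqVlt => /orP[/eqP ->//|]; exact: ch.
  by rewrite mulr0 add0r.
have NfE : N2 f = c ^+ 2 * N2 h + e ^+ 2 * N2 u + 2 * (c * e * J).
  rewrite /f (N2D lch leu) (N2Z _ lh) (N2Z _ lu) !nsq_real; congr (_ + 2 * _).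
  have lhu := L2_cintegrableM (L2_conj lh) lu.
  rewrite (eq_Cintegral (g := fun z => ((c * e)%:C)%C * (((h z)^*)%R * u z))).
    by rewrite (CintegralZ _ lhu) ReZ.
  move=> z; rewrite rmorphM /= rmorphM /=.
  have -> : (((c%:C)%C)^*)%R = (c%:C)%C :> C by apply: complex_eqP; rewrite !ReImE /= ?oppr0.
  by ring.
(* By Parseval the left-hand side is at most the energy of [e u] at the frequencies [k <= 0]. These
   are also frequencies of [f], and Bessel for [f] concludes. *)
have key (d : R) : 0 < d -> e ^+ 2 * N2 u - e ^+ 2 * (total_energy u + d) <= N2 f.
  move=> d0; have [M /(_ M (leqnn M)) hM] := parseval lu d0.
  have := bessel M lf; have := pos_energy_ge0 f M; have := pos_energy_le_total M lu.
  have -> : neg_energy f M = e ^+ 2 * neg_energy u M.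
    rewrite /neg_energy mulr_sumr; apply: eq_bigr => i _.
    by rewrite cf ?nsqM ?nsq_real// oppr_le0.
  rewrite cf// nsqM nsq_real -mulrBr => h1 h2 h3.
  apply: (@le_trans _ _ (e ^+ 2 * (neg_energy u M + nsq (coef u 0)))).
    by apply: ler_wpM2l; [exact: sqr_ge0|lra].
  by rewrite mulrDr; lra.
have {}key : - (e ^+ 2 * total_energy u) <= c * (c * N2 h + 2 * e * J).
  apply/ler_addgt0Pl => d d0.
  (* The error [d] of [key] is multiplied by [e ^+ 2], and [e] may be 0. *)
  have e0 : 0 < 1 + e ^+ 2 by rewrite ltr_pwDl// sqr_ge0.
  have := key _ (divr_gt0 d0 e0); rewrite NfE mulrDr.
  have : e ^+ 2 * (d / (1 + e ^+ 2)) <= d.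
    by rewrite mulrCA ler_piMr ?(ltW d0)// ler_pdivrMr// mul1r lerDr.
  by lra.
rewrite -(ler_pM2l c0); apply: le_trans key.
by rewrite mulrN lerN2 mulrA mulrCA divff ?mulr1// gt_eqF.
Qed.

(** [p] is the part of [u] at the frequencies 1 to [N]; by orthogonality its pairing with [u] is its
    own energy. Multiplied by [- eps] it gives the competitor of the upper estimate. *)
Lemma truncation u N : L2 u -> exists p,
  [/\ hardy p, coef p 0 = 0, N2 p = pos_energy u N &
      Re (Cintegral (fun z => ((p z)^*)%R * u z)) = pos_energy u N].
Proof.
move=> lu; pose p (z : circle R) := \sum_(k < N) coef u k.+1%:Z * (val z : C) ^+ k.+1.
have lk (k : nat) a : L2 (fun z => a * (val z : C) ^+ k) by exact: (L2Z a (L2_character R k)).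
have hp : hardy p.
  by apply: hardy_sum => k; apply: hardyZ; exact: hardy_character.
have cp j : coef p j = \sum_(k < N) coef u k.+1%:Z * (j == k.+1%:Z)%:R.
  rewrite /p coef_sum => [|k _]; last exact: lk.
  apply: eq_bigr => k _; rewrite (coefZ _ _ (L2_character R k.+1)).
  by rewrite (coef_character R k.+1 j).
have pair g : L2 g -> Cintegral (fun z => ((p z)^*)%R * g z) =
    \sum_(k < N) ((coef u k.+1%:Z)^*)%R * coef g k.+1%:Z.
  move=> lg; rewrite (eq_Cintegral (g := fun z => \sum_(k < N)
      ((coef u k.+1%:Z)^*)%R * ((val z : C) ^ (- k.+1%:Z) * g z))).
    rewrite Cintegral_sum => [|k _]; last exact: (cintegrableZ _ (cintegrable_coef _ lg)).
    by apply: eq_bigr => k _; rewrite (CintegralZ _ (cintegrable_coef _ lg)).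
  move=> z; rewrite rmorph_sum mulr_suml; apply: eq_bigr => k _.
  by rewrite rmorphM /= (circle_conjX z k.+1%:Z) mulrA.
exists p; split => //.
- by rewrite cp big1// => k _; rewrite mulr0.
- transitivity (Re (Cintegral (fun z => ((p z)^*)%R * p z))).
    by apply: eq_rint => z; rewrite mul_conj_nsq.
  rewrite (pair _ (hardy_L2 hp)) Re_sum; apply: eq_bigr => k _.
  rewrite cp (bigD1 k)//= eqxx mulr1 big1 ?addr0 => [|j jk]; last first.
    by rewrite eqz_nat eqSS eq_sym val_eqE (negPf jk) mulr0.
  by rewrite mul_conj_nsq.
- rewrite (pair _ lu) Re_sum; apply: eq_bigr => k _.
  by rewrite mul_conj_nsq.
Qed.

End total_energy.

Section expansion.
Variables (R : realType) (n : nat).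
Local Notation C := R[i].
Local Notation Re := complex.Re.
Local Notation m := (@arc_length R).
Variables (D V F : circle R -> 'M[C]_n) (eps B : R).
Let W z := 1%:M + ((eps%:C)%C) *: D z.
Hypothesis bD : forall i j, bounded_ae (fun z => D z i j).
Hypothesis bW : forall i j, bounded_ae (fun z => W z i j).
Hypothesis bV : forall i j, bounded_ae (fun z => V z i j).
Hypothesis VW : forall z, V z *m W z = 1%:M.
Hypothesis outerF : right_outer W F.
Hypothesis selfD : forall z, selfadjoint (D z).
Hypothesis D_le : forall z x, `|Re (form (D z) x)| <= B * nsqmx x.
Hypothesis eps0 : 0 < eps.
Hypothesis B0 : 0 <= B.
Hypothesis epsB : eps * B <= 1 / 2.

Let F0 := holo_ext F 0.

Lemma form_perturbation z (x h : 'cV[C]_n) :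
  Re (form (W z) (x + h)) =
  nsqmx x + nsqmx h + 2 * Re (\sum_i ((x i 0)^*)%R * h i 0) +
  eps * (Re (\sum_i ((x i 0)^*)%R * (D z *m x) i 0) + Re (form (D z) h) +
         2 * Re (\sum_i ((h i 0)^*)%R * (D z *m x) i 0)).
Proof.
have herm (A : 'M[C]_n) : selfadjoint A -> Re (form A (x + h)) =
    Re (form A x) + Re (form A h) + 2 * Re (\sum_i ((h i 0)^*)%R * (A *m x) i 0).
  move=> hA; rewrite formxD !ReD.
  have e : (h ^t* *m A *m x) 0 0 = \sum_i ((h i 0)^*)%R * (A *m x) i 0.
    by rewrite -mulmxA mxE; apply: eq_bigr => i _; rewrite adjE.
  have -> : (x ^t* *m A *m h) 0 0 = (((h ^t* *m A *m x) 0 0)^*)%R.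
    by rewrite -(adjE (h ^t* *m A *m x) 0 0) !adjM trmxCK hA mulmxA.
  by rewrite Re_conj e; ring.
have h1 : selfadjoint (1%:M : 'M[C]_n).
  by apply/matrixP => i j; rewrite !mxE rmorph_nat eq_sym.
rewrite /W formD formZ ReD ReZ (herm _ h1) (herm _ (selfD z)) !form1 mul1mx /=.
have -> : form (D z) x = \sum_i ((x i 0)^*)%R * (D z *m x) i 0.
  by rewrite /form -mulmxA mxE; apply: eq_bigr => i _; rewrite adjE.
have -> : Re (\sum_i ((h i 0)^*)%R * x i 0) = Re (\sum_i ((x i 0)^*)%R * h i 0).
  by rewrite !Re_sum; apply: eq_bigr => i _; rewrite !ReImE; ring.
by [].
Qed.

Lemma coef0E (f : circle R -> C) : coef f 0 = Cintegral f.
Proof. by apply: eq_Cintegral => z; rewrite oppr0 expr0z mul1r. Qed.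

Lemma D_bounded (x : 'cV[C]_n) i : bounded_ae (fun z => (D z *m x) i 0).
Proof.
under eq_fun do rewrite mxE; apply: bounded_sum => k.
exact: (boundedM (bD i k) (bounded_cst _)).
Qed.

Definition linear_part (x : 'cV[C]_n) : R :=
  nsqmx x + eps * Re (\sum_i ((x i 0)^*)%R * coef (fun z => (D z *m x) i 0) 0).

Definition interaction (x : 'cV[C]_n) (h : circle R -> 'cV[C]_n) : R :=
  \sum_i Re (Cintegral (fun z => ((h z i 0)^*)%R * (D z *m x) i 0)).

(** In the integral of [form_perturbation] the cross term of [x] and [h] vanishes because [h] has
    mean 0. [K] is the integral of the term quadratic in [h]; only its size is recorded, and each of
    the two estimates uses one side of that bound. *)
Lemma energy_expansion (x : 'cV[C]_n) (h : circle R -> 'cV[C]_n) :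
  (forall i, hardy (fun z => h z i 0)) -> (forall i, coef (fun z => h z i 0) 0 = 0) ->
  exists2 K, `|K| <= B * \sum_i N2 (fun z => h z i 0) &
  \sum_i N2 (fun z => (F z *m (x + h z)) i 0) =
  linear_part x + \sum_i N2 (fun z => h z i 0) + eps * (K + 2 * interaction x h).
Proof.
move=> hh h0; have lh i := hardy_L2 (hh i).
have lu i := bounded_L2 (D_bounded x i).
have lg i : L2 (fun z => (x + h z) i 0).
  by under eq_fun do rewrite mxE; exact: (L2D (L2_cst _) (lh i)).
have lFg i : L2 (fun z => (F z *m (x + h z)) i 0).
  under eq_fun do rewrite mxE; apply: L2_sum => l _.
  exact: (boundedM_L2 (outer_bounded bW outerF i l) (lg l)).
have ih : rintegrable (fun z => nsqmx (h z)).
  under eq_fun do rewrite nsqmx_col.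
  by apply: rintegrable_sum => i _; exact: (L2_rintegrable (lh i)).
have Hh : \int[m]_z nsqmx (h z) = \sum_i N2 (fun z => h z i 0).
  rewrite -(rint_sum _ (fun i (_ : true) => L2_rintegrable (lh i))).
  by apply: eq_rint => z; rewrite nsqmx_col.
have mform : measurable_fun setT (fun z => Re (form (D z) (h z))).
  apply: measurable_Re; under eq_fun do rewrite formE.
  apply: cmeasurable_sum => i _; apply: cmeasurable_sum => j _.
  apply: (cmeasurableM _ (L2_measurable (lh j))).
  exact: (cmeasurableM (cmeasurable_conj (L2_measurable (lh i))) (bounded_measurable (bD i j))).
have iform : rintegrable (fun z => Re (form (D z) (h z))).
  by apply: (rintegrable_le mform (rintegrableZ B ih)) => z; exact: D_le.
have sumI (f : 'I_n -> circle R -> C) : (forall i, cintegrable (f i)) ->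
    rintegrable (fun z => Re (\sum_i f i z)) /\
    \int[m]_z Re (\sum_i f i z) = \sum_i Re (Cintegral (f i)).
  move=> cf; have ci := cintegrable_sum (index_enum 'I_n) (fun i (_ : true) => cf i).
  split; first exact: (rintegrable_Re ci).
  rewrite -Re_sum -(Cintegral_sum _ (fun i (_ : true) => cf i)).
  by [].
have [i2 e2] := sumI _ (fun i => cintegrableZ ((x i 0)^*)%R (L2_cintegrable (lh i))).
have [i3 e3] := sumI _ (fun i => cintegrableZ ((x i 0)^*)%R (L2_cintegrable (lu i))).
have [i5 e5] := sumI _ (fun i => L2_cintegrableM (L2_conj (lh i)) (lu i)).
exists (\int[m]_z Re (form (D z) (h z))).
  rewrite ler_norml -Hh -rintZ//; apply/andP; split.
    rewrite -mulN1r -rintZ; last exact: rintegrableZ.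
    apply: (rint_le (rintegrableZ _ (rintegrableZ _ ih)) iform) => z.
    by rewrite mulN1r; have := D_le z (h z); rewrite ler_norml => /andP[].
  apply: (rint_le iform (rintegrableZ _ ih)) => z.
  by rewrite (le_trans (ler_norm _)).
have iC := rintegrable_cst (nsqmx x).
have iA := rintegrableD (rintegrableD iC ih) (rintegrableZ 2 i2).
have iB := rintegrableZ eps (rintegrableD (rintegrableD i3 iform) (rintegrableZ 2 i5)).
transitivity (\int[m]_z (nsqmx x + nsqmx (h z) + 2 * Re (\sum_i ((x i 0)^*)%R * h z i 0) +
  eps * (Re (\sum_i ((x i 0)^*)%R * (D z *m x) i 0) + Re (form (D z) (h z)) +
         2 * Re (\sum_i ((h z i 0)^*)%R * (D z *m x) i 0)))).
  rewrite -(rint_sum _ (fun i (_ : true) => L2_rintegrable (lFg i))).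
  apply: (rint_ae_eq _ (rintegrableD iA iB)).
    by apply: rintegrable_sum => i _; exact: (L2_rintegrable (lFg i)).
  case: outerF => _ FW _; apply: arc_aeS FW => z FWz.
  by rewrite -form_perturbation -FWz form_gram nsqmx_col.
rewrite (rintD iA iB) (rintD (rintegrableD iC ih) (rintegrableZ 2 i2)) (rintD iC ih).
rewrite (rintZ eps (rintegrableD (rintegrableD i3 iform) (rintegrableZ 2 i5))).
rewrite (rintD (rintegrableD i3 iform) (rintegrableZ 2 i5)) (rintD i3 iform).
rewrite !rintZ// rint_cst Hh e2 e3 e5 /linear_part /interaction.
have -> : \sum_i Re (Cintegral (fun z => ((x i 0)^*)%R * h z i 0)) = 0.
  by rewrite big1// => i _; rewrite (CintegralZ _ (L2_cintegrable (lh i))) -coef0E h0 mulr0.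
have -> : \sum_i Re (Cintegral (fun z => ((x i 0)^*)%R * (D z *m x) i 0)) =
    Re (\sum_i ((x i 0)^*)%R * coef (fun z => (D z *m x) i 0) 0).
  rewrite Re_sum; apply: eq_bigr => i _.
  by rewrite (CintegralZ _ (L2_cintegrable (lu i))) -coef0E.
by ring.
Qed.

(** The sum over [n >= 1] of [|D^(n) x|^2], arranged by coordinates so that the scalar results
    apply. *)
Definition perturbation_energy (x : 'cV[C]_n) : R :=
  \sum_i total_energy (fun z => (D z *m x) i 0).

Lemma perturbation_energy_ge0 x : 0 <= perturbation_energy x.
Proof. by apply: sumr_ge0 => i _; exact: (total_energy_ge0 (bounded_L2 (D_bounded x i))). Qed.

(** The expansion is applied to the minimizer itself. Its term [K] costs at most [B] times the
    energy of [h], which leaves the coefficient [c = 1 - eps * B] for [completed_square_ge]. *)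
Lemma outer_energy_ge x : linear_part x -
  eps ^+ 2 / (1 - eps * B) * perturbation_energy x <= nsqmx (F0 *m x).
Proof.
pose h z := outer_extremal V F x z - x.
have hE i : (fun z => h z i 0) = (fun z => outer_extremal V F x z i 0 + (- x i 0)).
  by apply/funext => z; rewrite /h subE.
have hh i : hardy (fun z => h z i 0).
  rewrite hE; apply: hardyD (hardy_cst _).
  exact: (outer_extremal_hardy bW bV VW outerF).
have h0 i : coef (fun z => h z i 0) 0 = 0.
  have hx := outer_extremal_hardy bW bV VW outerF x i.
  rewrite hE (coefD 0 (hardy_L2 hx) (L2_cst _)) coef_cst eqxx.
  have := congr1 (fun A : 'cV[C]_n => A i 0) (outer_extremal_mean bW bV VW outerF x).
  by rewrite mxE => ->; rewrite subrr.
have [K KB E] := energy_expansion x hh h0.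
rewrite -(outer_extremal_energy bW bV VW outerF x).
have -> : \sum_i N2 (fun z => (F z *m outer_extremal V F x z) i 0) =
    \sum_i N2 (fun z => (F z *m (x + h z)) i 0).
  by apply: eq_bigr => i _; apply: eq_N2 => z; rewrite /h addrC subrK.
rewrite E; set H := \sum_i N2 _ in KB *.
have c0 : 0 < 1 - eps * B by have := epsB; lra.
have : - (eps ^+ 2 / (1 - eps * B) * perturbation_energy x) <=
    (1 - eps * B) * H + 2 * eps * interaction x h.
  rewrite /perturbation_energy /H /interaction !mulr_sumr -sumrN -big_split /=.
  apply: ler_sum => i _.
  exact: (completed_square_ge eps (hh i) (h0 i) (bounded_L2 (D_bounded x i)) c0).
move: KB; rewrite ler_norml => /andP[K1 _].
have : eps * (- (B * H)) <= eps * K by rewrite ler_pM2l.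
by lra.
Qed.

(** Dropping [K], the best [h] is [- eps] times the positive part of [D x]. With [P] the truncated
    energy, the three contributions are [eps^2 P], at most [eps^3 B P] from [K], and [- 2 eps^2 P],
    in total at most [- eps^2 (1 - eps B) P]. *)
Lemma outer_energy_le_partial x N : nsqmx (F0 *m x) <=
  linear_part x - eps ^+ 2 * (1 - eps * B) * \sum_i pos_energy (fun z => (D z *m x) i 0) N.
Proof.
have tr i := truncation N (bounded_L2 (D_bounded x i)).
pose p i := sval (cid (tr i)).
have hp i : [/\ hardy (p i), coef (p i) 0 = 0,
    N2 (p i) = pos_energy (fun z => (D z *m x) i 0) N &
    Re (Cintegral (fun z => ((p i z)^*)%R * (D z *m x) i 0)) =
      pos_energy (fun z => (D z *m x) i 0) N] by rewrite /p; case: (cid _).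
pose h z := \col_i (((- eps)%:C)%C * p i z).
have hE i : (fun z => h z i 0) = (fun z => ((- eps)%:C)%C * p i z).
  by apply/funext => z; rewrite mxE.
have hh i : hardy (fun z => h z i 0).
  by rewrite hE; apply: hardyZ; case: (hp i).
have h0 i : coef (fun z => h z i 0) 0 = 0.
  by case: (hp i) => hpi p0 _ _; rewrite hE (coefZ _ _ (hardy_L2 hpi)) p0 mulr0.
have [K KB E] := energy_expansion x hh h0.
have hg i : hardy (fun z => (x + h z) i 0).
  by under eq_fun do rewrite mxE; exact: (hardyD (hardy_cst _) (hh i)).
have gx : mean_mx (fun z => x + h z) = x.
  apply/matrixP => i j; rewrite mxE ord1.
  rewrite (eq_coef (g := fun z => x i 0 + h z i 0)); last by move=> z; rewrite mxE.
  by rewrite (coefD 0 (L2_cst _) (hardy_L2 (hh i))) coef_cst eqxx h0 addr0.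
have := outer_energy bW outerF hg; rewrite gx E.
set P := \sum_i pos_energy _ _.
have HE : \sum_i N2 (fun z => h z i 0) = eps ^+ 2 * P.
  rewrite /P mulr_sumr; apply: eq_bigr => i _; case: (hp i) => hpi _ <- _.
  by rewrite hE (N2Z _ (hardy_L2 hpi)) nsq_real sqrrN.
have JE : interaction x h = - (eps * P).
  rewrite /interaction /P -mulNr mulr_sumr; apply: eq_bigr => i _; case: (hp i) => hpi _ _ <-.
  rewrite -ReZ -(CintegralZ _ (L2_cintegrableM (L2_conj (hardy_L2 hpi)) (bounded_L2 (D_bounded x i)))).
  congr Re; apply: eq_Cintegral => z; rewrite [h z i 0]mxE rmorphM /= -mulrA; congr (_ * _).
  by apply: complex_eqP; rewrite !ReImE /= ?oppr0.
rewrite HE JE in KB *; move: KB; rewrite ler_norml => /andP[_ K2].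
have : eps * K <= eps * (B * (eps ^+ 2 * P)) by rewrite ler_pM2l.
move: (linear_part x) => A h1 h2; apply: (le_trans h2); lra.
Qed.

Lemma outer_energy_le x : nsqmx (F0 *m x) <=
  linear_part x - eps ^+ 2 * (1 - eps * B) * perturbation_energy x.
Proof.
rewrite lerBrDl -lerBrDr.
have cv : eps ^+ 2 * (1 - eps * B) * (\sum_i pos_energy (fun z => (D z *m x) i 0) N)
    @[N --> \oo] --> eps ^+ 2 * (1 - eps * B) * perturbation_energy x.
  apply: cvgMr; apply: cvgn_sum => i _.
  exact: (cvg_pos_energy (bounded_L2 (D_bounded x i))).
rewrite -(cvg_lim _ cv)//; apply: limr_le; first by apply/cvg_ex; eexists; exact: cv.
by apply: nearW => N; have := outer_energy_le_partial x N; lra.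
Qed.

Lemma outer_energy_expansion x :
  `|nsqmx (F0 *m x) - (linear_part x - eps ^+ 2 * perturbation_energy x)| <=
  2 * B * eps ^+ 3 * perturbation_energy x.
Proof.
have := outer_energy_le x; have := outer_energy_ge x.
have s0 := perturbation_energy_ge0 x.
move: (linear_part x) (perturbation_energy x) (nsqmx _) s0 => A s q s0 h1 h2.
have c0 : 0 < 1 - eps * B by have := epsB; lra.
have B3 : 0 <= B * eps ^+ 3 * s by rewrite !mulr_ge0 ?exprn_ge0 ?(ltW eps0).
rewrite ler_norml; apply/andP; split; last first.
  by move: h2 B3; rewrite !exprS expr0 !mulr1; lra.
(* [1 / (1 - t) <= 1 + 2 t] for [0 <= t <= 1/2]; this is where [eps * B <= 1 / 2] and the constant 2
   of the error come from. *)
have : eps ^+ 2 / (1 - eps * B) * s <= eps ^+ 2 * (1 + 2 * (eps * B)) * s.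
  rewrite ler_wpM2r// ler_wpM2l ?sqr_ge0// -[leLHS]mul1r ler_pdivrMr//.
  have : 0 <= eps * B by rewrite mulr_ge0 ?(ltW eps0).
  by move: (eps * B) epsB => t; nra.
move: h1; rewrite !exprS expr0 !mulr1.
by lra.
Qed.

End expansion.

(** * Step functions *)

Section indicators.
Variable R : realType.
Local Notation C := R[i].
Local Notation Re := complex.Re.
Local Notation Im := complex.Im.
Local Notation m := (@arc_length R).
Implicit Types (A : set (circle R)) (u v : circle R -> C).

Definition ind A (z : circle R) : C := \1_A z.

Lemma indE A z : ind A z = ((\1_A z : R)%:C)%C.
Proof. by rewrite /ind !indicE; case: (z \in A). Qed.

Lemma ind_bounded A : measurable A -> bounded_ae (ind A).
Proof.
move=> mA; split.
  split; under eq_fun do rewrite indE /=; first exact: measurable_indic.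
  exact: measurable_cst.
exists 1 => //; apply: arc_aeW => z.
by rewrite indE nsq_real indicE; case: (z \in A); rewrite ?expr1n ?expr0n.
Qed.

Lemma coef_ind0 A : measurable A -> coef (ind A) 0 = ((fine (m A))%:C)%C.
Proof.
move=> mA; have -> : coef (ind A) 0 = Cintegral (ind A).
  by apply: eq_Cintegral => z; rewrite oppr0 expr0z mul1r.
apply: complex_eqP => /=; last first.
  by rewrite -[RHS](rint_cst (0 : R)); apply: eq_rint => z; rewrite indE.
transitivity (\int[m]_z (\1_A z : R)); first by apply: eq_rint => z; rewrite indE.
by rewrite /Rintegral integral_indic// setIT.
Qed.

(** For a real function the frequencies [n] and [- n] carry equal energy, so Parseval determines the
    positive half. For an indicator the norm is [m] and the squared mean [m^2], which gives
    [ind_energy]. *)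
Lemma total_energy_real u : L2 u -> (forall z, ((u z)^*)%R = u z) ->
  2 * total_energy u + nsq (coef u 0) = N2 u.
Proof.
move=> lu ru; have sym M : neg_energy u M = pos_energy u M.
  apply: eq_bigr => i _.
  by rewrite -nsq_conj -(coef_conj _ lu) (eq_coef _ ru).
have cv := cvg_pos_energy lu.
apply/eqP; rewrite eq_le; apply/andP; split.
  rewrite -lerBrDr -ler_pdivlMl// -(cvg_lim _ cv)//.
  apply: limr_le; first by apply/cvg_ex; eexists; exact: cv.
  by apply: nearW => M; have := bessel M lu; rewrite sym; lra.
apply/ler_addgt0Pr => e e0; have [M /(_ M (leqnn M))] := parseval lu e0.
by rewrite sym; have := pos_energy_le_total M lu; lra.
Qed.

Definition ind_energy A : R := (fine (m A) - fine (m A) ^+ 2) / 2.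

Lemma total_energy_ind A : measurable A -> total_energy (ind A) = ind_energy A.
Proof.
move=> mA; have lA := bounded_L2 (ind_bounded mA).
have := total_energy_real lA _; rewrite (coef_ind0 mA) nsq_real.
have -> : N2 (ind A) = fine (m A).
  have := congr1 (@complex.Re R) (coef_ind0 mA).
  rewrite /= => <-; apply: eq_rint => z.
  by rewrite oppr0 expr0z mul1r indE nsq_real indicE; case: (z \in A); rewrite ?expr1n ?expr0n.
have rA z : ((ind A z)^*)%R = ind A z by rewrite /ind !indicE rmorph_nat.
by move=> /(_ rA); rewrite /ind_energy; lra.
Qed.

Lemma total_energy_affine u (a b : C) : L2 u ->
  total_energy (fun z => a + b * u z) = nsq b * total_energy u.
Proof.
move=> lu; rewrite /total_energy.
have -> : pos_energy (fun z => a + b * u z) = (fun M => nsq b * pos_energy u M).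
  apply/funext => M; rewrite /pos_energy mulr_sumr; apply: eq_bigr => i _.
  by rewrite (coefD _ (L2_cst a) (L2Z b lu)) coef_cst (coefZ _ _ lu) add0r nsqM.
have cv : (nsq b * pos_energy u M) @[M --> \oo] --> nsq b * total_energy u.
  by apply: cvgMr; exact: cvg_pos_energy.
have [nb0 ub] := pos_energy_has_sup lu.
have cv' : (nsq b * pos_energy u M) @[M --> \oo] -->
    sup (range (fun M => nsq b * pos_energy u M)).
  apply: nondecreasing_cvgn.
    by move=> M N MN; apply: ler_wpM2l (pos_energy_mono _ MN); exact: nsq_ge0.
  exists (nsq b * total_energy u) => _ [M _ <-].
  by apply: ler_wpM2l; [exact: nsq_ge0|exact: pos_energy_le_total].
exact: (cvg_unique _ cv' cv).
Qed.

Lemma total_energy_ae_eq u v : L2 u -> L2 v -> {ae m, forall z, u z = v z} ->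
  total_energy u = total_energy v.
Proof.
move=> lu lv uv; rewrite /total_energy.
suff -> : pos_energy u = pos_energy v by [].
by apply/funext => M; apply: eq_bigr => i _; rewrite (coef_ae_eq _ lu lv uv).
Qed.

End indicators.

Section step_functions.
Variables (R : realType) (N n : nat).
Local Notation C := R[i].
Local Notation m := (@arc_length R).
Implicit Types (S : 'I_N -> set (circle R)) (D : 'I_N -> 'M[C]_n).

Lemma partition_ex S z : measurable_partition S -> exists k, S k z.
Proof. by case=> _ _ ST; have : [set: circle R] z by []; rewrite -ST => -[k _ Sk]; exists k. Qed.

Lemma partition_inj S j k z : measurable_partition S -> S j z -> S k z -> j = k.
Proof. by case=> _ tS _ Sj Sk; apply: tS => //; exists z. Qed.

Lemma ind_partition S j k z : measurable_partition S -> S k z ->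
  ind (S j) z = (j == k)%:R.
Proof.
move=> pS Sk; rewrite /ind indicE; case: eqVneq => [->|jk]; first by rewrite mem_set.
by rewrite memNset// => Sj; rewrite (partition_inj pS Sj Sk) eqxx in jk.
Qed.

Lemma stepmxE S D k z : measurable_partition S -> S k z -> stepmx S D z = D k.
Proof.
move=> pS Sk; rewrite /stepmx (bigD1 k)//= big1 => [|j jk].
  by rewrite -/(ind (S k) z) (ind_partition k pS Sk) eqxx scale1r addr0.
by rewrite -/(ind (S j) z) (ind_partition j pS Sk) (negPf jk) scale0r.
Qed.

Lemma stepmx_entry S D z i j : stepmx S D z i j = \sum_k D k i j * ind (S k) z.
Proof. by rewrite /stepmx summxE; apply: eq_bigr => k _; rewrite mxE mulrC. Qed.

Lemma stepmx_bounded S D i j : measurable_partition S -> bounded_ae (fun z => stepmx S D z i j).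
Proof.
case=> mS _ _; under eq_fun do rewrite stepmx_entry; apply: bounded_sum => k.
exact: (boundedM (bounded_cst _) (ind_bounded (mS k))).
Qed.

Lemma coef_stepmx S D i j k : measurable_partition S ->
  coef (fun z => stepmx S D z i j) k = \sum_l D l i j * coef (ind (S l)) k.
Proof.
case=> mS _ _; rewrite (eq_coef (g := fun z => \sum_l D l i j * ind (S l) z)); last first.
  by move=> z; exact: stepmx_entry.
have lS l := bounded_L2 (ind_bounded (mS l)).
rewrite coef_sum => [|l _]; last exact: (L2Z _ (lS l)).
by apply: eq_bigr => l _; rewrite (coefZ _ _ (lS l)).
Qed.

Lemma coef_mulmx (F : circle R -> 'M[C]_n) (x : 'cV[C]_n) i k :
  (forall i j, bounded_ae (fun z => F z i j)) ->
  coef (fun z => (F z *m x) i 0) k = (fourier F k *m x) i 0.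
Proof.
move=> bF; rewrite mxE (eq_coef (g := fun z => \sum_j x j 0 * F z i j)); last first.
  by move=> z; rewrite mxE; apply: eq_bigr => j _; rewrite mulrC.
rewrite coef_sum => [|j _]; last exact: (L2Z _ (bounded_L2 (bF i j))).
by apply: eq_bigr => j _; rewrite (coefZ _ _ (bounded_L2 (bF i j))) mulrC mxE.
Qed.

(** One hypothesis covers both degenerate cases: two equal matrices, with [c] the remaining index,
    and a null piece, with [a] and [c] the other two indices. *)
Lemma perturbation_energy_two_valued S D (a c : 'I_N) (x : 'cV[C]_n) :
  measurable_partition S -> (forall k, [\/ k = c, D k = D a | m (S k) = 0%E]) ->
  perturbation_energy (stepmx S D) x = ind_energy (S c) * nsqmx ((D c - D a) *m x).
Proof.
move=> pS two; have [mS _ _] := pS.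
have lc := bounded_L2 (ind_bounded (mS c)).
pose g i z := (D a *m x) i 0 + ((D c - D a) *m x) i 0 * ind (S c) z.
have lg i : L2 (g i) by exact: (L2D (L2_cst _) (L2Z _ lc)).
have lD i := bounded_L2 (D_bounded (fun i j => stepmx_bounded D i j pS) x i).
have aeD : {ae m, forall z, stepmx S D z = D a + ind (S c) z *: (D c - D a)}.
  have null k : {ae m, forall z, S k z -> [\/ k = c | D k = D a]}.
    have [->|Dk|Sk] := two k; [by apply: arc_aeW => z; left|by apply: arc_aeW => z; right|].
    exists (S k); split => //.
    by move=> z /= h; apply: contrapT => nSk; apply: h => /nSk.
  have : {ae m, forall z, forall k, S k z -> [\/ k = c | D k = D a]}.
    by apply: filter_forall.
  apply: arc_aeS => z /= h; have [k Sk] := partition_ex z pS.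
  rewrite (stepmxE D pS Sk) (ind_partition c pS Sk).
  case: (h k Sk) => [->|DkE]; first by rewrite eqxx scale1r addrC subrK.
  by case: eqVneq => [->|_]; rewrite DkE ?subrr ?scaler0 ?scale0r addr0.
rewrite /perturbation_energy nsqmx_col mulr_sumr; apply: eq_bigr => i _.
rewrite (total_energy_ae_eq (lD i) (lg i)).
  by rewrite /g (total_energy_affine _ _ lc) (total_energy_ind (mS c)) mulrC.
apply: arc_aeS aeD => z ->; rewrite mulmxDl mxE -scalemxAl; congr (_ + _).
by rewrite mxE mulrC.
Qed.

End step_functions.

(** * The matrix series of squares as a quadratic form *)

Section series_of_squares.
Variable R : realType.
Local Notation C := R[i].
Local Notation Re := complex.Re.
Local Notation Im := complex.Im.
Implicit Types (u v : circle R -> C).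

Let pairing u v N : C := \sum_(k < N) ((coef u k.+1%:Z)^*)%R * coef v k.+1%:Z.

Lemma cvg_complex_ReIm (s : nat -> C) (a b : R) :
  Re (s n) @[n --> \oo] --> a -> Im (s n) @[n --> \oo] --> b ->
  (s : nat -> C^o) @ \oo --> (Complex a b : C^o).
Proof.
move=> sa sb; apply: cvg_complex.
have -> : (0 : R) = (a - a) * (a - a) + (b - b) * (b - b) by rewrite !subrr mulr0 addr0.
under eq_fun do rewrite /nsq !ReImE /= !expr2.
have ca : (Re (s n) - a) @[n --> \oo] --> a - a by apply: cvgB => //; exact: cvg_cst.
have cb : (Im (s n) - b) @[n --> \oo] --> b - b by apply: cvgB => //; exact: cvg_cst.
by apply: cvgD; apply: cvgM.
Qed.

(** Polarization reduces the mixed sums to the energies of [u], [v] and [u + v], which are monotone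
    and bounded. *)
Lemma cvg_Re_pairing u v : L2 u -> L2 v -> cvg (Re (pairing u v N) @[N --> \oo]).
Proof.
move=> lu lv; have luv := L2D lu lv.
have -> : (fun N => Re (pairing u v N)) = (fun N => 2^-1 *
    (pos_energy (fun z => u z + v z) N - pos_energy u N - pos_energy v N)).
  apply/funext => N; rewrite /pairing Re_sum /pos_energy -!sumrB mulr_sumr.
  by apply: eq_bigr => k _; rewrite (coefD _ lu lv) nsqD; field.
apply/cvg_ex; eexists; apply: cvgMr; apply: cvgB; last exact: (cvg_pos_energy lv).
by apply: cvgB; [exact: (cvg_pos_energy luv)|exact: (cvg_pos_energy lu)].
Qed.

Lemma cvg_pairing u v : L2 u -> L2 v -> cvg ((pairing u v : nat -> C^o) @ \oo).
Proof.
move=> lu lv; have /cvg_ex[/= a ca] := cvg_Re_pairing lu lv.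
(* The imaginary part of the pairing with [v] is the real part of the pairing with [- i v]. *)
have /cvg_ex[/= b cb] := cvg_Re_pairing lu (L2Z (- 'i)%C lv).
apply/cvg_ex; exists (Complex a b); apply: cvg_complex_ReIm => //.
apply: cvg_trans cb; apply: near_eq_cvg; apply: nearW => N.
rewrite /pairing Im_sum Re_sum; apply: eq_bigr => k _.
by rewrite (coefZ _ _ lv) !ReImE /=; ring.
Qed.

(** Links the matrix series of the hypothesis with the scalar energies of the expansion: both sides
    are limits of the same partial sums. *)
Lemma form_mxseries n (F : circle R -> 'M[C]_n) (x : 'cV[C]_n) :
  (forall i j, bounded_ae (fun z => F z i j)) ->
  form (mxseries (fun k => sqabsmx (fourier F k.+1%:Z))) x =
  ((perturbation_energy F x)%:C)%C.
Proof.
move=> bF; set s := fun k => sqabsmx _.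
have sE k i j : s k i j = \sum_l ((coef (fun z => F z l i) k.+1%:Z)^*)%R *
    coef (fun z => F z l j) k.+1%:Z.
  by rewrite /s /sqabsmx mxE; apply: eq_bigr => l _; rewrite adjE !mxE.
(* [mxseries] is made of entrywise [lim], which carry information only once convergence is known,
   off the diagonal as well. *)
have cs i j : cvg (series (fun k => s k i j : C^o) @ \oo).
  have -> : series (fun k => s k i j : C^o) =
      (fun N => \sum_l pairing (fun z => F z l i) (fun z => F z l j) N : C^o).
    apply/funext => N; rewrite /series /= big_mkord /pairing exchange_big /=.
    by apply: eq_bigr => k _; exact: sE.
  have cp l := cvg_pairing (bounded_L2 (bF l i)) (bounded_L2 (bF l j)).
  apply/cvg_ex; eexists; apply: (cvgn_sum (V := C^o)) => l _; exact: cp.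
have c1 : (fun N => \sum_i \sum_j (((x i 0)^*)%R * x j 0 : C^o) *
      (series (fun k => s k i j : C^o) N : C^o)) @ \oo -->
    (form (mxseries s) x : C^o).
  rewrite formE; apply: (cvgn_sum (V := C^o)) => i _; apply: (cvgn_sum (V := C^o)) => j _.
  rewrite mulrAC mxE; apply: cvgMr; exact: cs.
have c2 : (fun N => \sum_i \sum_j (((x i 0)^*)%R * x j 0 : C^o) *
      (series (fun k => s k i j : C^o) N : C^o)) @ \oo -->
    (((perturbation_energy F x)%:C)%C : C^o).
  have -> : (fun N => \sum_i \sum_j (((x i 0)^*)%R * x j 0 : C^o) *
      (series (fun k => s k i j : C^o) N : C^o)) =
      (fun N => ((\sum_i pos_energy (fun z => (F z *m x) i 0) N)%:C)%C).
    apply/funext => N; transitivity (\sum_(k < N) form (s k) x).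
      rewrite (eq_bigr (fun i => \sum_j \sum_(k < N) ((x i 0)^*)%R * s k i j * x j 0)).
        rewrite (eq_bigr (fun i => \sum_(k < N) \sum_j ((x i 0)^*)%R * s k i j * x j 0)).
          by rewrite exchange_big /=; apply: eq_bigr => k _; rewrite formE.
        by move=> i _; rewrite exchange_big.
      move=> i _; apply: eq_bigr => j _; rewrite /series /= big_mkord mulr_sumr.
      by apply: eq_bigr => k _; rewrite mulrAC.
    rewrite exchange_big /= rmorph_sum /=; apply: eq_bigr => k _.
    rewrite /s form_gram nsqmx_col; congr ((_%:C)%C); apply: eq_bigr => i _.
    by rewrite (coef_mulmx _ _ _ bF).
  apply: cvg_complex_ReIm => /=; last exact: cvg_cst.
  apply: cvgn_sum => i _.
  exact: (cvg_pos_energy (bounded_L2 (D_bounded bF x i))).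
exact: (cvg_unique _ c1 c2).
Qed.

End series_of_squares.

(** Used by contraposition: distinct series yield a vector at which the energies differ. *)
Lemma mxseries_energy_eq (R : realType) n (F G : circle R -> 'M[R[i]]_n) :
  (forall i j, bounded_ae (fun z => F z i j)) -> (forall i j, bounded_ae (fun z => G z i j)) ->
  (forall x, perturbation_energy F x = perturbation_energy G x) ->
  mxseries (fun k => sqabsmx (fourier F k.+1%:Z)) =
  mxseries (fun k => sqabsmx (fourier G k.+1%:Z)).
Proof.
move=> bF bG FG; apply: form_inj => x.
by apply: (etrans (form_mxseries x bF)); rewrite FG; apply/esym; exact: (form_mxseries x bG).
Qed.

Lemma fourierE (R : realType) p q (F : circle R -> 'M[R[i]]_(p, q)) k i j :
  fourier F k i j = coef (fun z => F z i j) k.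
Proof. by rewrite mxE. Qed.

Lemma linear_part_eq (R : realType) n (F G : circle R -> 'M[R[i]]_n) eps x :
  (forall i j, bounded_ae (fun z => F z i j)) -> (forall i j, bounded_ae (fun z => G z i j)) ->
  fourier F 0 = fourier G 0 -> linear_part F eps x = linear_part G eps x.
Proof.
move=> bF bG FG.
suff e i : coef (fun z => (F z *m x) i 0) 0 = coef (fun z => (G z *m x) i 0) 0.
  have E : \sum_i ((x i 0)^*)%R * coef (fun z => (F z *m x) i 0) 0 =
      \sum_i ((x i 0)^*)%R * coef (fun z => (G z *m x) i 0) 0.
    by apply: eq_bigr => i _; rewrite e.
  exact: (congr1 (fun t => nsqmx x + eps * complex.Re t) E).
by rewrite (coef_mulmx x i 0 bF) (coef_mulmx x i 0 bG) FG.
Qed.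

Lemma absmx_ubound (R : realType) N n (D : 'I_N -> 'M[R[i]]_n) :
  exists2 B, 1 <= B & forall k, absmx (D k) <= B.
Proof.
exists (1 + \sum_k absmx (D k)).
  by rewrite lerDl; apply: sumr_ge0 => k _; exact: absmx_ge0.
move=> k; rewrite (bigD1 k)//= addrCA lerDl; apply: addr_ge0; first exact: ler01.
by apply: sumr_ge0 => j _; exact: absmx_ge0.
Qed.

Lemma nsqmx_sqabsmx (R : realType) n (A B : 'M[R[i]]_n) (x : 'cV_n) :
  sqabsmx A = sqabsmx B ->
  nsqmx (A *m x) = nsqmx (B *m x).
Proof.
move=> AB; have := form_gram A x; rewrite -/(sqabsmx A) AB.
by rewrite /sqabsmx form_gram => -[].
Qed.

(** * Weights obtained by a step perturbation of the identity *)

Section step_weights.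
Variables (R : realType) (N n : nat).
Local Notation C := R[i].
Local Notation Re := complex.Re.
Local Notation m := (@arc_length R).
Variables (S : 'I_N -> set (circle R)) (D : 'I_N -> 'M[C]_n) (eps B : R).
Hypothesis partS : measurable_partition S.
Hypothesis selfD : forall k, selfadjoint (D k).
Hypothesis D_le : forall k x, `|Re (form (D k) x)| <= B * nsqmx x.
Hypothesis eps0 : 0 < eps.
Hypothesis epsB : eps * B <= 1 / 2.

Let Delta := stepmx S D.
Let A k := 1%:M + ((eps%:C)%C) *: D k.
Let W z := 1%:M + ((eps%:C)%C) *: Delta z.

Lemma step_weightE k z : S k z -> W z = A k.
Proof. by move=> Sk; rewrite /W /Delta (stepmxE D partS Sk). Qed.

Lemma step_weight_stepmx : W = stepmx S A.
Proof.
apply/funext => z; have [k Sk] := partition_ex z partS.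
by rewrite (step_weightE Sk) (stepmxE A partS Sk).
Qed.

Lemma form_step_weight k x : exists2 r, form (A k) x = ((r%:C)%C) &
  nsqmx x / 2 <= r <= 3 / 2 * nsqmx x.
Proof.
exists (nsqmx x + eps * Re (form (D k) x)).
  rewrite /A formD form1 formZ (form_selfadjoint_real x (selfD k)) /=.
  by rewrite -rmorphM -rmorphD.
have : eps * `|Re (form (D k) x)| <= eps * (B * nsqmx x) by rewrite ler_pM2l.
have : eps * B * nsqmx x <= 1 / 2 * nsqmx x by apply: ler_wpM2r epsB; exact: nsqmx_ge0.
have : `|eps * Re (form (D k) x)| = eps * `|Re (form (D k) x)|.
  by rewrite normrM gtr0_norm.
move: (eps * Re _) (eps * `|_|) => a b ab h1 h2.
have : `|a| <= nsqmx x / 2 by lra.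
by rewrite ler_norml => /andP[h3 h4]; apply/andP; split; lra.
Qed.

Lemma step_weight_posmx k : posmx (A k).
Proof.
move=> x; rewrite -/(form (A k) x); have [r -> /andP[r0 _]] := form_step_weight k x.
by rewrite ler0c; have := nsqmx_ge0 x; lra.
Qed.

Lemma step_weight_unit k : A k \in unitmx.
Proof.
rewrite -row_free_unit; apply: inj_row_free => v vA.
have [r] := form_step_weight k (v ^t*).
rewrite /form trmxCK vA mul0mx mxE => -[<-] /andP[h _].
have {h} v0 : nsqmx (v ^t*) = 0.
  by apply/eqP; rewrite eq_le nsqmx_ge0 andbT; lra.
apply/matrixP => i j; rewrite mxE; apply: nsq_eq0; apply/eqP.
rewrite eq_le nsq_ge0 andbT -v0 -nsq_conj -adjE.
exact: nsq_le_nsqmx.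
Qed.

Definition step_inverse := stepmx S (fun k => invmx (A k)).

Lemma step_inverseP z : step_inverse z *m W z = 1%:M.
Proof.
have [k Sk] := partition_ex z partS.
by rewrite (step_weightE Sk) /step_inverse (stepmxE _ partS Sk) mulVmx// step_weight_unit.
Qed.

Lemma step_inverse_bounded i j : bounded_ae (fun z => step_inverse z i j).
Proof. exact: stepmx_bounded. Qed.

Lemma step_weight_bounded i j : bounded_ae (fun z => W z i j).
Proof. by rewrite step_weight_stepmx; exact: stepmx_bounded. Qed.

Lemma step_weight_matrix_weight : matrix_weight W.
Proof.
split=> [i j|]; first by have [[mRe mIm] _] := step_weight_bounded i j; split.
exists (1 / 2), (3 / 2); split; [by lra|by lra|]; apply: arc_aeW => z.
have [k Sk] := partition_ex z partS; rewrite (step_weightE Sk).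
split=> x; rewrite -/(form (_ - _) x) formB -scalemx1 formZ form1;
  have [r -> /andP[r1 r2]] := form_step_weight k x; rewrite -rmorphM -rmorphB ler0c /=; lra.
Qed.

Lemma step_weight_sqrtmx z x : ((nsqmx (sqrtmx (W z) *m x))%:C)%C = form (W z) x.
Proof.
have [k Sk] := partition_ex z partS.
by rewrite (step_weightE Sk); apply: ell2norm_sqrtmx; exact: step_weight_posmx.
Qed.

Lemma ell2norm_step_weight_inj : injective D -> injective (fun k => ell2norm (sqrtmx (A k))).
Proof.
move=> injD j k /ell2norm_eq jk; apply: injD.
have : A j = A k.
  apply: form_inj => x.
  have ej := ell2norm_sqrtmx x (step_weight_posmx j).
  have ek := ell2norm_sqrtmx x (step_weight_posmx k).
  move: jk ej ek; move: (sqrtmx (A j)) (sqrtmx (A k)) => Mj Mk jk ej ek; apply: (etrans (esym ej)); apply: (etrans _ ek).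
  by rewrite -(form_gram Mj x) jk form_gram.
move/addrI/(congr1 (fun M => ((eps^-1)%:C)%C *: M)).
have e : ((eps^-1)%:C)%C * ((eps%:C)%C) = 1 :> C 
  by apply: complex_eqP; rewrite !ReImE /= ?mulr0 ?mul0r ?subr0 ?addr0 ?mulVf ?gt_eqF.
by rewrite /= !scalerA e !scale1r.
Qed.

(** Applied to [eps0], it keeps every later [eps] below the inverse of the norm of [Delta]; the
    product form also makes sense when that norm is 0. *)
Lemma step_normLoo_le : (normLoo Delta <= B%:E)%E -> (eps%:E * normLoo Delta <= 1)%E.
Proof.
move=> h; have : (eps%:E * normLoo Delta <= eps%:E * B%:E)%E.
  by apply: lee_wpmul2l => //; rewrite lee_fin ltW.
by move/le_trans; apply; rewrite lee_fin; have := epsB; lra.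
Qed.

End step_weights.

Section distribution.
Variables (R : realType) (N : nat) (T : Type).
Local Notation m := (@arc_length R).
Variables (S : 'I_N -> set (circle R)) (X : circle R -> T) (v : 'I_N -> T).
Hypothesis partS : measurable_partition S.
Hypothesis Xv : forall k z, S k z -> X z = v k.

Lemma step_preimage (Q : set T) : m (X @^-1` Q) = (\sum_(k \in [set k | Q (v k)]) m (S k))%E.
Proof.
have [mS tS _] := partS; rewrite -measure_fin_bigcup//; [|exact: finite_finset|exact: sub_trivIset tS].
congr (m _); apply/seteqP; split=> [z /= Qz|z [k /= Qk Sk]]; last by rewrite (Xv Sk).
by have [k Sk] := partition_ex z partS; exists k; rewrite //= -(Xv Sk).
Qed.

Lemma step_range : (forall k, S k !=set0) -> range X = range v.
Proof.
move=> S0; apply/seteqP; split=> [_ [z _ <-]|_ [k _ <-]].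
  by have [k Sk] := partition_ex z partS; exists k => //; rewrite (Xv Sk).
by have [z Sk] := S0 k; exists z => //; exact: Xv.
Qed.

End distribution.

Lemma step_same_distribution (R : realType) N (T : Type) (S S' : 'I_N -> set (circle R))
    (X X' : circle R -> T) (v : 'I_N -> T) :
  measurable_partition S -> measurable_partition S' ->
  (forall k, arc_length (S k) = arc_length (S' k)) ->
  (forall k z, S k z -> X z = v k) -> (forall k z, S' k z -> X' z = v k) ->
  same_distribution X X'.
Proof.
move=> pS pS' mSS' Xv Xv' Q; rewrite (step_preimage pS Xv) (step_preimage pS' Xv').
by apply: eq_fsbigr => k _; exact: mSS'.
Qed.

Lemma ord3_third (a b : 'I_3) : a != b ->
  exists c : 'I_3, forall k : 'I_3, [\/ k = c, k = a | k = b].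
Proof.
(* The indices 0, 1 and 2 add up to 3, so [3 - a - b] is the third one. *)
move=> ab; have lt : (3 - a - b < 3)%N.
  by move: ab; rewrite -val_eqE /=; case: a => [a ?]; case: b => [b ?] /=; lia.
exists (Ordinal lt) => k; have : [|| k == Ordinal lt, k == a | k == b].
  by move: ab; rewrite -!val_eqE /=; case: a lt => [a ?]; case: b => [b ?]; case: k => [k ?] /=; lia.
by case/or3P => /eqP; [exact: Or31|exact: Or32|exact: Or33].
Qed.

(** * Comparison of the two partitions *)

Section two_partitions.
Variables (R : realType) (N n : nat).
Local Notation C := R[i].
Local Notation m := (@arc_length R).
Variables (S S' : 'I_N -> set (circle R)) (D : 'I_N -> 'M[C]_n).
Hypothesis partS : measurable_partition S.
Hypothesis partS' : measurable_partition S'.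
Hypothesis mSS' : forall k, m (S k) = m (S' k).

Lemma mxseries_two_valued (a c : 'I_N) :
  (forall k, [\/ k = c, D k = D a | m (S k) = 0%E]) ->
  mxseries (fun k => sqabsmx (fourier (stepmx S D) k.+1%:Z)) =
  mxseries (fun k => sqabsmx (fourier (stepmx S' D) k.+1%:Z)).
Proof.
move=> two; apply: (mxseries_energy_eq (fun i j => stepmx_bounded D i j partS)
  (fun i j => stepmx_bounded D i j partS')) => x.
rewrite (perturbation_energy_two_valued x partS two).
rewrite (perturbation_energy_two_valued (a := a) (c := c) x partS').
  by rewrite /ind_energy mSS'.
by move=> k; rewrite -mSS'.
Qed.

Lemma mean_stepmx : fourier (stepmx S D) 0 = fourier (stepmx S' D) 0.
Proof.
apply/matrixP => i j; apply: (etrans (fourierE _ _ _ _)); apply/esym.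
apply: (etrans (fourierE _ _ _ _)); apply: (etrans (coef_stepmx D i j 0 partS')); apply/esym.
apply: (etrans (coef_stepmx D i j 0 partS)).
have [mS _ _] := partS; have [mS' _ _] := partS'.
by apply: eq_bigr => l _; rewrite (coef_ind0 (mS l)) (coef_ind0 (mS' l)) mSS'.
Qed.

Lemma linear_part_step eps x :
  linear_part (stepmx S D) eps x = linear_part (stepmx S' D) eps x.
Proof.
exact: (linear_part_eq eps x (fun i j => stepmx_bounded D i j partS)
  (fun i j => stepmx_bounded D i j partS') mean_stepmx).
Qed.

End two_partitions.

(** If [q = q'], the two expansions force [eps^2 |s - s'|] below the total error
    [2 B eps^3 (s + s')], which fails for [eps < delta]; the [+ 1] in [delta] keeps its denominator
    positive. The other bound [1 / (2 B)] gives [eps0 * B <= 1 / 2], and then [eps0 < 1] because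
    [B >= 1]. *)
Lemma energy_gap (R : realFieldType) (s s' B : R) :
  0 <= s -> 0 <= s' -> 1 <= B -> s != s' ->
  exists eps0, [/\ 0 < eps0, eps0 < 1, eps0 * B <= 1 / 2 &
    forall L q q' eps, 0 < eps -> eps < eps0 ->
    `|q - (L - eps ^+ 2 * s)| <= 2 * B * eps ^+ 3 * s ->
    `|q' - (L - eps ^+ 2 * s')| <= 2 * B * eps ^+ 3 * s' -> q <> q'].
Proof.
move=> s0 s'0 B1 ss'; have B0 : 0 < B by lra.
have d0 : 0 < 2 * B * (s + s') + 1 by rewrite ltr_pwDr// !mulr_ge0 ?addr_ge0 ?(ltW B0).
pose delta := `|s - s'| / (2 * B * (s + s') + 1).
have delta0 : 0 < delta by rewrite divr_gt0// normr_gt0 subr_eq0.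
have BV : 1 / (2 * B) * B = 1 / 2 by field; rewrite gt_eqF.
exists (Num.min (1 / (2 * B)) delta).
have le1 : Num.min (1 / (2 * B)) delta <= 1 / (2 * B) by rewrite ge_min lexx.
have le2 : Num.min (1 / (2 * B)) delta <= delta by rewrite ge_min lexx orbT.
have gt0 : 0 < Num.min (1 / (2 * B)) delta.
  by rewrite lt_min delta0 andbT divr_gt0// mulr_gt0.
move: (Num.min _ _) le1 le2 gt0 => e0 le1 le2 gt0.
have e0B : e0 * B <= 1 / 2 by rewrite -BV ler_pM2r.
split => //; first by nra.
move=> L q q' eps e_gt0 /lt_le_trans/(_ le2) lt h h' qq'.
move: lt; rewrite ltr_pdivlMr// => lt.
have : `|eps ^+ 2 * (s - s')| <= 2 * B * eps ^+ 3 * s + 2 * B * eps ^+ 3 * s'.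
  have -> : eps ^+ 2 * (s - s') =
    (q - (L - eps ^+ 2 * s)) - (q' - (L - eps ^+ 2 * s')) by rewrite qq'; ring.
  by apply: le_trans (ler_normB _ _) _; exact: lerD.
rewrite normrM ger0_norm ?exprn_ge0 ?(ltW e_gt0)//.
have -> : 2 * B * eps ^+ 3 * s + 2 * B * eps ^+ 3 * s' =
  eps ^+ 2 * (eps * (2 * B * (s + s'))) by ring.
rewrite ler_pM2l ?exprn_gt0// => le.
by move: lt; rewrite mulrDr mulr1; lra.
Qed.

Theorem corollary3p2 (R : realType) (S S' : 'I_3 -> set (circle R))
    (D : 'I_3 -> 'M[R[i]]_2)
    (Delta := stepmx S D) (Delta' := stepmx S' D) :
  measurable_partition S -> measurable_partition S' ->
  (forall k, arc_length (S k) = arc_length (S' k)) ->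
  (forall k, selfadjoint (D k)) ->
  mxseries (fun n => sqabsmx (fourier Delta n.+1%:Z)) <>
    mxseries (fun n => sqabsmx (fourier Delta' n.+1%:Z)) ->
  exists eps0 : R, [/\ 0 < eps0, eps0 < 1, (eps0%:E * normLoo Delta <= 1)%E &
    forall eps : R, 0 < eps -> eps < eps0 ->
    let W z := 1%:M + (eps%:C)%C *: Delta z in
    let W' z := 1%:M + (eps%:C)%C *: Delta' z in
    let w z := sqrtmx (W z) in
    let w' z := sqrtmx (W' z) in
    [/\ matrix_weight W, matrix_weight W',
        same_distribution (ell2family w) (ell2family w'),
        (range (ell2family w) #= `I_3)%card /\
          (range (ell2family w') #= `I_3)%card &
        forall F F' : circle R -> 'M[R[i]]_2,
        normalized_right_outer W F -> normalized_right_outer W' F' ->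
        [/\ sqabsmx (holo_ext F 0) <> sqabsmx (holo_ext F' 0),
            forall x, interp0 (ell2family w) x
              = (ell2norm (holo_ext F 0) x)%:E,
            forall x, interp0 (ell2family w') x
              = (ell2norm (holo_ext F' 0) x)%:E &
            ell2norm (holo_ext F 0) <> ell2norm (holo_ext F' 0)]]].
Proof.
move=> partS partS' mSS' selfD neqT.
(* In a degenerate configuration the two series would agree; excluding it makes [D] injective and
   all pieces non-null, which is what three distinct values require. *)
have sep a c : ~ (forall k, [\/ k = c, D k = D a | arc_length (S k) = 0%E]).
  by move=> two; apply: neqT; exact: (mxseries_two_valued partS partS' mSS' two).
have injD : injective D.
  move=> a b Dab; apply: contrapT => /eqP ab.
  have [c abc] := ord3_third ab; apply: (sep a c) => k.
  by case: (abc k) => ->; [exact: Or31|exact: Or32|apply: Or32].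
have mS k : arc_length (S k) <> 0%E.
  move=> Sk0; have [a ak] : exists a : 'I_3, a != k by exists (lift k ord0); rewrite eq_sym neq_lift.
  have [c akc] := ord3_third ak; apply: (sep a c) => j.
  by case: (akc j) => ->; [exact: Or31|exact: Or32|exact: Or33].
have S0 k : S k !=set0.
  by apply/set0P/eqP => Sk; apply: (mS k); rewrite Sk measure0.
have S'0 k : S' k !=set0.
  by apply/set0P/eqP => Sk; apply: (mS k); rewrite mSS' Sk measure0.
have bD i j : bounded_ae (fun z => Delta z i j) by exact: stepmx_bounded.
have bD' i j : bounded_ae (fun z => Delta' z i j) by exact: stepmx_bounded.
(* This vector and its two energies determine [eps0], so it is fixed before [eps] and before [F] and
   [F']. *)
have [x ss'] : exists x, perturbation_energy Delta x != perturbation_energy Delta' x.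
  apply: contrapT => h; apply: neqT; apply: (mxseries_energy_eq bD bD') => x.
  by apply: contrapT => /eqP ss'; apply: h; exists x.
have [B B1 absD] := absmx_ubound D.
have B0 : 0 <= B := le_trans ler01 B1.
have D_le k y : `|complex.Re (form (D k) y)| <= B * nsqmx y.
  by apply: le_trans (Re_form_le _ _) _; apply: ler_wpM2r (absD k); exact: nsqmx_ge0.
have Delta_le (P : 'I_3 -> set (circle R)) (partP : measurable_partition P) z y :
    `|complex.Re (form (stepmx P D z) y)| <= B * nsqmx y.
  by have [k Pk] := partition_ex z partP; rewrite (stepmxE D partP Pk).
have Delta_self (P : 'I_3 -> set (circle R)) (partP : measurable_partition P) z :
    selfadjoint (stepmx P D z).
  by have [k Pk] := partition_ex z partP; rewrite (stepmxE D partP Pk).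
have Delta_Loo : (normLoo Delta <= B%:E)%E.
  apply/ess_supP; apply: arc_aeW => z; rewrite lee_fin.
  have [k Sk] := partition_ex z partS; rewrite /Delta (stepmxE D partS Sk).
  exact: le_trans (opnorm_le _) (absD k).
have [eps0 [eps0_gt0 eps0_lt1 eps0B gap]] := energy_gap (perturbation_energy_ge0 bD x)
  (perturbation_energy_ge0 bD' x) B1 ss'.
exists eps0; split; [exact: eps0_gt0|exact: eps0_lt1| |].
  exact: (step_normLoo_le eps0_gt0 eps0B Delta_Loo).
move=> eps eps_gt0 eps_lt W W' w w'.
have epsB : eps * B <= 1 / 2.
  exact: (le_trans (ler_wpM2r B0 (ltW eps_lt)) eps0B).
pose v k := ell2norm (sqrtmx (1%:M + ((eps%:C)%C) *: D k)).
have wv k z : S k z -> ell2family w z = v k.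
  by move=> Sk; rewrite /ell2family /w /W /Delta (stepmxE D partS Sk).
have w'v k z : S' k z -> ell2family w' z = v k.
  by move=> Sk; rewrite /ell2family /w' /W' /Delta' (stepmxE D partS' Sk).
have range_v : (range v #= `I_3)%card.
  have injv : injective v := ell2norm_step_weight_inj selfD D_le eps_gt0 epsB injD.
  apply: (card_eq_trans (inj_card_eq _)); first by move=> j k _ _; exact: injv.
  by rewrite card_eq_sym; exact: card_II.
split.
- exact: (step_weight_matrix_weight partS selfD D_le eps_gt0 epsB).
- exact: (step_weight_matrix_weight partS' selfD D_le eps_gt0 epsB).
- exact: (step_same_distribution partS partS' mSS' wv w'v).
- by split; [rewrite (step_range partS wv S0)|rewrite (step_range partS' w'v S'0)].
move=> F F' [outF _] [outF' _].
have bW := step_weight_bounded D eps partS; have bW' := step_weight_bounded D eps partS'.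
have bV := step_inverse_bounded D eps partS; have bV' := step_inverse_bounded D eps partS'.
have VW := step_inverseP partS selfD D_le eps_gt0 epsB.
have VW' := step_inverseP partS' selfD D_le eps_gt0 epsB.
have neq : sqabsmx (holo_ext F 0) <> sqabsmx (holo_ext F' 0).
  have e := outer_energy_expansion bD bW bV VW outF (Delta_self S partS) (Delta_le S partS)
    eps_gt0 B0 epsB x.
  have e' := outer_energy_expansion bD' bW' bV' VW' outF' (Delta_self S' partS')
    (Delta_le S' partS') eps_gt0 B0 epsB x.
  rewrite -(linear_part_step D partS partS' mSS') in e'.
  move=> eqF; apply: (gap _ _ _ _ eps_gt0 eps_lt e e').
  exact: (nsqmx_sqabsmx x eqF).
split; first exact: neq.
- exact: (interp0_outer bW bV VW outF (step_weight_sqrtmx partS selfD D_le eps_gt0 epsB)).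
- exact: (interp0_outer bW' bV' VW' outF' (step_weight_sqrtmx partS' selfD D_le eps_gt0 epsB)).
- by move=> /ell2norm_eq; exact: neq.
Qed.
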